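(* Let $\mathbb{F}$ be a finite field and let $A\in\mathbb{F}^{n\times n}$ be a generic matrix. Suppose a Frobenius normal form of $A$ and a Frobenius normal form of $A^T$ are given. Then, for any $a,b\in\mathbb{F}^{n\times 1}$ such that $A'=A+ab^T$ is generic, Frobenius normal forms of $A'$ and $(A')^T$ can be computed explicitly (i.e., all three factors) in $\widetilde{O}(n^2)$ time by a randomized algorithm that succeeds with high probability.
   Context: A matrix $A\in\mathbb{F}^{n\times n}$ is called generic if its characteristic polynomial $p_A(t)=\det(tI-A)$ equals its minimal polynomial. For generic $A$, a Frobenius normal form (FNF) of $A$ is a factorization $A=U\cdot C\cdot U^{-1}$ with $U\in\mathbb{F}^{n\times n}$ invertible and $C$ the companion matrix of $p_A$ (for $p_A(t)=t^n+c_{n-1}t^{n-1}+\dots+c_0$: ones on the subdiagonal, last column $(-c_0,\ldots,-c_{n-1})^T$, zeros elsewhere); an FNF is given/computed as the explicit matrices $U$, $C$, $U^{-1}$. Time is measured in field operations; $\widetilde{O}$ hides polylogarithmic factors in $n$. ''With high probability'' means with probability at least $1-1/n^c$ for an arbitrary chosen constant $c\ge 1$. *)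

(* Defs.v *)
From mathcomp Require Import all_boot all_order all_algebra.
From mathcomp Require Import all_classical all_reals all_analysis.
Set Implicit Arguments.
Unset Strict Implicit.
Unset Printing Implicit Defensive.
Import Order.TTheory GRing.Theory Num.Theory numFieldNormedType.Exports.
Local Open Scope ring_scope.

Section FrobeniusNormalForm.
Variables (F : fieldType) (n' : nat).
Local Notation n := n'.+1.

(* [mxminpoly] only exists for dimensions of the form n'.+1, i.e. n >= 1. *)
Definition generic (A : 'M[F]_n) : Prop := char_poly A = mxminpoly A.

(* Transposed with respect to the library's [companionmx], and with a
   dimension that does not mention [size p]. *)
Definition companion (p : {poly F}) : 'M[F]_n :=
  \matrix_(i, j) if j == n' :> nat then - p`_i else (i == j.+1 :> nat)%:R.

(* [V] is the third factor, given explicitly. *)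
Definition is_FNF (A U C V : 'M[F]_n) : Prop :=
  [/\ U \in unitmx, V = invmx U, C = companion (char_poly A)
    & A = U *m C *m V].

End FrobeniusNormalForm.

(* The machine model: a random access machine with integer cells and cells
   holding elements of a field used as a black box, presented as a structured
   imperative language.  A program is a finite syntactic object that mentions
   neither the field nor the dimension.  Both memories are divided into arrays,
   unbounded in length and designated by literals in the program text.

   A field operation, a zero test and a random draw cost one unit each.  Integer
   arithmetic and addressing are charged too, at bit cost (logarithmic-cost
   criterion), so that nothing can be gained by computing with huge integers:
   on integers of size polynomial in n an integer operation costs
   O((log n)^2).  There is no conversion from field elements to integers. *)

Inductive nop := Nadd | Nsub | Nmul | Ndiv.

Inductive nexp :=
  | NConst of nat
  | NGet of nat & nexp
  | NBin of nop & nexp & nexp.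

Inductive fexp :=
  | FZero
  | FOne
  | FGet of nat & nexp
  | FAdd of fexp & fexp
  | FSub of fexp & fexp
  | FMul of fexp & fexp
  | FDiv of fexp & fexp.

Inductive bexp :=
  | BLe of nexp & nexp
  | BFzero of fexp
  | BNot of bexp
  | BAnd of bexp & bexp.

Inductive cmd :=
  | Skip
  | Seq of cmd & cmd
  | NSet of nat & nexp & nexp
  | FSet of nat & nexp & fexp
  | FRand of nat & nexp
  | If of bexp & cmd & cmd
  | While of bexp & cmd.

Definition bitlen (x : nat) : nat := (trunc_log 2 x).+1.

Definition nop_val (o : nop) : nat -> nat -> nat :=
  match o with Nadd => addn | Nsub => subn | Nmul => muln | Ndiv => divn end.

Section Semantics.
Variable F : fieldType.

(* [tape] holds the random field elements not yet drawn. *)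
Record state := State {
  nmem : nat -> nat -> nat;
  fmem : nat -> nat -> F;
  tape : seq F }.

Definition upd (T : Type) (m : nat -> nat -> T) (a i : nat) (v : T) :=
  fun a' i' => if (a' == a) && (i' == i) then v else m a' i'.

Fixpoint nval (s : state) (e : nexp) : nat :=
  match e with
  | NConst k => k
  | NGet a i => nmem s a (nval s i)
  | NBin o e1 e2 => nop_val o (nval s e1) (nval s e2)
  end.

Fixpoint ncost (s : state) (e : nexp) : nat :=
  match e with
  | NConst k => bitlen k
  | NGet a i => ncost s i + bitlen (nval s i) + bitlen (nval s e)
  | NBin o e1 e2 =>
      ncost s e1 + ncost s e2 + bitlen (nval s e1) * bitlen (nval s e2)
  end.

(* [x / 0] is [0], as everywhere in the library. *)
Fixpoint fval (s : state) (e : fexp) : F :=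
  match e with
  | FZero => 0
  | FOne => 1
  | FGet a i => fmem s a (nval s i)
  | FAdd e1 e2 => fval s e1 + fval s e2
  | FSub e1 e2 => fval s e1 - fval s e2
  | FMul e1 e2 => fval s e1 * fval s e2
  | FDiv e1 e2 => fval s e1 / fval s e2
  end.

Fixpoint fcost (s : state) (e : fexp) : nat :=
  match e with
  | FZero | FOne => 1
  | FGet a i => ncost s i + bitlen (nval s i)
  | FAdd e1 e2 | FSub e1 e2 | FMul e1 e2 | FDiv e1 e2 =>
      (fcost s e1 + fcost s e2).+1
  end.

Fixpoint bval (s : state) (b : bexp) : bool :=
  match b with
  | BLe e1 e2 => (nval s e1 <= nval s e2)%N
  | BFzero e => fval s e == 0
  | BNot b1 => ~~ bval s b1
  | BAnd b1 b2 => bval s b1 && bval s b2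
  end.

Fixpoint bcost (s : state) (b : bexp) : nat :=
  match b with
  | BLe e1 e2 =>
      ncost s e1 + ncost s e2 + bitlen (nval s e1) + bitlen (nval s e2)
  | BFzero e => (fcost s e).+1
  | BNot b1 => (bcost s b1).+1
  | BAnd b1 b2 => (bcost s b1 + bcost s b2).+1
  end.

(* [exec p s s' t]: started in [s], the program [p] halts in [s'] after time
   [t].  A random draw from an exhausted tape is stuck. *)
Inductive exec : cmd -> state -> state -> nat -> Prop :=
  | ExecSkip s : exec Skip s s 1
  | ExecSeq p q s s' s'' t t' :
      exec p s s' t -> exec q s' s'' t' -> exec (Seq p q) s s'' (t + t')
  | ExecNSet s a i e :
      exec (NSet a i e) s
        (State (upd (nmem s) a (nval s i) (nval s e)) (fmem s) (tape s))
        (ncost s i + ncost s e + bitlen (nval s i) + bitlen (nval s e))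
  | ExecFSet s a i e :
      exec (FSet a i e) s
        (State (nmem s) (upd (fmem s) a (nval s i) (fval s e)) (tape s))
        (ncost s i + fcost s e + bitlen (nval s i)).+1
  | ExecFRand s a i x r :
      tape s = x :: r ->
      exec (FRand a i) s
        (State (nmem s) (upd (fmem s) a (nval s i) x) r)
        (ncost s i + bitlen (nval s i)).+1
  | ExecIf b p q s s' t :
      exec (if bval s b then p else q) s s' t ->
      exec (If b p q) s s' (bcost s b + t)
  | ExecWhileStop b p s :
      ~~ bval s b -> exec (While b p) s s (bcost s b)
  | ExecWhileStep b p s s' s'' t t' :
      bval s b -> exec p s s' t -> exec (While b p) s' s'' t' ->
      exec (While b p) s s'' (bcost s b + t + t').

Lemma exec_det p s s1 s2 t1 t2 :
  exec p s s1 t1 -> exec p s s2 t2 -> s1 = s2 /\ t1 = t2.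
Proof.
move=> h; elim: h s2 t2 => {p s s1 t1}.
- by move=> s s2 t2 h; inversion h.
- move=> p q s s' s'' t t' _ IHp _ IHq s2 t2 h; inversion h as [|? ? ? ? ? ? ? hp hq| | | | | | ]; subst.
  by case: (IHp _ _ hp) => ? ?; subst; case: (IHq _ _ hq) => ? ?; subst.
- by move=> s a i e s2 t2 h; inversion h.
- by move=> s a i e s2 t2 h; inversion h.
- move=> s a i x r hr s2 t2 h.
  inversion h as [| | | |? ? ? ? ? hr'| | | ]; subst.
  by move: hr; rewrite hr' => -[-> ->].
- move=> b p q s s' t _ IH s2 t2 h.
  inversion h as [| | | | |? ? ? ? ? ? hi| | ]; subst.
  by case: (IH _ _ hi) => ? ?; subst.
- move=> b p s /negPf hb s2 t2 h.
  inversion h as [| | | | | | |? ? ? ? ? ? ? hb']; subst => //.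
  by rewrite hb in hb'.
- move=> b p s s' s'' t t' hb _ IHp _ IHw s2 t2 h.
  inversion h as [| | | | | |? ? ? hb'|? ? ? ? ? ? ? hb' hp hw]; subst.
    by rewrite hb in hb'.
  by case: (IHp _ _ hp) => ? ?; subst; case: (IHw _ _ hw) => ? ?; subst.
Qed.

(* Row-major encoding of a matrix as an array, padded with zeros. *)
Definition array_of_mx (m n : nat) (M : 'M[F]_(m, n)) (l : nat) : F :=
  match insub (l %/ n)%N, insub (l %% n)%N with
  | Some i, Some j => M i j
  | _, _ => 0
  end.

Definition mx_of_array (m n : nat) (x : nat -> F) : 'M[F]_(m, n) :=
  \matrix_(i, j) x (i * n + j)%N.

Lemma array_of_mxK m n (M : 'M[F]_(m, n)) :
  mx_of_array m n (array_of_mx M) = M.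
Proof.
apply/matrixP => i j; rewrite mxE /array_of_mx.
have n_gt0 : (0 < n)%N by apply: leq_ltn_trans (ltn_ord j).
rewrite divnMDl // divn_small ?ltn_ord // addn0 modnMDl modn_small ?ltn_ord //.
by rewrite !valK.
Qed.

(* Initially integer cell 0 of array 0 holds n, field arrays 0-2 and 3-5 hold
   the factors of the two given normal forms, and field arrays 6 and 7 hold the
   two vectors; all other cells are zero.  The decomposed matrix
   itself is not in memory. *)
Definition init_state (n : nat) (U C V Ut Ct Vt : 'M[F]_n) (a b : 'cV[F]_n)
    (r : seq F) : state :=
  State
    (fun k l => if (k == 0) && (l == 0) then n else 0)%N
    (fun k => match k with
      | 0 => array_of_mx U
      | 1 => array_of_mx C
      | 2 => array_of_mx V
      | 3 => array_of_mx Ut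
      | 4 => array_of_mx Ct
      | 5 => array_of_mx Vt
      | 6 => array_of_mx a
      | 7 => array_of_mx b
      | _ => fun=> 0%R
      end)%N
    r.

Definition output (n : nat) (s : state) (k : nat) : 'M[F]_n :=
  mx_of_array n n (fmem s k).

End Semantics.

(* Probability of [E] when [m] elements of [F] are drawn independently and
   uniformly. *)
Definition prob (R : realType) (F : finFieldType) (m : nat)
    (E : m.-tuple F -> Prop) : R :=
  #|[set r : m.-tuple F | `[< E r >]]|%:R / (#|F| ^ m)%:R.

Local Open Scope classical_set_scope.

(* f = O(g (log n)^k) for some constant k *)
Definition soft_O (R : realType) (f g : nat -> R) : Prop :=
  exists k : nat, f =O_\oo (fun n : nat => g n * ln (n%:R : R) ^+ k).

(* Main.v *)
(* Let A = U C V with C companion, alpha = V a and beta = U^T b, so that A' is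
   U M V with M = C + alpha beta^T.  Writing p for the characteristic polynomial
   of A, the F[X]-module defined by M is generated by e_0 and alpha with the
   relations p e_0 = r1 alpha and alpha(X) e_0 = r2 alpha, whose coefficients are
   correlations of p and alpha with beta; hence the characteristic polynomial of
   A' is p r2 - alpha(X) r1.  If d = gcd(p, alpha(X)) and s is the part of this
   polynomial prime to d, then alpha + s(M) e_0 is a cyclic vector of M: no
   random choice is needed.

   The Krylov matrix U' of A' on this vector is U times that of M.  Since M is a
   rank one perturbation of C, each of its rows is a correlation of a linear
   recurrent sequence with known initial terms (the row of U), corrected by a
   convolution; this takes one fast polynomial product per row.  The same
   applied to A^T yields the Krylov matrix of A'^T on a vector z.  The inverse of
   U' is then read off the inverse of the Hankel matrix of the sequence
   z^T A'^k w, i.e. off one modular inverse of a polynomial, again with one fast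
   product per row.

   Products over an arbitrary field use Schoenhage's algorithm: a recursive FFT
   over F[x]/Phi with Phi cyclotomic of order 2^K or, in characteristic 2, 3^K. *)
Require Import Defs.
From HB Require Import structures.
From mathcomp Require Import all_boot all_order all_algebra.
From mathcomp Require Import all_classical all_reals all_analysis.
From mathcomp Require Import zify ring.
Set Implicit Arguments.
Unset Strict Implicit.
Unset Printing Implicit Defensive.
Import Order.TTheory GRing.Theory Num.Theory.

(** * Programs with bounded loops *)

(** Two obstacles shape the proof. First, the machine has only [While] and charges integer
    operations by bit length. The algorithm is therefore written in a language of bounded loops,
    whose time bound is a function of the syntax alone ([weight]); the exponent 2 of n is found by
    evaluating [degn] on the finished program. Recursion is absent too: the multiplication treats
    all blocks of one recursion level at once, and the levels are loop iterations. Second, the field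
    may be tiny: it may lack roots of unity, which are adjoined formally, and a random vector need
    not be cyclic with high probability, so the cyclic vector is built from gcds. Genericity enters
    through the minimal polynomial: it identifies p r2 - alpha(X) r1 with the characteristic
    polynomial, and it forbids a common factor of p, alpha(X), r1 and r2. The two normal forms are
    needed together, because inverting the Krylov matrix of A' uses the Krylov matrix of its
    transpose; the residue form of F[X] modulo the characteristic polynomial replaces the Hankel
    inverse by a modular product. *)

Local Open Scope nat_scope.

(* [PFor v e a b p] runs [p] with the cell 0 of the integer array [v] ranging
   over 0, ..., e - 1, where e is evaluated once and kept in the array v + 1;
   (a, b) announces a trip count of O(n^a (log n)^b). *)
Inductive prog :=
  | PSkip
  | PSeq of prog & prog
  | PNSet of nat & nexp & nexp
  | PFSet of nat & nexp & fexp
  | PIf of bexp & prog & prog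
  | PFor of nat & nexp & nat & nat & prog.

Definition nvar v := NGet v (NConst 0).

Fixpoint compile (p : prog) : cmd :=
  match p with
  | PSkip => Skip
  | PSeq p q => Seq (compile p) (compile q)
  | PNSet a i e => NSet a i e
  | PFSet a i e => FSet a i e
  | PIf b p q => If b (compile p) (compile q)
  | PFor v e _ _ p =>
      Seq (NSet v.+1 (NConst 0) e)
     (Seq (NSet v (NConst 0) (NConst 0))
     (While (BNot (BLe (nvar v.+1) (nvar v)))
        (Seq (compile p) (NSet v (NConst 0) (NBin Nadd (nvar v) (NConst 1))))))
  end.

(* Integer and field arrays that a program may write. *)
Fixpoint wN (p : prog) : seq nat :=
  match p with
  | PSkip | PFSet _ _ _ => [::]
  | PSeq p q | PIf _ p q => wN p ++ wN q
  | PNSet a _ _ => [:: a]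
  | PFor v _ _ _ p => [:: v, v.+1 & wN p]
  end.

Fixpoint wF (p : prog) : seq nat :=
  match p with
  | PSkip | PNSet _ _ _ => [::]
  | PSeq p q | PIf _ p q => wF p ++ wF q
  | PFSet a _ _ => [:: a]
  | PFor v _ _ _ p => wF p
  end.

(** The counter and its bound must survive the body, and [a + b <= 3] keeps trip counts, hence
    counters, below [cellmax], which is of order n^3. *)
Fixpoint wf (p : prog) : bool :=
  match p with
  | PSkip | PNSet _ _ _ | PFSet _ _ _ => true
  | PSeq p q | PIf _ p q => wf p && wf q
  | PFor v _ a b p =>
      [&& v \notin wN p, v.+1 \notin wN p, a + b <= 3 & wf p]
  end.

Section Den.
Variable F : fieldType.
Implicit Types s : state F.

Definition setN v i x s := State (upd (nmem s) v i x) (fmem s) (tape s).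
Definition setF v i x s := State (nmem s) (upd (fmem s) v i x) (tape s).
Definition incr v s := setN v 0 (nmem s v 0).+1 s.

Fixpoint den (p : prog) (s : state F) : state F :=
  match p with
  | PSkip => s
  | PSeq p q => den q (den p s)
  | PNSet a i e => setN a (nval s i) (nval s e) s
  | PFSet a i e => setF a (nval s i) (fval s e) s
  | PIf b p q => if bval s b then den p s else den q s
  | PFor v e _ _ p =>
      iter (nval s e) (fun s => incr v (den p s))
        (setN v 0 0 (setN v.+1 0 (nval s e) s))
  end.

Definition frame (lN lF : seq nat) s s' :=
  [/\ forall a, a \notin lN -> nmem s' a =1 nmem s a,
      forall a, a \notin lF -> fmem s' a =1 fmem s a & tape s' = tape s].

Lemma frame_refl lN lF s : frame lN lF s s.
Proof. by []. Qed.

Lemma frame_trans lN lF s1 s2 s3 :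
  frame lN lF s1 s2 -> frame lN lF s2 s3 -> frame lN lF s1 s3.
Proof.
move=> [a1 b1 c1] [a2 b2 c2]; split=> [a ha i|a ha i|].
- by rewrite a2 // a1.
- by rewrite b2 // b1.
- by rewrite c2.
Qed.

Lemma frame_sub lN lF lN' lF' s1 s2 :
  {subset lN <= lN'} -> {subset lF <= lF'} ->
  frame lN lF s1 s2 -> frame lN' lF' s1 s2.
Proof.
move=> hN hF [a1 b1 c1]; split=> // a ha i.
  by apply: a1; apply: contra ha; apply: hN.
by apply: b1; apply: contra ha; apply: hF.
Qed.

Lemma frame_setN v i x s : frame [:: v] [::] s (setN v i x s).
Proof. by split=> // a; rewrite inE => /negPf ha j; rewrite /= /upd ha. Qed.

Lemma frame_setF v i x s : frame [::] [:: v] s (setF v i x s).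
Proof. by split=> // a; rewrite inE => /negPf ha j; rewrite /= /upd ha. Qed.

Lemma frame_den p s : frame (wN p) (wF p) s (den p s).
Proof.
elim: p s => [|p IHp q IHq|a i e|a i e|b p IHp q IHq|v e ca cb p IHp] s /=.
- exact: frame_refl.
- apply: frame_trans (frame_sub _ _ (IHp s)) (frame_sub _ _ (IHq _));
  by move=> x; rewrite mem_cat => ->; rewrite ?orbT.
- exact: frame_setN.
- exact: frame_setF.
- by case: ifP => _; [apply: frame_sub (IHp s)|apply: frame_sub (IHq s)];
  move=> x; rewrite mem_cat => ->; rewrite ?orbT.
- have iF m : forall s0, frame [:: v, v.+1 & wN p] (wF p) s0
      (iter m (fun s => incr v (den p s)) s0).
    elim: m => [|m IHm] s0 /=; first exact: frame_refl.
    apply: frame_trans (IHm _) _.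
    apply: frame_trans (frame_sub _ _ (IHp _)) (frame_sub _ _ (frame_setN _ _ _ _)) => //;
    by move=> x; rewrite !inE // => ->; rewrite ?orbT.
  apply: frame_trans (iF _ _).
  apply: frame_trans (frame_sub _ _ (frame_setN _ _ _ _)) (frame_sub _ _ (frame_setN _ _ _ _)) => //;
  by move=> x; rewrite !inE // => ->; rewrite ?orbT.
Qed.

End Den.

(** * Bit lengths and the time bound of compiled programs *)

Lemma bitlen_gt0 x : 0 < bitlen x. Proof. by []. Qed.

Lemma bitlen_le x k : (bitlen x <= k) = (x < 2 ^ k) && (0 < k).
Proof.
rewrite /bitlen; case: k => [|k]; first by rewrite andbF.
rewrite andbT ltnS; case: (posnP x) => [->|x_gt0].
  by rewrite trunc_log0 expn_gt0.
apply/idP/idP => h.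
  by apply: leq_trans (trunc_log_ltn _ (isT : 1 < 2)) _; rewrite leq_pexp2l.
have h2 : 2 ^ trunc_log 2 x < 2 ^ k.+1 by apply: leq_ltn_trans h; apply: trunc_logP.
by move: h2; rewrite ltn_exp2l.
Qed.

Lemma bitlenP x : x < 2 ^ bitlen x.
Proof. by have := leqnn (bitlen x); rewrite {1}bitlen_le => /andP[]. Qed.

Lemma leq_bitlen x y : x <= y -> bitlen x <= bitlen y.
Proof. by move=> h; rewrite bitlen_le andbT (leq_ltn_trans h (bitlenP y)). Qed.

Lemma bitlenD x y : bitlen (x + y) <= bitlen x + bitlen y.
Proof.
rewrite bitlen_le addn_gt0 andbT expnD.
have := bitlenP x; have := bitlenP y.
by case: x => [|x]; case: y => [|y]; rewrite ?addn0 ?add0n => h1 h2; nia.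
Qed.

Lemma bitlenM x y : bitlen (x * y) <= bitlen x + bitlen y.
Proof.
rewrite bitlen_le addn_gt0 andbT expnD.
by have := bitlenP x; have := bitlenP y; nia.
Qed.

Lemma bitlenX x k : bitlen (x ^ k) <= (bitlen x * k).+1.
Proof.
elim: k => [|k IH]; first by rewrite expn0 muln0.
rewrite expnS; apply: leq_trans (bitlenM _ _) _; lia.
Qed.

Lemma bitlen_self x : 0 < x -> bitlen x <= x.
Proof. by move=> h; rewrite bitlen_le h andbT ltn_expl. Qed.

(* Bounds, in multiples of log X or (log X)^2, for values and costs of
   expressions evaluated in a state whose integers are at most X. *)
Fixpoint nsize (e : nexp) : nat :=
  match e with
  | NConst k => bitlen k
  | NGet _ _ => 1
  | NBin _ e1 e2 => nsize e1 + nsize e2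
  end.

Fixpoint nweight (e : nexp) : nat :=
  match e with
  | NConst k => bitlen k
  | NGet _ i => nweight i + nsize i + 1
  | NBin _ e1 e2 => nweight e1 + nweight e2 + nsize e1 * nsize e2
  end.

Fixpoint fweight (e : fexp) : nat :=
  match e with
  | FZero | FOne => 1
  | FGet _ i => nweight i + nsize i
  | FAdd e1 e2 | FSub e1 e2 | FMul e1 e2 | FDiv e1 e2 =>
      (fweight e1 + fweight e2).+1
  end.

Fixpoint bweight (e : bexp) : nat :=
  match e with
  | BLe e1 e2 => nweight e1 + nweight e2 + nsize e1 + nsize e2
  | BFzero e => (fweight e).+1
  | BNot b => (bweight b).+1
  | BAnd b1 b2 => (bweight b1 + bweight b2).+1
  end.

(* 2^20 is arbitrary, large enough for every loop of the algorithm. *)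
Definition tripc := locked (2 ^ 20).
Definition trip n a b := tripc * n ^ a * bitlen n ^ b.
Definition cellmax n := tripc * n ^ 3.

Section Weight.
Variable n : nat.
(** In units of the squared bit length of [cellmax n]. The 40 covers the test and the increment of
    one iteration, the 30 the two initialisations and the last, failing test; a conditional is
    charged for both branches. *)
Fixpoint weight (p : prog) : nat :=
  match p with
  | PSkip => 1
  | PSeq p q => weight p + weight q
  | PNSet a i e => nweight i + nweight e + nsize i + nsize e
  | PFSet a i e => (nweight i + fweight e + nsize i).+1
  | PIf b p q => bweight b + weight p + weight q
  | PFor v e a b p => nweight e + nsize e + 30 + trip n a b * (weight p + 40)
  end.
End Weight.

Section Exec.
Variables (F : fieldType) (n : nat).
Hypothesis n_gt0 : 0 < n.
Implicit Types s : state F.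
Let X := cellmax n.
Let L := bitlen X.

Definition small s := forall a i, nmem s a i <= X.

(** The side conditions that make [weight] a valid bound: integers written stay below [cellmax], and
    loops keep to the trip counts they announce. Addresses need no condition, since [nsizeP] bounds
    every expression over small cells. *)
Fixpoint ok (p : prog) (s : state F) : Prop :=
  match p with
  | PSkip | PFSet _ _ _ => True
  | PSeq p q => ok p s /\ ok q (den p s)
  | PNSet a i e => nval s e <= X
  | PIf b p q => if bval s b then ok p s else ok q s
  | PFor v e a b p =>
      nval s e <= trip n a b /\
      forall i, i < nval s e ->
       ok p (iter i (fun s => incr v (den p s))
        (setN v 0 0 (setN v.+1 0 (nval s e) s)))
  end.

(** Bit length is subadditive under sums and products, while differences and quotients do not exceed
    their first argument. *)
Lemma nsizeP e s : small s -> bitlen (nval s e) <= nsize e * L.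
Proof.
have L_gt0 : 0 < L by [].
move=> hs; elim: e => [k|a i _|o e1 h1 e2 h2] /=.
- by rewrite leq_pmulr.
- by rewrite mul1n leq_bitlen.
- rewrite mulnDl; case: o => /=.
  + by apply: leq_trans (bitlenD _ _) (leq_add h1 h2).
  + by apply: leq_trans (leq_bitlen (leq_subr _ _)) _; apply: leq_trans h1 (leq_addr _ _).
  + by apply: leq_trans (bitlenM _ _) (leq_add h1 h2).
  + by apply: leq_trans (leq_bitlen (leq_div _ _)) _; apply: leq_trans h1 (leq_addr _ _).
Qed.

Lemma nweightP e s : small s -> ncost s e <= nweight e * L ^ 2.
Proof.
have L_gt0 : 0 < L by [].
move=> hs; elim: e => [k|a i h|o e1 h1 e2 h2] /=.
- by rewrite leq_pmulr // expn_gt0 L_gt0.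
- have := nsizeP i hs; have : bitlen (nmem s a (nval s i)) <= L by exact: leq_bitlen.
  by move: h; nia.
- by have := nsizeP e1 hs; have := nsizeP e2 hs; move: h1 h2; nia.
Qed.

Lemma fweightP e s : small s -> fcost s e <= fweight e * L ^ 2.
Proof.
have L_gt0 : 0 < L by [].
move=> hs; elim: e => [||a i|e1 h1 e2 h2|e1 h1 e2 h2|e1 h1 e2 h2|e1 h1 e2 h2] /=;
  rewrite ?mul1n ?expn_gt0 ?L_gt0 //; last 4 first; [nia..|].
by have := nsizeP i hs; have := nweightP i hs; nia.
Qed.

Lemma bweightP e s : small s -> bcost s e <= bweight e * L ^ 2.
Proof.
have L_gt0 : 0 < L by [].
move=> hs; elim: e => [e1 e2|e|b h|b1 h1 b2 h2] /=; last 2 first; [nia..| | ].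
- have := nsizeP e1 hs; have := nsizeP e2 hs.
  by have := nweightP e1 hs; have := nweightP e2 hs; nia.
- by have := fweightP e hs; nia.
Qed.

Lemma small_setN v i x s : small s -> x <= X -> small (setN v i x s).
Proof. by move=> hs hx a j /=; rewrite /upd; case: ifP. Qed.

Lemma trip_cellmax a b : a + b <= 3 -> trip n a b <= X.
Proof.
move=> hab; rewrite /trip /X /cellmax -mulnA leq_mul2l; apply/orP; right.
apply: (@leq_trans (n ^ a * n ^ b)).
  rewrite leq_mul2l; apply/orP; right.
  by case: (b) => // k; rewrite leq_exp2r // bitlen_self.
by rewrite -expnD leq_pexp2l.
Qed.

(** The bridge from the total function [den] to the execution relation: later proofs speak of values
    only, never of time or derivations. *)
Lemma exec_compile p s : wf p -> small s -> ok p s ->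
  small (den p s) /\
  exists2 t, t <= weight n p * L ^ 2 & exec (compile p) s (den p s) t.
Proof.
have L_gt0 : 0 < L by [].
have L2_gt0 : 0 < L ^ 2 by rewrite expn_gt0.
elim: p s => [|p IHp q IHq|a i e|a i e|b p IHp q IHq|v e ca cb p IHp] s /=.
- by move=> _ hs _; split=> //; exists 1; [rewrite mul1n|constructor].
- move=> /andP[wp wq] hs [op oq].
  have [hs' [t1 b1 e1]] := IHp _ wp hs op.
  have [hs'' [t2 b2 e2]] := IHq _ wq hs' oq.
  split=> //; exists (t1 + t2); first by rewrite mulnDl leq_add.
  by econstructor; eauto.
- move=> _ hs oe; split; first exact: small_setN.
  eexists; last by constructor.
  have := nsizeP i hs; have := nsizeP e hs.
  by have := nweightP i hs; have := nweightP e hs; nia.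
- move=> _ hs _; split; first by [].
  eexists; last by constructor.
  by have := nsizeP i hs; have := nweightP i hs; have := fweightP e hs; nia.
- move=> /andP[wp wq] hs; have hb := bweightP b hs; case: ifP => eb o.
    have [hs' [t1 b1 e1]] := IHp _ wp hs o.
    split=> //; exists (bcost s b + t1); first by nia.
    by constructor; rewrite eb.
  have [hs' [t1 b1 e1]] := IHq _ wq hs o.
  split=> //; exists (bcost s b + t1); first by nia.
  by constructor; rewrite eb.
- move=> /and4P[v1 v2 cab wp] hs [mtrip oi].
  set m := nval s e in mtrip oi *.
  have mX : m <= X by apply: leq_trans mtrip (trip_cellmax cab).
  set s0 := setN v 0 0 _ in oi *.
  have hs0 : small s0 by do 2?apply: small_setN.
  set f := fun s => _ in oi *.
  (* By [wf] the body writes neither [v] nor [v.+1], so these cells still hold the iteration number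
     and the bound. *)
  have vals i : nmem (iter i f s0) v.+1 0 = m /\ nmem (iter i f s0) v 0 = i.
    elim: i => [|i [IH1 IH2]] /=.
      by rewrite /upd !eqxx /= (gtn_eqF (ltnSn v)).
    have [dN _ _] := frame_den p (iter i f s0).
    by rewrite /upd !eqxx /= (gtn_eqF (ltnSn v)) /= !dN // IH1 IH2.
  (* Induction on the number k of iterations left; the 20 pays for the final test. *)
  have loop k i : i + k = m -> small (iter i f s0) ->
    small (iter m f s0) /\
    exists2 t, t <= (k * (weight n p + 40) + 20) * L ^ 2 &
     exec (While (BNot (BLe (nvar v.+1) (nvar v)))
        (Seq (compile p) (NSet v (NConst 0) (NBin Nadd (nvar v) (NConst 1)))))
        (iter i f s0) (iter m f s0) t.
    elim: k i => [|k IHk] i eim hsi.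
      rewrite addn0 in eim; rewrite -eim; split=> //.
      eexists; last first.
        by apply: ExecWhileStop; rewrite /=; case: (vals i) => -> ->; rewrite -eim leqnn.
      apply: leq_trans (bweightP _ hsi) _; by rewrite leq_mul2r; apply/orP; right.
    have lim : i < m by lia.
    have [hs1 [t1 b1 e1]] := IHp _ wp hsi (oi i lim).
    have [dN _ _] := frame_den p (iter i f s0).
    have [vm vi] := vals i.
    have hs2 : small (iter i.+1 f s0).
      by apply: small_setN => //; rewrite dN // vi (leq_trans lim).
    have [|hf [t2 b2 e2]] := IHk i.+1 _ hs2; first by lia.
    split=> //; eexists; last first.
      apply: ExecWhileStep; last 1 first.
      - exact: e2.
      - by rewrite /= vm vi -ltnNge.
      - apply: ExecSeq; first exact: e1.
        have -> : iter i.+1 f s0 = setN v (nval (den p (iter i f s0)) (NConst 0))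
           (nval (den p (iter i f s0)) (NBin Nadd (nvar v) (NConst 1))) (den p (iter i f s0)).
          by rewrite /= /f /incr addn1.
        exact: ExecNSet.
    set c := NBin Nadd (nvar v) (NConst 1); set s1 := den p _ in hs1 e1 dN *.
    have c1 : bcost (iter i f s0) (BNot (BLe (nvar v.+1) (nvar v))) <= 9 * L ^ 2.
      exact: bweightP hsi.
    have c2 : ncost s1 c <= 5 * L ^ 2 by exact: nweightP hs1.
    have c3 : bitlen (nval s1 c) <= 2 * L by exact: nsizeP hs1.
    have c4 : ncost s1 (NConst 0) <= 1 by [].
    have c5 : bitlen (nval s1 (NConst 0)) <= 1 by [].
    have c6 : L <= L ^ 2 by rewrite (leq_pexp2l L_gt0 (isT : 1 <= 2)).
    rewrite [k.+1 * _]mulSn.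
    move: c1 c2 c3 c4 c5 c6 b1 b2 L2_gt0; rewrite !mulnDl.
    set A1 := bcost _ _; set A2 := ncost _ c; set A3 := bitlen (nval _ c).
    set A4 := ncost _ _; set A5 := bitlen _.
    move: (L ^ 2) => LL; move: (weight n p) (k * _) => W kW; lia.
  have [|hf [t bt et]] := loop m 0 (add0n m); first exact: hs0.
  split=> //.
  eexists; last first.
    apply: ExecSeq; first exact: ExecNSet.
    apply: ExecSeq; first exact: ExecNSet.
    exact: et.
  have c1 := nweightP e hs; have c2 := nsizeP e hs.
  have c3 : m * (weight n p + 40) <= trip n ca cb * (weight n p + 40).
    by rewrite leq_mul2r mtrip orbT.
  have c4 : m * (weight n p + 40) * L ^ 2 <=
            trip n ca cb * (weight n p + 40) * L ^ 2 by rewrite leq_mul2r c3 orbT.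
  have c6 : L <= L ^ 2 by rewrite (leq_pexp2l L_gt0 (isT : 1 <= 2)).
  have c7 : nsize e * L <= nsize e * L ^ 2 by rewrite leq_mul2l c6 orbT.
  move: c1 c2 c4 c6 c7 bt L2_gt0; rewrite -/m !mulnDl.
  rewrite [ncost _ (NConst 0)]/= [ncost _ (NConst 0)]/= [nval _ (NConst 0)]/= [nval _ (NConst 0)]/=.
  rewrite (_ : bitlen 0 = 1) //.
  move: (L ^ 2) (trip n ca cb) (weight n p) => LL T W; lia.
Qed.

End Exec.

(** * Correctness triples *)

(** The exponent of n in the running time, read off the loop annotations ([deglog] does the same for
    log n); for a closed program it is found by computation. *)
Fixpoint degn (p : prog) : nat :=
  match p with
  | PSeq p q | PIf _ p q => maxn (degn p) (degn q)
  | PFor _ _ a _ p => a + degn p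
  | _ => 0
  end.

Fixpoint deglog (p : prog) : nat :=
  match p with
  | PSeq p q | PIf _ p q => maxn (deglog p) (deglog q)
  | PFor _ _ _ b p => b + deglog p
  | _ => 0
  end.

Fixpoint wcoef (p : prog) : nat :=
  match p with
  | PSkip => 1
  | PSeq p q => wcoef p + wcoef q
  | PNSet a i e => nweight i + nweight e + nsize i + nsize e
  | PFSet a i e => (nweight i + fweight e + nsize i).+1
  | PIf b p q => bweight b + wcoef p + wcoef q
  | PFor v e a b p => nweight e + nsize e + 30 + tripc * (wcoef p + 40)
  end.

Lemma weight_bound n p : 0 < n ->
  weight n p <= wcoef p * (n ^ degn p * bitlen n ^ deglog p).
Proof.
move=> n_gt0.
have mono a b a' b' : a <= a' -> b <= b' ->
    n ^ a * bitlen n ^ b <= n ^ a' * bitlen n ^ b'.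
  by move=> ha hb; rewrite leq_mul // leq_pexp2l.
have pos a b : 0 < n ^ a * bitlen n ^ b by rewrite muln_gt0 !expn_gt0 n_gt0.
elim: p => [|p IHp q IHq|a i e|a i e|b p IHp q IHq|v e a b p IHp] /=;
  rewrite ?expn0 ?muln1 //.
- rewrite mulnDl leq_add //.
    by apply: leq_trans IHp _; rewrite leq_mul2l mono ?leq_maxl ?orbT.
  by apply: leq_trans IHq _; rewrite leq_mul2l mono ?leq_maxr ?orbT.
- rewrite !mulnDl !leq_add ?leq_pmulr //.
    by apply: leq_trans IHp _; rewrite leq_mul2l mono ?leq_maxl ?orbT.
  by apply: leq_trans IHq _; rewrite leq_mul2l mono ?leq_maxr ?orbT.
- rewrite mulnDl leq_add ?leq_pmulr // /trip !expnD.
  have h : weight n p + 40 <= (wcoef p + 40) * (n ^ degn p * bitlen n ^ deglog p).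
    by rewrite mulnDl leq_add ?leq_pmulr.
  move: h; move: (weight n p + 40) (n ^ degn p) (bitlen n ^ deglog p).
  move=> W u w h; apply: leq_trans (leq_mul (leqnn _) h) _.
  by apply/eq_leq; lia.
Qed.

Definition farr (F : fieldType) (s : state F) a len (f : nat -> F) :=
  forall i, i < len -> fmem s a i = f i.
Definition nreg (F : fieldType) (s : state F) a x := nmem s a 0 = x.

Section Tri.
Variables (F : fieldType) (n : nat).
Implicit Types s : state F.

(* Locked, so that automation does not compute with whole programs. *)
Definition tri : prog -> state F -> (state F -> Prop) -> Prop :=
  locked (fun p s Q => ok n p s /\ Q (den p s)).

Lemma triE p s Q : tri p s Q = (ok n p s /\ Q (den p s)).
Proof. by rewrite /tri -lock. Qed.

(** Every consequence step hands over the frame computed from the syntax, so that postconditions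
    need only state what is new. *)
Lemma tri_conseq p s (P Q : state F -> Prop) : tri p s P ->
  (forall s', frame (wN p) (wF p) s s' -> P s' -> Q s') -> tri p s Q.
Proof.
by rewrite !triE => -[okp h] k; split=> //; apply: k h; apply: frame_den.
Qed.

Lemma tri_skip s (Q : state F -> Prop) : Q s -> tri PSkip s Q.
Proof. by rewrite triE. Qed.

Lemma tri_seq p q s (P Q : state F -> Prop) : tri p s P ->
  (forall s', frame (wN p) (wF p) s s' -> P s' -> tri q s' Q) ->
  tri (PSeq p q) s Q.
Proof.
rewrite !triE => -[okp h] k; have := k (den p s) (frame_den p s) h.
by rewrite triE => -[ok2 h2].
Qed.

Lemma tri_nset a i e s (Q : state F -> Prop) :
  nval s e <= cellmax n -> Q (setN a (nval s i) (nval s e) s) ->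
  tri (PNSet a i e) s Q.
Proof. by rewrite triE. Qed.

Lemma tri_fset a i e s (Q : state F -> Prop) :
  Q (setF a (nval s i) (fval s e) s) -> tri (PFSet a i e) s Q.
Proof. by rewrite triE. Qed.

Lemma tri_if b p q s (Q : state F -> Prop) :
  (bval s b -> tri p s Q) -> (~~ bval s b -> tri q s Q) ->
  tri (PIf b p q) s Q.
Proof.
rewrite !triE => h1 h2; split; rewrite /=; case: ifP => hb.
- by case: (h1 hb).
- by case: (h2 (negbT hb)).
- by case: (h1 hb).
- by case: (h2 (negbT hb)).
Qed.

(** The loop writes its counter outside the body. Hence the invariant is required after an arbitrary
    change of array [v], and at the start after one of [v] and [v.+1]. *)
Lemma tri_for v e a b p s (Q : state F -> Prop) m (I : nat -> state F -> Prop) :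
  nval s e = m -> m <= trip n a b -> v \notin wN p ->
  (forall s0, frame [:: v; v.+1] [::] s s0 -> I 0 s0) ->
  (forall i s', i < m -> frame [:: v, v.+1 & wN p] (wF p) s s' ->
     nreg s' v i -> I i s' ->
     tri p s' (fun s1 => forall s2, frame [:: v] [::] s1 s2 -> I i.+1 s2)) ->
  (forall s', frame [:: v, v.+1 & wN p] (wF p) s s' -> I m s' -> Q s') ->
  tri (PFor v e a b p) s Q.
Proof.
move=> em mt vp I0 IS IQ; rewrite triE /= em.
set s0 := setN v 0 0 _; set f := fun s => _.
have f0 : frame [:: v; v.+1] [::] s s0.
  by apply: frame_trans (frame_sub _ _ (frame_setN _ _ _ _)) (frame_sub _ _ (frame_setN _ _ _ _)) => //;
  move=> x; rewrite !inE => ->; rewrite ?orbT.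
have inv i : i <= m ->
  [/\ frame [:: v, v.+1 & wN p] (wF p) s (iter i f s0),
     nmem (iter i f s0) v 0 = i, I i (iter i f s0) &
     forall j, j < i -> ok n p (iter j f s0)].
  elim: i => [|i IH] im.
    split=> //=; last exact: I0; last by rewrite /upd !eqxx.
    apply: frame_sub f0 => // x; rewrite !inE => /orP[] ->; rewrite ?orbT //.
  have [fi vi Ii oi] := IH (ltnW im).
  have := IS _ _ im fi vi Ii; rewrite triE => -[ok1 h1].
  have fp := frame_den p (iter i f s0).
  have vp' : nmem (den p (iter i f s0)) v 0 = i by case: fp => -> .
  split.
  - apply: frame_trans fi _ => /=.
    apply: frame_trans (frame_sub _ _ fp) (frame_sub _ _ (frame_setN _ _ _ _)) => //;
    by move=> x; rewrite !inE // => ->; rewrite ?orbT.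
  - by rewrite /= /upd !eqxx vp'.
  - by apply: h1; apply: frame_setN.
  - by move=> j; rewrite ltnS leq_eqVlt => /orP[/eqP->//|/oi].
have [fm vm Im om] := inv m (leqnn m).
by split; [split|apply: IQ].
Qed.

(* For v < e, stores init + sum_(w < e') term at index eb + v of the array o;
   v and w are the cells 90 and 92, on which init and term may depend.  Integer
   arrays 90 to 93 and field array 99 are reserved for this loop. *)
Definition msum o eb e a b e' a' b' init term :=
  PFor 90 e a b
   (PSeq (PFSet 99 (NConst 0) init)
   (PSeq (PFor 92 e' a' b' (PFSet 99 (NConst 0) (FAdd (FGet 99 (NConst 0)) term)))
         (PFSet o (NBin Nadd eb (nvar 90)) (FGet 99 (NConst 0))))).

Definition sim o s s' := frame [:: 90; 91; 92; 93] [:: o; 99] s s'.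

(** The hypotheses quantify over all states that agree with [s] outside [o], the scratch array 99
    and the counters, so no term can depend on the array being written. The clause on the rest of
    [o] lets a matrix be filled row by row. *)
Lemma tri_msum o eb e a b e' a' b' init term s m B M (T0 : nat -> F) (T : nat -> nat -> F) :
  o != 99 -> nval s e = m -> m <= trip n a b ->
  (forall s' i, i < m -> sim o s s' -> nmem s' 90 0 = i -> nval s' eb = B) ->
  (forall s' i, i < m -> sim o s s' -> nmem s' 90 0 = i ->
     [/\ nval s' e' = M i, M i <= trip n a' b' & fval s' init = T0 i]) ->
  (forall s' i j, i < m -> j < M i -> sim o s s' -> nmem s' 90 0 = i ->
     nmem s' 92 0 = j -> fval s' term = T i j) ->
  tri (msum o eb e a b e' a' b' init term) s (fun s' =>
    (forall i, i < m -> fmem s' o (B + i) = (T0 i + \sum_(j < M i) T i j)%R) /\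
    (forall i, ~~ (B <= i < B + m) -> fmem s' o i = fmem s o i)).
Proof.
move=> o99 em mt hb hM hT.
pose I i s' := (forall k, k < i -> fmem s' o (B + k) = (T0 k + \sum_(j < M k) T k j)%R) /\
    (forall k, ~~ (B <= k < B + i) -> fmem s' o k = fmem s o k).
apply: (tri_for (m := m) (I := I)) => //.
- by move=> s0 [_ hF _]; split=> // k _; rewrite hF.
- move=> i s' im fr vi [Ii1 Ii2].
  have sm : sim o s s'.
    by apply: frame_sub fr => // x; rewrite !inE; case/or3P => -> //; rewrite ?orbT.
  have [eM Mt eT] := hM _ _ im sm vi.
  have sub99 s2 s3 : frame [::] [:: 99] s2 s3 -> sim o s2 s3.
    by apply: frame_sub => // x; rewrite !inE => ->; rewrite orbT.
  apply: (@tri_seq _ _ _ (fun s1 => fmem s1 99 0 = T0 i)).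
    by apply: tri_fset; rewrite /= /upd !eqxx eT.
  move=> s1 f1 e1.
  have nm1 : forall a, nmem s1 a =1 nmem s' a by case: f1 => h _ _ c; apply: h.
  have sm1 : sim o s s1 by apply: frame_trans sm (sub99 _ _ f1).
  have [eM1 _ _] := hM _ _ im sm1 (etrans (nm1 _ _) vi).
  apply: (@tri_seq _ _ _ (fun s1 => fmem s1 99 0 = T0 i + \sum_(j < M i) T i j)%R).
    apply: (tri_for (m := M i)
             (I := fun j s2 => fmem s2 99 0 = T0 i + \sum_(k < j) T i k)%R) => //.
    - by move=> s0 [_ hF _]; rewrite big_ord0 addr0 hF.
    - move=> j s2 jM f2 vj e2; apply: tri_fset => s3 [_ hF _].
      rewrite hF //= /upd !eqxx /= e2 big_ord_recr /= addrA; congr (_ + _)%R.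
      apply: hT => //.
        apply: frame_trans sm1 (frame_sub _ _ f2) => x; rewrite !inE.
          by move=> /orP[] ->; rewrite ?orbT.
        by move=> ->; rewrite orbT.
      by case: f2 => -> // _ _; rewrite nm1.
  move=> s2 f2 e2; apply: tri_fset => s3 [_ hF _].
  have sm2 : sim o s s2.
    apply: frame_trans sm1 (frame_sub _ _ f2) => x; rewrite !inE.
      by move=> /orP[] ->; rewrite ?orbT.
    by move=> ->; rewrite orbT.
  have vi2 : nmem s2 90 0 = i by case: f2 => -> // _ _; rewrite nm1.
  have o2 : fmem s2 o =1 fmem s' o.
    move=> x; have on : o \notin [:: 99] by rewrite inE.
    by case: f2 => _ -> // _; case: f1 => _ ->.
  split=> k; rewrite hF //= /upd eqxx /= vi2 (hb _ _ im sm2 vi2).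
    rewrite ltnS eqn_add2l leq_eqVlt => /orP[/eqP->|ki]; first by rewrite eqxx e2.
    by rewrite (ltn_eqF ki) o2 Ii1.
  case: eqP => [->|_ hk]; first by rewrite addnS ltnS leqnn leq_addr.
  rewrite o2 Ii2 //; apply: contra hk => /andP[-> h]; apply: leq_trans h _; lia.
Qed.

End Tri.

Lemma farr_frame (F : fieldType) lN lF (s s' : state F) a len f :
  frame lN lF s s' -> a \notin lF -> farr s a len f -> farr s' a len f.
Proof. by move=> [_ h _] ha hf i il; rewrite h // hf. Qed.

Lemma nreg_frame (F : fieldType) lN lF (s s' : state F) a x :
  frame lN lF s s' -> a \notin lN -> nreg s a x -> nreg s' a x.
Proof. by move=> [h _ _] ha; rewrite /nreg h. Qed.

(* Restates about s' every array fact about s that the frame preserves, and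
   forgets the others. *)
Ltac carry FR :=
  match type of FR with
  | frame _ _ ?s ?s' =>
    repeat match goal with
    | H : farr s ?a ?l ?f |- _ =>
        first [ move: (@farr_frame _ _ _ _ _ a l f FR isT H) => {}H | clear H ]
    | H : nreg s ?a ?x |- _ =>
        first [ move: (@nreg_frame _ _ _ _ _ a x FR isT H) => {}H | clear H ]
    end
  end.

Notation "a |+| b" := (NBin Nadd a b) (at level 50, left associativity).
Notation "a |-| b" := (NBin Nsub a b) (at level 50, left associativity).
Notation "a |*| b" := (NBin Nmul a b) (at level 40, left associativity).
Notation "a |/| b" := (NBin Ndiv a b) (at level 40, left associativity).
Notation "# k" := (NConst k) (at level 8, format "# k").
Definition nmod a b := a |-| a |/| b |*| b.
Notation "a |%| b" := (nmod a b) (at level 40, left associativity).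

Lemma nval_mod (F : fieldType) (s : state F) a b :
  nval s (a |%| b) = nval s a %% nval s b.
Proof. by rewrite /= {1}(divn_eq (nval s a) (nval s b)) addKn. Qed.

Section Nval.
Variables (F : fieldType) (s : state F).
Lemma nvalD a b : nval s (a |+| b) = nval s a + nval s b. Proof. by []. Qed.
Lemma nvalB a b : nval s (a |-| b) = nval s a - nval s b. Proof. by []. Qed.
Lemma nvalM a b : nval s (a |*| b) = nval s a * nval s b. Proof. by []. Qed.
Lemma nvalQ a b : nval s (a |/| b) = nval s a %/ nval s b. Proof. by []. Qed.
Lemma nvalC k : nval s #k = k. Proof. by []. Qed.
Lemma fvalG a e : fval s (FGet a e) = fmem s a (nval s e). Proof. by []. Qed.
Lemma fvalD a b : fval s (FAdd a b) = (fval s a + fval s b)%R. Proof. by []. Qed.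
Lemma fvalB a b : fval s (FSub a b) = (fval s a - fval s b)%R. Proof. by []. Qed.
Lemma fvalM a b : fval s (FMul a b) = (fval s a * fval s b)%R. Proof. by []. Qed.
Lemma fvalQ a b : fval s (FDiv a b) = (fval s a / fval s b)%R. Proof. by []. Qed.
End Nval.
Definition nvalE := (nval_mod, nvalD, nvalB, nvalM, nvalQ, nvalC).
Definition fvalE := (fvalG, fvalD, fvalB, fvalM, fvalQ).

Lemma subn_div a b : a - a %/ b * b = a %% b.
Proof. by rewrite {1}(divn_eq a b) addKn. Qed.

Definition cp dst src len a b :=
  msum dst #0 len a b #0 0 0 (FGet src (nvar 90)) FZero.

Section Macros.
Variables (F : fieldType) (n : nat).
Implicit Types s : state F.

Lemma trip_gt0 a b : 0 < n -> 0 < trip n a b.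
Proof.
by move=> n0; rewrite !muln_gt0 !expn_gt0 n0 andbT /tripc -lock expn_gt0.
Qed.

Lemma tri_set a e s x : nval s e = x -> x <= cellmax n ->
  tri n (PNSet a #0 e) s (fun s' => nreg s' a x).
Proof. by move=> ex xc; apply: tri_nset; rewrite ?ex // /nreg /= /upd !eqxx. Qed.

Lemma tri_setf a e s x : fval s e = x ->
  tri n (PFSet a #0 e) s (fun s' => fmem s' a 0 = x).
Proof. by move=> ex; apply: tri_fset; rewrite /= /upd !eqxx. Qed.

Lemma tri_cp dst src len a b s m f : dst != 99 -> src != 99 -> src != dst ->
  nval s len = m -> m <= trip n a b -> farr s src m f ->
  tri n (cp dst src len a b) s (fun s' => farr s' dst m f).
Proof.
move=> d99 s99 sd em mt hf.
apply: (tri_conseq (tri_msum (M := fun=> 0) (T0 := f) (T := fun _ _ => 0%R) (B := 0) _ em mt _ _ _)) => //.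
- move=> s' i im [_ hF _] vi; split=> //=; rewrite vi hF ?hf // !inE negb_or sd s99 //.
- by move=> s' _ [h _] i im; rewrite -(add0n i) h // big_ord0 GRing.addr0.
Qed.

Lemma tri_map o eb e a b init s m B T0 :
  o != 99 -> nval s e = m -> m <= trip n a b ->
  (forall s' i, i < m -> sim o s s' -> nmem s' 90 0 = i ->
     nval s' eb = B /\ fval s' init = T0 i) ->
  tri n (msum o eb e a b #0 0 0 init FZero) s (fun s' =>
    (forall i, i < m -> fmem s' o (B + i) = T0 i) /\
    (forall i, ~~ (B <= i < B + m) -> fmem s' o i = fmem s o i)).
Proof.
move=> o99 em mt h.
apply: (tri_conseq (tri_msum (M := fun=> 0) (T0 := T0) (T := fun _ _ => 0%R) (B := B) o99 em mt _ _ _)) => //.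
- by move=> s' i im sm vi; case: (h _ _ im sm vi).
- by move=> s' i im sm vi; case: (h _ _ im sm vi).
- by move=> s' _ [h1 h2]; split=> // i im; rewrite h1 // big_ord0 GRing.addr0.
Qed.

Lemma tri_sum o e a b e' a' b' term s m M T :
  o != 99 -> nval s e = m -> m <= trip n a b ->
  (forall s' i, i < m -> sim o s s' -> nmem s' 90 0 = i ->
     nval s' e' = M i /\ M i <= trip n a' b') ->
  (forall s' i j, i < m -> j < M i -> sim o s s' -> nmem s' 90 0 = i ->
     nmem s' 92 0 = j -> fval s' term = T i j) ->
  tri n (msum o #0 e a b e' a' b' FZero term) s (fun s' =>
    farr s' o m (fun i => \sum_(j < M i) T i j)%R).
Proof.
move=> o99 em mt h1 h2.
apply: (tri_conseq (tri_msum (M := M) (T0 := fun=> 0%R) (T := T) (B := 0) o99 em mt _ _ _)) => //.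
- by move=> s' i im sm vi; case: (h1 _ _ im sm vi).
- by move=> s' _ [h _] i im; rewrite -(add0n i) h // GRing.add0r.
Qed.

End Macros.

(** Expressions have no conditional. An inner sum of [1 - b] terms, with truncated subtraction,
    plays that part: it runs once if [b] is 0 and not at all otherwise. *)
Lemma sum_guard (F : fieldType) (b : nat) (x : F) :
  (\sum_(j < 1 - b) x = if b == 0 then x else 0)%R.
Proof. by case: b => [|b]; rewrite ?subSS ?sub0n ?big_ord1 ?big_ord0. Qed.

(** * Fast Fourier transform *)

Local Open Scope ring_scope.

Section Reindex.
Lemma sum_mul (V : nmodType) P l (G : nat -> V) :
  \sum_(v < P * l) G v = \sum_(u < P) \sum_(i < l) G (u * l + i)%N.
Proof.
elim: P => [|P IH]; first by rewrite mul0n !big_ord0.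
by rewrite big_ord_recr /= -IH mulSnr big_split_ord.
Qed.

Lemma div_mulDl a b w : (b < w)%N -> ((a * w + b) %/ w = a)%N.
Proof. by move=> h; rewrite divnMDl ?divn_small ?addn0 //; apply: leq_ltn_trans h. Qed.

Lemma mod_mulDl a b w : (b < w)%N -> ((a * w + b) %% w = b)%N.
Proof. by move=> h; rewrite modnMDl modn_small. Qed.

Lemma ltn_mulD a b c d : (a < c)%N -> (b < d)%N -> (a * d + b < c * d)%N.
Proof. by nia. Qed.
End Reindex.

Section Stage.
Variables (F : fieldType) (S : comNzRingType) (iota : {rmorphism F -> S}).
Implicit Types X : nat -> F.

(** A block stands for an element of [S] redundantly: as a polynomial in [z] modulo z^q - 1 rather
    than modulo the cyclotomic polynomial. Multiplication by a power of [z] is then a rotation of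
    the block and costs no field operation. *)
Definition elem X q (z : S) e := \sum_(y < q) iota (X (e * q + y)%N) * z ^+ y.

Lemma sum_rotr (f : nat -> S) q z a : (0 < q)%N -> z ^+ q = 1 ->
  (\sum_(y < q) f ((y + a) %% q)%N * z ^+ y) * z ^+ a = \sum_(y < q) f y * z ^+ y.
Proof.
move=> q0 zq; pose h (r : nat) (y : 'I_q) := Ordinal (ltn_pmod (y + r) q0).
have ha : {on [pred i | true], bijective (h a)}.
  exists (h (q - a %% q)%N) => y _; apply/val_inj => /=.
    rewrite modnDml -addnA -(modnDmr y) -(modnDml a) subnKC ?(ltnW (ltn_pmod _ _)) //.
    by rewrite modnn addn0 modn_small.
  rewrite modnDml -addnA -(modnDmr y) -(modnDmr _ a) subnK ?(ltnW (ltn_pmod _ _)) //.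
  by rewrite modnn addn0 modn_small.
rewrite mulr_suml [RHS](reindex _ ha) /=; apply: eq_bigr => y _.
by rewrite -mulrA -exprD (expr_mod _ zq).
Qed.

Lemma sum_rotl (f : nat -> S) q z r : (0 < q)%N -> z ^+ q = 1 ->
  \sum_(y < q) f ((y + (q - r %% q)) %% q)%N * z ^+ y = z ^+ r * \sum_(y < q) f y * z ^+ y.
Proof.
move=> q0 zq; rewrite -(sum_rotr _ (q - r %% q) q0 zq) mulrCA -exprD.
rewrite -(expr_mod _ zq) addnC -modnDmr subnK ?(ltnW (ltn_pmod _ _)) //.
by rewrite modnn expr0 mulr1.
Qed.

Variables (l kap s' S' : nat) (z : S).
Hypothesis l23 : (l == 2%N) || (l == 3%N).
Hypothesis lF : (l%:R : F) != 0.
Hypothesis kap_gt0 : (0 < kap)%N.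
Hypothesis zsum : \sum_(i < l) (z ^+ (l ^ kap.-1)) ^+ i = 0.
Hypothesis sS : (s' < S')%N.
Hypothesis Sk : (S' <= kap)%N.
Let q := (l ^ kap)%N.
Let P := (l ^ s')%N.
Let g := (l ^ (S' - s'.+1))%N.
Let w := (g * q)%N.
Let eps := (l ^ (kap - s'.+1))%N.

Let l_gt0 : (0 < l)%N. Proof. by case/orP: l23 => /eqP->. Qed.
Let q_gt0 : (0 < q)%N. Proof. by rewrite expn_gt0 l_gt0. Qed.
Let g_gt0 : (0 < g)%N. Proof. by rewrite expn_gt0 l_gt0. Qed.
Let P_gt0 : (0 < P)%N. Proof. by rewrite expn_gt0 l_gt0. Qed.

Lemma root_one : z ^+ q = 1.
Proof.
have -> : z ^+ q = (z ^+ (l ^ kap.-1)) ^+ l.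
  by rewrite -exprM -expnSr prednK.
move: zsum; set x := z ^+ _.
case/orP: l23 => /eqP->; rewrite !big_ord_recl big_ord0 /= /bump /= => h.
  by have := congr1 (fun t => (x - 1) * t + 1) h; rewrite mulr0 add0r => <-; ring.
by have := congr1 (fun t => (x - 1) * t + 1) h; rewrite mulr0 add0r => <-; ring.
Qed.

Let z' := z ^+ q.-1.
Let zz' : z' * z = 1. Proof. by rewrite -exprSr prednK ?root_one. Qed.

(** [S] may have zero divisors, so a ratio other than 1 does not by itself make a geometric sum
    vanish. Put x = z^(l^(kap-1)). For l = 2 or 3 and a != b the ratio is x or its inverse, and 1 +
    x + ... + x^(l-1) = 0 holds at both. *)
Lemma orth (a b : nat) : (a < l)%N -> (b < l)%N ->
  \sum_(j < l) ((z ^+ a * z' ^+ b) ^+ (P * eps)) ^+ j = (if a == b then l else 0)%:R.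
Proof.
have -> : (P * eps = l ^ kap.-1)%N.
  rewrite /P /eps -expnD; congr (_ ^ _)%N; move: sS Sk; lia.
set x := z ^+ (l ^ kap.-1); set x' := z' ^+ (l ^ kap.-1).
have xx' : x' * x = 1 by rewrite -exprMn zz' expr1n.
have -> : (z ^+ a * z' ^+ b) ^+ (l ^ kap.-1) = x ^+ a * x' ^+ b.
  by rewrite exprMn -!exprM mulnC (mulnC b) !exprM.
have x'E : x' = x ^+ l.-1.
  have xl : x ^+ l = 1 by rewrite -exprM -expnSr prednK ?root_one.
  by rewrite -[LHS]mulr1 -xl -(prednK l_gt0) exprS mulrA xx' mul1r.
have [->|neq] := eqVneq a b.
  move=> _ _; rewrite -exprMn [x * x']mulrC xx' expr1n.
  by rewrite (eq_bigr (fun=> 1)) ?sumr_const ?card_ord // => i _; rewrite expr1n.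
move: zsum neq x'E; rewrite -/x; case/orP: l23 => /eqP->; rewrite !big_ord_recl !big_ord0 /= /bump /= => h neq x'E.
  by case: a neq => [|[|a]]; case: b => [|[|b]] // _ _ _;
  rewrite x'E ?mul1r ?mulr1 ?expr1 -[RHS]h; ring.
have h0 : 1 + x + x ^+ 2 = 0 by rewrite -h; ring.
have e1 : x ^+ 2 = - 1 - x by rewrite -[LHS]addr0 -oppr0 -h0; ring.
have x3 : x ^+ 3 = 1 by rewrite exprS e1 mulrBr mulrN1 -expr2 e1; ring.
have x4 : x ^+ 4 = x by rewrite exprS x3 mulr1.
have h1 : 1 + x' + x' ^+ 2 = 0 by rewrite x'E -exprM x4 -h0; ring.
set y := x ^+ a * x' ^+ b => al bl.
suff : y = x \/ y = x'.
  by case=> ->; [rewrite -[RHS]h0|rewrite -[RHS]h1]; ring.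
rewrite /y; move: neq al bl; case: a {y} => [|[|[|a]]]; case: b => [|[|[|b]]] // _ _ _.
- by right; rewrite expr0 expr1 mul1r.
- by left; rewrite expr0 mul1r x'E -exprM x4.
- by left; rewrite expr0 expr1 mulr1.
- by right; rewrite expr1 [x' ^+ 2]expr2 mulrA [x * x']mulrC xx' mul1r.
- by right; rewrite expr0 mulr1 x'E.
- by left; rewrite expr1 expr2 -mulrA [x * x']mulrC xx' mulr1.
Qed.

Let zrot r : z' ^+ r * z ^+ r = 1. Proof. by rewrite -exprMn zz' expr1n. Qed.

Lemma sum_rotr_inv f a : \sum_(y < q) f ((y + a) %% q)%N * z ^+ y =
  z' ^+ a * \sum_(y < q) f y * z ^+ y.
Proof. by rewrite -(sum_rotr f a q_gt0 root_one) mulrCA zrot mulr1. Qed.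

Lemma elem_rotl X e r :
  z ^+ r * elem X q z e = \sum_(y < q) iota (X (e * q + (y + (q - r %% q)) %% q)%N) * z ^+ y.
Proof. by rewrite -(sum_rotl (fun y => iota (X (e * q + y)%N))) ?root_one. Qed.

Lemma elem_rotr X e a :
  z' ^+ a * elem X q z e = \sum_(y < q) iota (X (e * q + (y + a) %% q)%N) * z ^+ y.
Proof. by rewrite -(sum_rotr_inv (fun y => iota (X (e * q + y)%N))). Qed.

(** One radix-l butterfly: residue [chi] comes from residue [chi %% P] of the previous stage by
    putting z^(chi eps) for x^g. The factor z^(i chi eps) is the rotation in the last index. *)
Definition split_fun X idx : F :=
  let chi := ((idx %/ w) %% (P * l))%N in
  let blk := (idx %/ w %/ (P * l))%N in
  let y := ((idx %% w) %% q)%N in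
  \sum_(i < l) X (((blk * P + chi %% P) * l + i) * w + (idx %% w - y)
                   + (y + (q - (i * (chi * eps)) %% q)) %% q)%N.

Definition unsplit_fun X idx : F :=
  let i := ((idx %/ w) %% l)%N in
  let c := ((idx %/ w %/ l) %% P)%N in
  let blk := (idx %/ w %/ l %/ P)%N in
  let y := ((idx %% w) %% q)%N in
  \sum_(j < l) (l%:R^-1 *
    X ((blk * (P * l) + (c + j * P)) * w + (idx %% w - y)
                   + (y + i * ((c + j * P) * eps)) %% q)%N).

(* The elements of each of the first NB blocks, seen as polynomials modulo
   x^h - z^(c eps'), are reductions of the polynomial with coefficients H. *)
Definition stage_inv NB s (X : nat -> F) (H : nat -> nat -> S) :=
  forall blk c t, (blk < NB)%N -> (c < l ^ s)%N -> (t < l ^ (S' - s))%N ->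
   elem X q z ((blk * l ^ s + c) * l ^ (S' - s) + t)%N =
   \sum_(u < l ^ s) H blk (t + u * l ^ (S' - s))%N * z ^+ (c * u * l ^ (kap - s)).

Let hE : (l ^ (S' - s') = l * g)%N.
Proof. by rewrite /g -expnS -subSn. Qed.
Let PlE : (l ^ s'.+1 = P * l)%N. Proof. by rewrite expnSr. Qed.
Let Plq : (P * l * eps = q)%N.
Proof. by rewrite -PlE /eps -expnD subnKC // (leq_trans sS). Qed.

(** If chi = c modulo P, then x^g - z^(chi eps) divides x^(l g) - z^(c l eps), because z^(P l eps) =
    z^q = 1. Reducing further thus amounts to replacing x^(i g) by z^(i chi eps). *)
Lemma split_stage NB X X' H :
  (forall idx, (idx < NB * l ^ S' * q)%N -> X' idx = split_fun X idx) ->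
  stage_inv NB s' X H -> stage_inv NB s'.+1 X' H.
Proof.
move=> hX' hX blk chi t hb hchi ht; rewrite -/g -/eps PlE in hchi ht *.
pose c := (chi %% P)%N; have c_lt : (c < P)%N by rewrite ltn_pmod.
have tot : (NB * l ^ S' * q = NB * (P * l) * w)%N.
  rewrite /w -!mulnA; congr (_ * _)%N; rewrite !mulnA; congr (_ * _)%N.
  by rewrite -PlE /g -expnD subnKC.
transitivity (\sum_(i < l) z ^+ (i * (chi * eps)) *
    elem X q z ((blk * P + c) * (l ^ (S' - s')) + (i * g + t))%N).
  under [RHS]eq_bigr do rewrite elem_rotl.
  rewrite exchange_big /=; apply: eq_bigr => y _; rewrite -mulr_suml; congr (_ * _).
  rewrite hX' /split_fun; last first.
    by rewrite tot /w [(_ * (g * q))%N]mulnA; do 3!(apply: ltn_mulD => //).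
  rewrite rmorph_sum; apply: eq_bigr => i _; congr (iota (X _)).
  have tqy : (t * q + y < w)%N by rewrite ltn_mulD.
  have -> : (((blk * (P * l) + chi) * g + t) * q + y = (blk * (P * l) + chi) * w + (t * q + y))%N.
    by rewrite /w; ring.
  rewrite !(div_mulDl, mod_mulDl) // addnK.
  rewrite hE /w -/c; congr (_ + _)%N; ring.
rewrite (sum_mul P l (fun u => H blk (t + u * g)%N * z ^+ (chi * u * eps))) exchange_big /=; apply: eq_bigr => i _.
rewrite hX //; last by rewrite hE ltn_mulD.
rewrite mulr_sumr; apply: eq_bigr => u _; rewrite mulrCA hE -exprD; congr (H _ _ * _).
  ring.
rewrite -[in RHS](expr_mod _ root_one) -[in LHS](expr_mod _ root_one); congr (_ ^+ _).
rewrite [in RHS](divn_eq chi P) -/c.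
have -> : (l ^ (kap - s') = l * eps)%N by rewrite /eps -expnS -subSn // (leq_trans sS).
have -> : ((chi %/ P * P + c) * (u * l + i) * eps =
   (chi %/ P * u) * (P * l * eps) + (i * ((chi %/ P * P + c) * eps) + c * u * (l * eps)))%N by ring.
by rewrite Plq modnMDl -divn_eq.
Qed.

Lemma unsplit_stage NB X X' H :
  (forall idx, (idx < NB * l ^ S' * q)%N -> X' idx = unsplit_fun X idx) ->
  stage_inv NB s'.+1 X H -> stage_inv NB s' X' H.
Proof.
move=> hX' hX blk c t0 hb hc; rewrite hE => ht0; rewrite -/P in hc *.
have [i [t [-> il tg]]] : exists i t, [/\ t0 = i * g + t, i < l & t < g]%N.
  exists (t0 %/ g)%N, (t0 %% g)%N; rewrite -divn_eq ltn_pmod //; split=> //.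
  by rewrite ltn_divLR.
have tot : (NB * l ^ S' * q = NB * (P * l) * w)%N.
  rewrite /w -!mulnA; congr (_ * _)%N; rewrite !mulnA; congr (_ * _)%N.
  by rewrite -PlE /g -expnD subnKC.
pose chi j := (c + j * P)%N.
have chi_lt (j : 'I_l) : (chi j < P * l)%N by rewrite /chi; have := ltn_ord j; nia.
transitivity (\sum_(j < l) iota (l%:R^-1) * (z' ^+ (i * (chi j * eps)) *
    elem X q z ((blk * (P * l) + chi j) * g + t)%N)).
  under [RHS]eq_bigr do rewrite elem_rotr mulr_sumr.
  rewrite exchange_big /=; apply: eq_bigr => y _.
  under [RHS]eq_bigr do rewrite mulrA; rewrite -mulr_suml; congr (_ * _).
  rewrite hX' /unsplit_fun; last first.
    rewrite tot (_ : NB * (P * l) * w = NB * P * (l * g) * q)%N; last by rewrite /w; ring.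
    by do 2!(apply: ltn_mulD => //); apply: ltn_mulD.
  rewrite rmorph_sum; apply: eq_bigr => j _; rewrite rmorphM; congr (_ * iota (X _)).
  have tqy : (t * q + y < w)%N by rewrite ltn_mulD.
  have -> : (((blk * P + c) * (l * g) + (i * g + t)) * q + y = ((blk * P + c) * l + i) * w + (t * q + y))%N.
    by rewrite /w; ring.
  rewrite !(div_mulDl, mod_mulDl) // addnK.
  by rewrite /chi /w; congr (_ + _)%N; ring.
have hX1 j : (j < l)%N -> elem X q z ((blk * (P * l) + chi j) * g + t) =
    \sum_(u < P) \sum_(i' < l) H blk (t + (u * l + i') * g)%N * z ^+ (chi j * (u * l + i') * eps).
  by move=> jl; have := hX blk (chi j) t hb; rewrite PlE -/g -/eps (sum_mul P l (fun u => H blk (t + u * g)%N * z ^+ (chi j * u * eps))); apply=> //; exact: (chi_lt (Ordinal jl)).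
under eq_bigr do rewrite hX1 //.
(* After exchanging the sums, a geometric sum over j is left as a factor; [orth] retains only the
   term i' = i, multiplied by l. *)
transitivity (\sum_(u < P) \sum_(i' < l) H blk (t + (u * l + i') * g)%N * z ^+ (c * u * (l * eps)) *
   (iota l%:R^-1 * ((z ^+ i' * z' ^+ i) ^+ (c * eps) *
   \sum_(j < l) ((z ^+ i' * z' ^+ i) ^+ (P * eps)) ^+ j))).
  transitivity (\sum_(j < l) \sum_(u < P) \sum_(i' < l) iota l%:R^-1 * (z' ^+ (i * (chi j * eps)) *
     (H blk (t + (u * l + i') * g)%N * z ^+ (chi j * (u * l + i') * eps)))).
    apply: eq_bigr => j _; rewrite !mulr_sumr; apply: eq_bigr => u _.
    by rewrite !mulr_sumr.
  rewrite exchange_big /=; apply: eq_bigr => u _.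
  rewrite exchange_big /=; apply: eq_bigr => i' _.
  rewrite !mulr_sumr; apply: eq_bigr => j _.
  rewrite [RHS]mulrCA; congr (_ * _); rewrite mulrCA -mulrA; congr (_ * _).
  have e1 : z ^+ (chi j * (u * l + i') * eps) = z ^+ (c * u * (l * eps)) * z ^+ (i' * (chi j * eps)).
    rewrite -exprD -[LHS](expr_mod _ root_one) -[RHS](expr_mod _ root_one); congr (_ ^+ _).
    have -> : (chi j * (u * l + i') * eps = (j * u) * (P * l * eps) + (c * u * (l * eps) + i' * (chi j * eps)))%N.
      by rewrite /chi; ring.
    by rewrite Plq modnMDl.
  rewrite e1 mulrCA; congr (_ * _).
  rewrite -!exprM -exprD exprMn -!exprM.
  have -> : (c * eps + P * eps * j = chi j * eps)%N by rewrite /chi; ring.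
  by rewrite mulrC -[(q.-1 * i * _)%N]mulnA.
apply: eq_bigr => u _; rewrite (bigD1 (Ordinal il)) //= [X in _ + X]big1 => [|i' hi']; last first.
  by rewrite orth // (_ : (i' == i :> nat) = false) ?mulr0 //; apply: negPf; move: hi'; rewrite -val_eqE.
rewrite addr0 orth // eqxx -exprMn [z * z']mulrC zz' !expr1n mul1r.
have -> : iota l%:R^-1 * l%:R = 1 by rewrite -(rmorph_nat iota) -rmorphM mulVf // rmorph1.
rewrite mulr1; congr (H _ _ * z ^+ _); first by ring.
by rewrite /eps -expnS -subSn // (leq_trans sS).
Qed.
End Stage.

(** * Regrouping a block into a polynomial over a smaller ring *)

Section Level.
Variables (F : fieldType) (S : comNzRingType) (iota : {rmorphism F -> S}).
Variables (l m q NB : nat) (xi : S).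
Hypothesis m_gt0 : (0 < m)%N.
Hypothesis q_gt0 : (0 < q)%N.
Hypothesis l_gt1 : (1 < l)%N.
Hypothesis zq : (xi ^+ m) ^+ q = 1.
Implicit Types X : nat -> F.

(** With z = xi^m, a block of m q coefficients in xi becomes m blocks of q coefficients in z: entry
    m y + t goes to place y of block t. The remaining blocks, up to l m, are zero and leave room for
    products of degree below 2 m. *)
Definition pad_fun X idx : F :=
  let e := (idx %/ q)%N in
  if (e %% (l * m) < m)%N then X (e %/ (l * m) * (m * q) + m * (idx %% q) + e %% (l * m))%N
  else 0.

(** The way back from z to xi: block t + m carries xi^(t + m) = z xi^t, so it is rotated by one
    place and added to block t. *)
Definition unpad_fun X idx : F :=
  let r := (idx %% (m * q))%N in
  let e := (idx %/ (m * q) * (l * m) + r %% m)%N in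
  X (e * q + r %/ m)%N + X ((e + m) * q + (r %/ m + (q - 1)) %% q)%N.

Definition coefs X b t : S :=
  if (t < m)%N then \sum_(y < q) iota (X (b * (m * q) + m * y + t)%N) * (xi ^+ m) ^+ y else 0.

Lemma elem_coefs X b : elem iota X (m * q) xi b = \sum_(t < m) coefs X b t * xi ^+ t.
Proof.
rewrite /elem mulnC (sum_mul _ _ (fun y => iota (X (b * (q * m) + y)%N) * xi ^+ y)).
rewrite exchange_big /=; apply: eq_bigr => t _; rewrite /coefs ltn_ord mulr_suml.
apply: eq_bigr => y _; rewrite exprD -exprM mulrA (mulnC m y) (mulnC q m).
by rewrite (mulnC m) addnA.
Qed.

Lemma elem_pad X X' : (forall idx, (idx < NB * (l * m) * q)%N -> X' idx = pad_fun X idx) ->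
  forall b t, (b < NB)%N -> (t < l * m)%N ->
  elem iota X' q (xi ^+ m) (b * (l * m) + t)%N = coefs X b t.
Proof.
move=> hX b t hb ht; rewrite /elem /coefs.
have e1 (y : 'I_q) : X' ((b * (l * m) + t) * q + y)%N =
    if (t < m)%N then X (b * (m * q) + m * y + t)%N else 0.
  rewrite hX; last by do 2!(apply: ltn_mulD => //).
  by rewrite /pad_fun !(div_mulDl, mod_mulDl).
case: ltnP => tm; first by apply: eq_bigr => y _; rewrite e1 tm.
by rewrite big1 // => y _; rewrite e1 ltnNge tm rmorph0 mul0r.
Qed.

Lemma elem_unpad X X' (H : nat -> nat -> S) :
  (forall idx, (idx < NB * (m * q))%N -> X' idx = unpad_fun X idx) ->
  (forall b t, (b < NB)%N -> (t < l * m)%N ->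
     elem iota X q (xi ^+ m) (b * (l * m) + t)%N = H b t) ->
  forall b, (b < NB)%N -> elem iota X' (m * q) xi b = \sum_(t < 2 * m) H b t * xi ^+ t.
Proof.
move=> hX hH b hb; rewrite mul2n -addnn big_split_ord /=.
rewrite /elem (_ : m * q = q * m)%N; last exact: mulnC.
rewrite (sum_mul _ _ (fun y => iota (X' (b * (q * m) + y)%N) * xi ^+ y)).
rewrite exchange_big -big_split /=; apply: eq_bigr => t _.
have tl : (m + t < l * m)%N by have := ltn_ord t; nia.
have tl' : (t < l * m)%N by lia.
rewrite -!hH //; set z := xi ^+ m.
have -> : elem iota X q z (b * (l * m) + (m + t)) * xi ^+ (m + t) =
   z * elem iota X q z (b * (l * m) + (m + t)) * xi ^+ t.
  by rewrite exprD mulrCA mulrA.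
have -> : z * elem iota X q z (b * (l * m) + (m + t)) =
  \sum_(y < q) iota (X ((b * (l * m) + (m + t)) * q + (y + (q - 1)) %% q)%N) * z ^+ y.
  (* For q = 1 the rotation by 1 degenerates, but then z = 1. *)
  case: (ltnP 1 q) => q1; last first.
    have q1' : q = 1%N by lia.
    rewrite /elem; move: zq; rewrite -/z q1' expr1 => ->.
    by rewrite mul1r !big_ord1 /= modn1.
  have := sum_rotl (fun y => iota (X ((b * (l * m) + (m + t)) * q + y)%N)) 1 q_gt0 zq.
  by rewrite expr1 (modn_small q1) => <-.
rewrite /elem -mulrDl -big_split mulr_suml; apply: eq_bigr => y _ /=.
rewrite -mulrDl -rmorphD exprD -exprM (mulnC m) mulrA mulrAC.
rewrite mulrAC; congr (iota _ * _ * _).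
have -> : (b * (q * m) + (y * m + t) = b * (m * q) + (y * m + t))%N by rewrite (mulnC q).
have r_lt : (y * m + t < m * q)%N by rewrite [(m * q)%N]mulnC ltn_mulD.
rewrite hX; last by rewrite ltn_mulD.
by rewrite /unpad_fun !(div_mulDl, mod_mulDl) //; congr (_ + X (_ * q + _)%N); lia.
Qed.

End Level.

Section Conv.
Variables (S : comNzRingType) (m : nat).
Implicit Types H : nat -> S.

Definition conv H1 H2 t := ((\poly_(i < m) H1 i) * (\poly_(i < m) H2 i))`_t.

Lemma conv_sum H1 H2 N x : (2 * m <= N)%N ->
  \sum_(u < N) conv H1 H2 u * x ^+ u =
  (\sum_(u < m) H1 u * x ^+ u) * (\sum_(u < m) H2 u * x ^+ u).
Proof.
move=> mN; rewrite -[X in X * _]horner_poly -[X in _ * X]horner_poly -hornerM.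
rewrite (horner_coef_wide (n := N)) //; apply: leq_trans (size_polyMleq _ _) _.
move: (size_poly m H1) (size_poly m H2); move: (size _) (size _) => a b ha hb.
by apply: leq_trans (leq_pred _) _; apply: leq_trans mN; rewrite mul2n -addnn leq_add.
Qed.

Lemma sum_trunc H N (f : nat -> S) : (m <= N)%N -> (forall t, (m <= t)%N -> H t = 0) ->
  \sum_(u < N) H u * f u = \sum_(u < m) H u * f u.
Proof.
move=> mN H0; rewrite -(subnKC mN) big_split_ord /= [X in _ + X]big1 ?addr0 //.
by move=> i _; rewrite H0 ?mul0r ?leq_addr.
Qed.
End Conv.

(** * The quotient of F[X] by the cyclotomic polynomial *)

Section Cyclotomic.
Variables (F : fieldType) (l K : nat).
Hypothesis l_gt1 : (1 < l)%N.
Let q := (l ^ K.-1)%N.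
Let R := (l.-1 * q)%N.
Let q_gt0 : (0 < q)%N. Proof. by rewrite expn_gt0 ltnW. Qed.

(* The cyclotomic polynomial of order l^K, when l is prime. *)
Definition Phi : {poly F} := \sum_(j < l) 'X^(j * q).

Lemma size_Phi_aux : (size (\sum_(j < l.-1) 'X^(j * q) : {poly F})%R < R.+1)%N.
Proof.
rewrite ltnS; apply: leq_trans (size_sum _ _ _) _; apply/bigmax_leqP => j _.
by rewrite size_polyXn /R; have := ltn_ord j; nia.
Qed.

Lemma PhiE : Phi = \sum_(j < l.-1) 'X^(j * q) + 'X^R.
Proof. by rewrite /Phi -(prednK (ltnW l_gt1)) big_ord_recr. Qed.

Lemma size_Phi : size Phi = R.+1.
Proof. by rewrite PhiE addrC size_polyDl size_polyXn // size_Phi_aux. Qed.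

Lemma monic_Phi : Phi \is monic.
Proof. by rewrite monicE PhiE lead_coefDr ?lead_coefXn // size_polyXn size_Phi_aux. Qed.

Definition cyc := {poly %/ Phi}.
Definition cyc_iota : F -> cyc := in_qpoly Phi \o polyC.
HB.instance Definition _ := GRing.RMorphism.on cyc_iota.
Definition cyc_X : cyc := in_qpoly Phi 'X.

(** The quotient type replaces its modulus by 'X unless the modulus is monic and non-constant. *)
Lemma mk_monic_Phi : mk_monic Phi = Phi.
Proof.
rewrite /mk_monic size_Phi monic_Phi andbT ltnS /R muln_gt0 q_gt0 andbT.
by case: (l) l_gt1 => [|[]].
Qed.

Lemma in_cyc_small (p : {poly F}) : (size p <= R)%N -> in_qpoly Phi p = p :> {poly F}.
Proof. by move=> h; apply: in_qpoly_small; rewrite mk_monic_Phi size_Phi. Qed.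

Lemma in_cyc_Phi : in_qpoly Phi Phi = 0.
Proof.
apply/val_inj; rewrite /= mk_monic_Phi.
exact: (Pdiv.RingMonic.rmodpp monic_Phi).
Qed.

Lemma cyc_sum n (f : nat -> F) :
  \sum_(i < n) cyc_iota (f i) * cyc_X ^+ i = in_qpoly Phi (\poly_(i < n) f i).
Proof.
rewrite poly_def rmorph_sum; apply: eq_bigr => i _.
by rewrite /cyc_iota /cyc_X /= -rmorphXn -rmorphM mul_polyC.
Qed.

Lemma cyc_root : \sum_(i < l) (cyc_X ^+ q) ^+ i = 0.
Proof.
rewrite -[RHS]in_cyc_Phi rmorph_sum; apply: eq_bigr => i _.
by rewrite -exprM mulnC rmorphXn.
Qed.

(** Return from the redundant representation. Modulo [Phi], X^(R + i) is minus the sum of the X^(j q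
    + i) over j < l - 1, so each top coefficient is subtracted from all lower ones in its class
    modulo q. The size hypothesis makes the remainder the product itself. *)
Lemma cyc_reduce (x1 x2 x3 : nat -> F) n : (0 < K)%N ->
  let f := \poly_(i < n) x1 i in let g := \poly_(i < n) x2 i in
  (size (f * g)%R <= R)%N ->
  \sum_(i < l ^ K) cyc_iota (x3 i) * cyc_X ^+ i =
  (\sum_(i < n) cyc_iota (x1 i) * cyc_X ^+ i) *
  (\sum_(i < n) cyc_iota (x2 i) * cyc_X ^+ i) ->
  forall i, (i < R)%N -> (f * g)`_i = x3 i - x3 (R + i %% q)%N.
Proof.
move=> K0 f g sfg; rewrite !cyc_sum -rmorphM => e.
have QE : (l ^ K = l.-1 * q + q)%N.
  by rewrite -mulSnr /q (prednK (ltnW l_gt1)) -expnS prednK.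
pose h' := \poly_(i < R) (x3 i - x3 (R + i %% q)%N).
pose t := \poly_(i < q) x3 (R + i)%N.
(* The top q coefficients, collected in [t], are the quotient by [Phi], and [h'] is the
   remainder. *)
suff hE : \poly_(i < l ^ K) x3 i = h' + Phi * t.
  move: e; rewrite hE; have -> : in_qpoly Phi (h' + Phi * t) = in_qpoly Phi h'.
    by rewrite in_qpolyD in_qpolyM in_cyc_Phi mul0r addr0.
  move=> e i iR; have {}e : in_qpoly Phi h' = in_qpoly Phi (f * g) := e.
  have := in_cyc_small (size_poly R (fun i => x3 i - x3 (R + i %% q)%N)).
  by rewrite -/h' e in_cyc_small // => ->; rewrite coef_poly iR.
have tail : 'X^R * t = \sum_(i < q) x3 (R + i)%N *: 'X^(R + i).
  rewrite /t poly_def mulr_sumr; apply: eq_bigr => i _.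
  by rewrite -scalerAr -exprD.
rewrite PhiE mulrDl tail poly_def QE big_split_ord /= addrA; congr (_ + _).
rewrite -/R (eq_bigr (fun i : 'I_R => (x3 i - x3 (R + i %% q)%N) *: 'X^i + x3 (R + i %% q)%N *: 'X^i)); last first.
  by move=> i _; rewrite -scalerDl subrK.
rewrite big_split /=; congr (_ + _); first by rewrite /h' poly_def.
rewrite (sum_mul l.-1 q (fun i => x3 (R + i %% q)%N *: 'X^i)) mulr_suml; apply: eq_bigr => j _.
rewrite /t poly_def mulr_sumr; apply: eq_bigr => i _.
by rewrite mod_mulDl // -scalerAr -exprD.
Qed.

End Cyclotomic.

(** * Multiplication program *)

Local Open Scope nat_scope.

(* Integer arrays: 0 n, 2 l, 3 K, 4 Q = l^K, 5 Lambda, 6 powers of l,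
   7 exponents of the successive block lengths; 20 level, 22 stage, 30-33 block
   parameters.  Field arrays: 40 operands, 41 scratch, 42 product, 44 1/l. *)
Definition rl := nvar 2.
Definition rQ := nvar 4.
Definition rm := nvar 30.
Definition rq := nvar 31.
Definition rS := nvar 32.
Definition rk := nvar 33.
Definition pw e := NGet 6 e.
Definition vi := nvar 90.
Definition vj := nvar 92.

(** From blocks of length l^k to blocks of length l^k': each is a polynomial with m = l^(k - k')
    coefficients, and the transform has length l m = l^(k - k' + 1) because of the zero padding. *)
Definition set_level lev :=
  PSeq (PNSet 33 #0 (NGet 7 (lev |+| #1)))
  (PSeq (PNSet 30 #0 (pw (NGet 7 lev |-| rk)))
  (PSeq (PNSet 31 #0 (pw rk))
        (PNSet 32 #0 (NGet 7 lev |-| rk |+| #1)))).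

Definition pad_prog D :=
  msum 41 #0 D 1 2 (#1 |-| (vi |/| rq |%| (rl |*| rm)) |/| rm) 0 0 FZero
    (FGet 40 (vi |/| rq |/| (rl |*| rm) |*| (rm |*| rq) |+| rm |*| (vi |%| rq)
              |+| (vi |/| rq |%| (rl |*| rm)))).

Definition sP sg := pw sg.
Definition sw sg := pw (rS |-| (sg |+| #1)) |*| rq.
Definition seps sg := pw (rk |-| (sg |+| #1)).

Definition split_prog sg D :=
  let chi := vi |/| sw sg |%| (sP sg |*| rl) in
  let blk := vi |/| sw sg |/| (sP sg |*| rl) in
  let y := vi |%| sw sg |%| rq in
  msum 41 #0 D 1 2 rl 0 0 FZero
    (FGet 40 (((blk |*| sP sg |+| (chi |%| sP sg)) |*| rl |+| vj) |*| sw sg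
       |+| ((vi |%| sw sg) |-| y)
       |+| ((y |+| (rq |-| (vj |*| (chi |*| seps sg) |%| rq))) |%| rq))).

Definition unsplit_prog sg D :=
  let i := vi |/| sw sg |%| rl in
  let c := vi |/| sw sg |/| rl |%| sP sg in
  let blk := vi |/| sw sg |/| rl |/| sP sg in
  let y := vi |%| sw sg |%| rq in
  msum 41 #0 D 1 2 rl 0 0 FZero
    (FMul (FGet 44 #0) (FGet 42 ((blk |*| (sP sg |*| rl) |+| (c |+| vj |*| sP sg)) |*| sw sg
       |+| ((vi |%| sw sg) |-| y)
       |+| ((y |+| i |*| ((c |+| vj |*| sP sg) |*| seps sg)) |%| rq)))).

Definition unpad_prog D :=
  let r := vi |%| (rm |*| rq) in
  let e := vi |/| (rm |*| rq) |*| (rl |*| rm) |+| (r |%| rm) in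
  msum 41 #0 D 1 2 #0 0 0
    (FAdd (FGet 42 (e |*| rq |+| r |/| rm))
          (FGet 42 ((e |+| rm) |*| rq |+| ((r |/| rm |+| (rq |-| #1)) |%| rq)))) FZero.

Definition fwd_level :=
  let D := #2 |*| rQ |*| pw (nvar 20 |+| #1) in
  PSeq (set_level (nvar 20))
  (PSeq (pad_prog D)
  (PSeq (cp 40 41 D 1 2)
  (PFor 22 rS 0 1 (PSeq (split_prog (nvar 22) D) (cp 40 41 D 1 2))))).

Definition bwd_level :=
  let lev := nvar 5 |-| (nvar 20 |+| #1) in
  let D := rQ |*| pw (lev |+| #1) in
  let D' := rQ |*| pw lev in
  let sg := rS |-| (nvar 22 |+| #1) in
  PSeq (set_level lev)
  (PSeq (PFor 22 rS 0 1 (PSeq (unsplit_prog sg D) (cp 42 41 D 1 2)))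
  (PSeq (unpad_prog D') (cp 42 41 D' 1 2))).

Definition reduce_prog :=
  msum 43 #0 (rQ |-| rQ |/| rl) 1 2 #0 0 0
    (FSub (FGet 42 vi) (FGet 42 (rQ |-| rQ |/| rl |+| (vi |%| (rQ |/| rl))))) FZero.

(** Blocks have at most 9 entries by now and are multiplied by direct cyclic convolution; the second
    operand starts at index [D] of the same array. *)
Definition bottom_prog :=
  let D := rQ |*| pw (nvar 5) in
  let y := vi |%| rq in
  let b := vi |/| rq in
  PSeq (PNSet 31 #0 (pw (NGet 7 (nvar 5))))
       (msum 42 #0 D 1 2 rq 0 0 FZero
         (FMul (FGet 40 (b |*| rq |+| vj))
            (FGet 40 (D |+| (b |*| rq |+| ((y |+| (rq |-| (vj |%| rq))) |%| rq)))))).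

Definition transform_prog :=
  PSeq (PFor 20 (nvar 5) 0 1 fwd_level)
  (PSeq bottom_prog (PFor 20 (nvar 5) 0 1 bwd_level)).

Definition mul_prog := PSeq transform_prog reduce_prog.

(** * Correctness of the multiplication program *)

Section MulCorrect.
Variables (F : fieldType) (n l K Lam : nat).
Hypothesis n_gt0 : 0 < n.
Hypothesis l23 : (l == 2) || (l == 3).
Hypothesis l_neq0 : (l%:R : F)%R != 0%R.
Hypothesis K_gt0 : 0 < K.
Let Q := l ^ K.
Hypothesis D_trip : 2 * Q * l ^ Lam <= trip n 1 2.
Hypothesis K_trip : K.+1 <= trip n 0 1.
Hypothesis Lam_trip : Lam <= trip n 0 1.
Hypothesis Lam_K : Lam <= K.
Implicit Types s : state F.

(** Halving the exponent takes the square root of the block length. The successor makes the root of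
    the smaller ring have order a multiple of the transform length l m ([SjK]); the exponents end at
    1 or 2. *)
Definition ktab j := iter j (fun k => k./2.+1) K.

Arguments ktab : simpl never.

Lemma ktab_gt0 j : 0 < ktab j. Proof. by case: j. Qed.

Lemma ktabS j : ktab j.+1 = (ktab j)./2.+1. Proof. by []. Qed.

Lemma ktab_le j : ktab j.+1 <= ktab j.
Proof. by rewrite ktabS; have := ktab_gt0 j; case: (ktab j) => // k _; rewrite -divn2 ltn_Pdiv. Qed.

Lemma ktab_leK j : ktab j <= K.
Proof. by elim: j => // j IH; apply: leq_trans (ktab_le j) IH. Qed.

Let l_gt1 : 1 < l. Proof. by case/orP: l23 => /eqP->. Qed.
Let l_gt0 : 0 < l. Proof. exact: ltnW. Qed.

Definition mulenv s :=
  [/\ [/\ nreg s 0 n, nreg s 2 l, nreg s 3 K & nreg s 4 Q], nreg s 5 Lam,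
      forall i, i <= K.+1 -> nmem s 6 i = l ^ i,
      forall j, j <= Lam -> nmem s 7 j = ktab j &
      fmem s 44 0 = (l%:R^-1)%R].

Lemma mulenv_frame lN lF s s' : frame lN lF s s' ->
  all (fun a => a \notin lN) [:: 0; 2; 3; 4; 5; 6; 7] -> 44 \notin lF ->
  mulenv s -> mulenv s'.
Proof.
move=> [hN hF _] /= /and5P[a0 a2 a3 a4 /and4P[a5 a6 a7 _]] hf [[b0 b2 b3 b4] b5 b6 b7 b8].
by split; [split| |move=> i hi|move=> i hi|]; rewrite /nreg ?hN ?hF //; auto.
Qed.

Ltac carryM FR :=
  carry FR;
  match type of FR with
  | frame _ _ ?s ?s' =>
    repeat match goal with
    | H : mulenv s |- _ =>
        first [ move: (mulenv_frame FR isT isT H) => {}H | clear H ]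
    end
  end.

Definition kj j := ktab j.
Definition mj j := l ^ (ktab j - ktab j.+1).
Definition qj j := l ^ ktab j.
Definition Sj j := (ktab j - ktab j.+1).+1.
(** The number of blocks per operand on level j. The padding multiplies the volume of data by l on
    every level ([BqE]), by l^Lam in all. *)
Definition Bj j := l ^ (j + (K - ktab j)).

Definition level_regs s j :=
  [/\ nreg s 30 (mj j), nreg s 31 (qj j.+1), nreg s 32 (Sj j) & nreg s 33 (ktab j.+1)].

Lemma D_cell : 2 * Q * l ^ Lam <= cellmax n.
Proof. by apply: leq_trans D_trip (trip_cellmax _ _). Qed.

Lemma Q_cell : Q <= cellmax n.
Proof.
apply: leq_trans D_cell; rewrite mulnC mulnA leq_pmull //.
by rewrite muln_gt0 expn_gt0 l_gt0.
Qed.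

Lemma pow_cell i : i <= K -> l ^ i <= cellmax n.
Proof. by move=> h; apply: leq_trans Q_cell; rewrite leq_pexp2l. Qed.

Lemma K_cell : K.+1 <= cellmax n.
Proof. by apply: leq_trans K_trip (trip_cellmax _ _). Qed.

Lemma tri_set_level lev s j : j < Lam -> mulenv s -> (forall s', frame [:: 30; 31; 32; 33] [::] s s' -> nval s' lev = j) ->
  tri n (set_level lev) s (fun s' => level_regs s' j).
Proof.
move=> jL E hlev.
have hl s' : frame [:: 30; 31; 32; 33] [::] s s' -> nval s' lev = j := hlev s'.
apply: tri_seq.
  apply: (@tri_set _ _ _ _ _ (ktab j.+1)).
    by case: E => _ _ _ h _; rewrite /= hl ?addn1 ?h //.
  by apply: leq_trans (ktab_leK _) (ltnW K_cell).
move=> s1 f1 /= h1; rewrite /= in f1; carryM f1.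
have g1 : frame [:: 30; 31; 32; 33] [::] s s1 by apply: frame_sub f1 => // x; rewrite !inE => ->; rewrite ?orbT.
apply: tri_seq.
  apply: (@tri_set _ _ _ _ _ (mj j)).
    case: E => _ _ h6 h7 _; rewrite /= hl // h7 ?(ltnW jL) // /rk /nvar /= h1 h6 //.
    by apply: leq_trans (leq_subr _ _) _; apply: leqW (ktab_leK _).
  by apply: pow_cell; apply: leq_trans (leq_subr _ _) (ktab_leK _).
move=> s2 f2 /= h2; rewrite /= in f2; carryM f2.
have g2 : frame [:: 30; 31; 32; 33] [::] s s2.
  by apply: frame_trans g1 _; apply: frame_sub f2 => // x; rewrite !inE => ->; rewrite ?orbT.
apply: tri_seq.
  apply: (@tri_set _ _ _ _ _ (qj j.+1)).
    by case: E => _ _ h6 _ _; rewrite /= h1 h6 //; apply: leqW (ktab_leK _).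
  by apply: pow_cell (ktab_leK _).
move=> s3 f3 /= h3; rewrite /= in f3; carryM f3.
have g3 : frame [:: 30; 31; 32; 33] [::] s s3.
  by apply: frame_trans g2 _; apply: frame_sub f3 => // x; rewrite !inE => ->; rewrite ?orbT.
apply: tri_conseq.
  apply: (@tri_set _ _ _ _ _ (Sj j)).
    by case: E => _ _ _ h7 _; rewrite /= hl // h1 h7 ?(ltnW jL) // addn1.
  by apply: leq_trans K_cell; rewrite ltnS (leq_trans (leq_subr _ _)) // ktab_leK.
by move=> s4 f4 /= h4; rewrite /= in f4; carryM f4.
Qed.

Variables (S : comNzRingType) (iota : {rmorphism F -> S}) (xi : S).
Hypothesis xi_root : (\sum_(i < l) (xi ^+ (l ^ K.-1)) ^+ i = 0)%R.

Definition xij j : S := (xi ^+ (l ^ (K - ktab j)))%R.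

Lemma mqE j : mj j * qj j.+1 = qj j.
Proof. by rewrite /mj /qj -expnD subnK // ktab_le. Qed.

Lemma lmE j : l ^ Sj j = l * mj j. Proof. by rewrite expnS. Qed.

Lemma BjS j : Bj j.+1 = Bj j * l ^ Sj j.
Proof.
rewrite /Bj /Sj -expnD; congr (l ^ _).
by have := ktab_le j; have := ktab_leK j; lia.
Qed.

Lemma BqE j : Bj j * qj j = Q * l ^ j.
Proof. by rewrite /Bj /qj /Q -!expnD; congr (l ^ _); have := ktab_leK j; lia. Qed.

Lemma xijS j : xij j.+1 = (xij j ^+ mj j)%R.
Proof.
rewrite /xij /mj -GRing.exprM -expnD; congr (_ ^+ (l ^ _))%R.
by have := ktab_le j; have := ktab_leK j; lia.
Qed.

Lemma xij_root j : (\sum_(i < l) (xij j ^+ (l ^ (ktab j).-1)) ^+ i = 0)%R.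
Proof.
rewrite -[RHS]xi_root; apply: eq_bigr => i _; congr (_ ^+ _)%R.
rewrite /xij -GRing.exprM -expnD; congr (_ ^+ (l ^ _))%R.
by have := ktab_gt0 j; have := ktab_leK j; lia.
Qed.

Lemma SjK j : Sj j <= ktab j.+1.
Proof. by rewrite /Sj ktabS; lia. Qed.

(** The polynomials [H b] tie block values on one level to their transforms on the next. On the way
    up, products of values in V' are values of the product of two such polynomials, whose value at
    [xij j] is the product of the corresponding V's. *)
Definition link j (V V' : nat -> S) := exists H : nat -> nat -> S,
  [/\ forall b t, mj j <= t -> H b t = 0%R,
      forall b, b < 2 * Bj j -> V b = (\sum_(t < mj j) H b t * xij j ^+ t)%R &
      forall b chi, b < 2 * Bj j -> chi < l ^ Sj j ->
        V' (b * l ^ Sj j + chi) = (\sum_(u < l ^ Sj j)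
          H b u * (xij j.+1 ^+ (chi * l ^ (ktab j.+1 - Sj j))) ^+ u)%R].

Definition sinv j NB := stage_inv iota l (ktab j.+1) (Sj j) (xij j.+1) NB.

Lemma tot_trip j : j < Lam -> 2 * Q * l ^ j.+1 <= trip n 1 2.
Proof. by move=> h; apply: leq_trans D_trip; rewrite leq_mul2l leq_pexp2l ?orbT. Qed.

Lemma stage_vals j e sg s : sg < Sj j -> nval s e = sg ->
  nreg s 31 (qj j.+1) -> nreg s 32 (Sj j) -> nreg s 33 (ktab j.+1) -> mulenv s ->
  [/\ nval s (sP e) = l ^ sg, nval s (sw e) = l ^ (Sj j - sg.+1) * qj j.+1 &
      nval s (seps e) = l ^ (ktab j.+1 - sg.+1)].
Proof.
move=> sgS he a31 a32 a33 [_ _ a6 _ _].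
have sgk : sg < ktab j.+1 by apply: leq_trans sgS (SjK j).
have SK1 : Sj j <= K.+1 by rewrite /Sj ltnS; apply: leq_trans (leq_subr _ _) (ktab_leK _).
have kK := ktab_leK j.+1.
rewrite /= he a31 a32 a33 addn1.
by rewrite !a6 //; move: sgk sgS SK1 kK; lia.
Qed.

Lemma tri_fwd_level s j V : j < Lam -> mulenv s -> nreg s 20 j ->
  (forall b, b < 2 * Bj j -> elem iota (fmem s 40) (qj j) (xij j) b = V b) ->
  tri n fwd_level s (fun s' => exists2 V', link j V V' &
    forall b, b < 2 * Bj j.+1 -> elem iota (fmem s' 40) (qj j.+1) (xij j.+1) b = V' b).
Proof.
move=> jL E r20 hV; set D := 2 * Q * l ^ j.+1.
have Dt : D <= trip n 1 2 by apply: tot_trip.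
have DE : D = 2 * Bj j * (l * mj j) * qj j.+1.
  by rewrite -!mulnA mqE [Bj j * _]mulnCA BqE /D expnS; ring.
apply: tri_seq.
  apply: (@tri_set_level _ _ j) => // s' f; rewrite /nvar /=.
  by move: (@nreg_frame _ _ _ _ _ 20 j f isT r20) => {}r20.
move=> s1 f1 [r30 r31 r32 r33]; rewrite /= in f1; carryM f1.
have X40 : fmem s1 40 =1 fmem s 40 by case: f1 => _ h _; apply: h.
have Dv s' : nreg s' 20 j -> mulenv s' -> nval s' (#2 |*| rQ |*| pw (nvar 20 |+| #1)) = D.
  move=> r [[_ _ _ rq] _ h6 _ _]; rewrite /= r rq h6 ?addn1 //.
  by have := Lam_K; lia.
apply: tri_seq.
  apply: (@tri_sum _ _ _ _ _ _ _ _ _ _ _ D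
   (fun idx => 1 - (idx %/ qj j.+1 %% (l * mj j)) %/ mj j)
   (fun idx _ => fmem s1 40 (idx %/ qj j.+1 %/ (l * mj j) * (mj j * qj j.+1) +
       mj j * (idx %% qj j.+1) + idx %/ qj j.+1 %% (l * mj j)))) => //.
  - exact: Dv.
  - move=> s' i _ FR ei; rewrite /sim in FR; carryM FR; case: E => -[_ hrl _ _] _ _ _ _.
    rewrite /= hrl r30 r31 ei !subn_div; split=> //.
    by apply: leq_trans (leq_subr _ _) _; apply: trip_gt0.
  - move=> s' i k _ _ FR ei _; rewrite /sim in FR; carryM FR; case: E => -[_ hrl _ _] _ _ _ _.
    by case: FR => _ hF _; rewrite /= hrl r30 r31 ei !subn_div hF.
move=> s2 f2 /= h2; rewrite /= in f2; carryM f2.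
apply: tri_seq.
  by apply: (tri_cp (m := D)) h2 => //; apply: Dv.
move=> s3 f3 /= h3; rewrite /= in f3; carryM f3.
set H := coefs iota (mj j) (qj j.+1) (xij j) (fmem s 40).
have mj_gt0 : 0 < mj j by rewrite expn_gt0 l_gt0.
have inv0 : sinv j (2 * Bj j) 0 (fmem s3 40) H.
  move=> b c t hb hc ht; rewrite expn0 in hc; rewrite expn0 muln1 big_ord1 mul0n addn0.
  rewrite subn0 lmE in ht *; case: c hc => // _; rewrite addn0 !mul0n GRing.expr0 GRing.mulr1 xijS.
  apply: (@elem_pad _ _ iota _ _ _ (2 * Bj j)) => // idx; rewrite -DE => hidx.
  rewrite h3 // sum_guard /pad_fun -X40.
  have -> : (idx %/ qj j.+1 %% (l * mj j) < mj j) = (idx %/ qj j.+1 %% (l * mj j) %/ mj j == 0).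
    by rewrite -[RHS]leqn0 [RHS]leqNgt divn_gt0 // -ltnNge.
  by case: ifP => // _; rewrite X40.
apply: (@tri_for _ _ _ _ _ _ _ _ _ (Sj j) (fun sg s' => sinv j (2 * Bj j) sg (fmem s' 40) H)) => //.
- by apply: leq_trans K_trip; rewrite ltnS (leq_trans (leq_subr _ _)) // ktab_leK.
- by move=> s0 f0 b c t hb hc ht; rewrite -inv0 //; case: f0 => _ hF _; apply: eq_bigr => y _; rewrite hF.
- move=> sg s4 sgS f4 r22 I4; rewrite /= in f4; carryM f4.
  have sgk : sg < ktab j.+1 by apply: leq_trans sgS (SjK j).
  pose P := l ^ sg; pose w := l ^ (Sj j - sg.+1) * qj j.+1; pose eps := l ^ (ktab j.+1 - sg.+1).
  apply: tri_seq.
    apply: (@tri_sum _ _ _ _ _ _ _ _ _ _ _ D (fun=> l)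
       (fun idx i => let chi := ((idx %/ w) %% (P * l))%N in
          let blk := (idx %/ w %/ (P * l))%N in
          let y := ((idx %% w) %% qj j.+1)%N in
          fmem s4 40 (((blk * P + chi %% P) * l + i) * w + (idx %% w - y)
                   + (y + (qj j.+1 - (i * (chi * eps)) %% qj j.+1)) %% qj j.+1)%N)) => //.
    - exact: Dv.
    - move=> s' i _ FR ei; rewrite /sim in FR; carryM FR; case: E => -[_ hrl _ _] _ _ _ _.
      rewrite /= hrl; split=> //; apply: leq_trans (_ : 3 <= _); first by case/orP: l23 => /eqP->.
      by rewrite /trip !expn0 !muln1 /tripc -lock.
    - move=> s' i k _ _ FR ei ej; rewrite /sim in FR; carryM FR.
      have [vP vw ve] := stage_vals (e := nvar 22) sgS r22 r31 r32 r33 E; case: E => -[_ hrl _ _] _ _ _ _.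
      have vl : nval s' rl = l by [].
      have vq : nval s' rq = qj j.+1 by [].
      have vvi : nval s' vi = i by [].
      have vvj : nval s' vj = k by [].
      rewrite fvalG !(nvalE, vP, vw, ve, vl, vq, vvi, vvj).
      by case: FR => _ hF _; rewrite hF.
  move=> s5 f5 /= h5; rewrite /= in f5; carryM f5.
  apply: (tri_conseq (tri_cp (m := D) _ _ _ _ _ h5)) => //; first exact: Dv.
  move=> s6 f6 /= h6 s7 f7.
  apply: (split_stage (X := fmem s4 40) l23 _ (xij_root j.+1) sgS (SjK j)) => //.
  move=> idx; rewrite lmE -/(qj j.+1) -DE => hidx.
  by case: f7 => _ hF _; rewrite hF // h6.
- move=> s4 f4 I4; exists (fun e => elem iota (fmem s4 40) (qj j.+1) (xij j.+1) e).
    exists H; split.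
    + by move=> b t; rewrite /H /coefs ltnNge => ->.
    + by move=> b hb; rewrite -hV // -mqE elem_coefs.
    + move=> b chi hb hchi; have := I4 b chi 0 hb hchi; rewrite subnn expn0 muln1 addn0 => -> //.
      by apply: eq_bigr => u _; rewrite add0n muln1 -GRing.exprM; congr (_ * _ ^+ _)%R; ring.
  by [].
Qed.

Lemma three_trip : l <= trip n 0 0.
Proof.
apply: leq_trans (_ : 3 <= _); first by case/orP: l23 => /eqP->.
by rewrite /trip !expn0 !muln1 /tripc -lock.
Qed.

Lemma tot_trip' j : j <= Lam -> Q * l ^ j <= trip n 1 2.
Proof.
move=> h; apply: leq_trans D_trip; rewrite -mulnA; apply: leq_trans (leq_pmull _ _) => //.
by rewrite leq_mul2l leq_pexp2l ?orbT.
Qed.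

Lemma elem_ext (X X' : nat -> F) q z e : X =1 X' -> elem iota X q z e = elem iota X' q z e.
Proof. by move=> h; apply: eq_bigr => y _; rewrite h. Qed.

Lemma tri_bwd_level s jj j V V' : jj < Lam -> j = Lam - jj.+1 ->
  mulenv s -> nreg s 20 jj -> link j V V' ->
  (forall e, e < Bj j.+1 -> elem iota (fmem s 42) (qj j.+1) (xij j.+1) e =
     (V' e * V' (e + Bj j.+1)%N)%R) ->
  tri n bwd_level s (fun s' =>
    forall b, b < Bj j -> elem iota (fmem s' 42) (qj j) (xij j) b = (V b * V (b + Bj j)%N)%R).
Proof.
move=> jjL jE E r20 [H [H0 HV HV']] h42.
have jL : j < Lam by rewrite jE; lia.
set D := Q * l ^ j.+1; set D' := Q * l ^ j.
have Dt : D <= trip n 1 2 by apply: tot_trip'.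
have Dt' : D' <= trip n 1 2 by apply: tot_trip'; apply: ltnW.
have DE : D = Bj j * (l * mj j) * qj j.+1.
  by rewrite -!mulnA mqE [Bj j * _]mulnCA BqE /D expnS; ring.
have DE' : D' = Bj j * (mj j * qj j.+1) by rewrite mqE BqE.
have mj_gt0 : 0 < mj j by rewrite expn_gt0 l_gt0.
have qj_gt0 : 0 < qj j.+1 by rewrite expn_gt0 l_gt0.
have levE s' : nreg s' 20 jj -> mulenv s' -> nval s' (nvar 5 |-| (nvar 20 |+| #1)) = j.
  by move=> r [_ h5 _ _ _]; rewrite /= r h5 jE addn1.
apply: tri_seq.
  apply: (@tri_set_level _ _ j) => // s' f; apply: levE.
    exact: (@nreg_frame _ _ _ _ _ 20 jj f isT r20).
  exact: (mulenv_frame f isT isT E).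
move=> s1 f1 [r30 r31 r32 r33]; rewrite /= in f1; carryM f1.
have X42 : fmem s1 42 =1 fmem s 42 by case: f1 => _ h _; apply: h.
have Dv s' : nreg s' 20 jj -> mulenv s' -> nval s' (rQ |*| pw (nvar 5 |-| (nvar 20 |+| #1) |+| #1)) = D.
  move=> r EE; have := levE _ r EE; case: EE => -[_ _ _ rq] _ h6 _ _.
  by rewrite !nvalE => h; rewrite /= rq; rewrite /= in h; rewrite h h6 ?addn1 //; have := Lam_K; lia.
have Dv' s' : nreg s' 20 jj -> mulenv s' -> nval s' (rQ |*| pw (nvar 5 |-| (nvar 20 |+| #1))) = D'.
  move=> r EE; have := levE _ r EE; case: EE => -[_ _ _ rq] _ h6 _ _.
  by rewrite !nvalE => h; rewrite /= rq; rewrite /= in h; rewrite h h6 //; have := Lam_K; lia.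
pose H3 b := conv (mj j) (H b) (H (b + Bj j)).
have m2 : 2 * mj j <= l ^ Sj j by rewrite lmE leq_mul2r l_gt1 orbT.
have m1 : mj j <= l ^ Sj j by apply: leq_trans m2; rewrite leq_pmull.
(* Entries are now values at the l m points; a product polynomial has at most 2 m <= l m
   coefficients, so nothing wraps around. *)
have invS : sinv j (Bj j) (Sj j) (fmem s1 42) H3.
  move=> b c t hb hc; rewrite subnn expn0 muln1; case: t => // _; rewrite addn0.
  rewrite (elem_ext _ _ _ X42) h42; last by rewrite BjS ltn_mulD.
  have -> : (b * l ^ Sj j + c + Bj j.+1 = (b + Bj j) * l ^ Sj j + c) by rewrite BjS; ring.
  rewrite !HV' //; [|lia..].
  rewrite !(sum_trunc _ m1) => [|t ht|t ht]; [|exact: H0..].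
  rewrite -(conv_sum _ _ _ m2); apply: eq_bigr => u _; rewrite add0n muln1 -GRing.exprM.
  by congr (_ * _ ^+ _)%R; ring.
apply: (@tri_seq _ _ _ _ _ (fun s' => sinv j (Bj j) 0 (fmem s' 42) H3)).
  apply: (@tri_for _ _ _ _ _ _ _ _ _ (Sj j) (fun i s' => sinv j (Bj j) (Sj j - i) (fmem s' 42) H3)) => //.
  - by apply: leq_trans K_trip; rewrite ltnS (leq_trans (leq_subr _ _)) // ktab_leK.
  - move=> s0 f0; rewrite subn0 => b c t hb hc ht; rewrite -invS //.
    by case: f0 => _ hF _; apply: eq_bigr => y _; rewrite hF.
  - move=> i s4 iS f4 r22; rewrite /= in f4; carryM f4.
    have [sg sgE sgS] : exists2 sg, Sj j - i = sg.+1 & sg < Sj j.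
      by exists (Sj j - i.+1); lia.
    rewrite sgE => I4.
    pose P := l ^ sg; pose w := l ^ (Sj j - sg.+1) * qj j.+1; pose eps := l ^ (ktab j.+1 - sg.+1).
    have sgv s' : nreg s' 22 i -> nreg s' 32 (Sj j) -> nval s' (rS |-| (nvar 22 |+| #1)) = sg.
      by move=> a b; rewrite /= a b addn1; lia.
    apply: tri_seq.
      apply: (@tri_sum _ _ _ _ _ _ _ _ _ _ _ D (fun=> l)
       (fun idx j' =>
        let i := ((idx %/ w) %% l)%N in
        let c := ((idx %/ w %/ l) %% P)%N in
        let blk := (idx %/ w %/ l %/ P)%N in
        let y := ((idx %% w) %% qj j.+1)%N in
        (l%:R^-1 *
        fmem s4 42 ((blk * (P * l) + (c + j' * P)) * w + (idx %% w - y)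
                   + (y + i * ((c + j' * P) * eps)) %% qj j.+1)%N)%R)) => //.
      - exact: Dv.
      - move=> s' i' _ FR ei; rewrite /sim in FR; carryM FR; case: E => -[_ hrl _ _] _ _ _ _.
        by rewrite /= hrl; split=> //; apply: three_trip.
      - move=> s' i' k _ _ FR ei ej; rewrite /sim in FR; carryM FR.
        have [vP vw ve] := stage_vals sgS (sgv _ r22 r32) r31 r32 r33 E; case: E => -[_ hrl _ _] _ _ _ h44.
        have vl : nval s' rl = l by [].
        have vq : nval s' rq = qj j.+1 by [].
        have vvi : nval s' vi = i' by [].
        have vvj : nval s' vj = k by [].
        case: FR => _ hF _; rewrite !fvalE nvalC h44 !hF //.
        by rewrite !(nvalE, vP, vw, ve, vl, vq, vvi, vvj).
    move=> s5 f5 /= h5; rewrite /= in f5; carryM f5.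
    apply: (tri_conseq (tri_cp (m := D) _ _ _ _ _ h5)) => //; first exact: Dv.
    move=> s6 f6 /= h6 s7 f7.
    have -> : Sj j - i.+1 = sg by lia.
    apply: (unsplit_stage (X := fmem s4 42) l23 l_neq0 _ (xij_root j.+1) sgS (SjK j)) => //.
    move=> idx; rewrite lmE -/(qj j.+1) -DE => hidx.
    by case: f7 => _ hF _; rewrite hF // h6.
  - by move=> s' _; rewrite subnn.
move=> s2 f2 I2; rewrite /= in f2; carryM f2.
apply: tri_seq.
  apply: (@tri_map _ _ _ _ _ _ _ _ _ D' 0 (unpad_fun l (mj j) (qj j.+1) (fmem s2 42))) => //.
  - exact: Dv'.
  - move=> s' i' _ FR ei; rewrite /sim in FR; carryM FR; split=> //.
    case: E => -[_ hrl _ _] _ _ _ _; case: FR => _ hF _.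
    have vl : nval s' rl = l by [].
    have vq : nval s' rq = qj j.+1 by [].
    have vm : nval s' rm = mj j by [].
    have vvi : nval s' vi = i' by [].
    by rewrite !fvalE !hF // !(nvalE, vl, vq, vm, vvi).
move=> s3 f3 [h3 _]; rewrite /= in f3; carryM f3.
apply: (tri_conseq (tri_cp (m := D') (f := unpad_fun l (mj j) (qj j.+1) (fmem s2 42)) _ _ _ _ _ _)) => //; first exact: Dv'.
move=> s4 f4 /= h4 b hb.
rewrite -mqE (@elem_unpad _ _ iota l _ _ (Bj j) _ mj_gt0 qj_gt0 l_gt1 _ (fmem s2 42) _ H3) //.
- by rewrite (conv_sum _ _ _ (leqnn _)) -!HV //; lia.
- by rewrite -xijS; apply: root_one l23 _ (xij_root j.+1).
- by move=> idx; rewrite -DE' => hidx; apply: h4.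
- move=> b' t hb' ht; have := I2 b' 0 t hb'; rewrite expn0 subn0 lmE muln1 addn0 xijS => -> //.
  by rewrite big_ord1 mul0n addn0 !mul0n GRing.expr0 GRing.mulr1.
Qed.

Hypothesis ktab_Lam : ktab Lam <= 2.

Lemma bottom_trip : qj Lam <= trip n 0 0.
Proof.
apply: leq_trans (_ : 9 <= _); last by rewrite /trip !expn0 !muln1 /tripc -lock.
apply: leq_trans (_ : l ^ 2 <= _); first by rewrite leq_pexp2l.
by case/orP: l23 => /eqP->.
Qed.

Lemma tri_bottom s : mulenv s ->
  tri n bottom_prog s (fun s' => forall e, e < Bj Lam ->
    elem iota (fmem s' 42) (qj Lam) (xij Lam) e =
    (elem iota (fmem s 40) (qj Lam) (xij Lam) e *
     elem iota (fmem s 40) (qj Lam) (xij Lam) (e + Bj Lam)%N)%R).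
Proof.
move=> E; set D := Q * l ^ Lam; set q := qj Lam.
have q_gt0 : 0 < q by rewrite expn_gt0 l_gt0.
have BqD : Bj Lam * q = D by rewrite BqE.
apply: tri_seq.
  apply: (@tri_set _ _ _ _ _ q); last exact: pow_cell (ktab_leK _).
  by case: E => _ h5 h6 h7 _; rewrite /= h5 h7 // h6 //; apply: leqW (ktab_leK _).
move=> s1 f1 /= r31; rewrite /= in f1; carryM f1.
have X40 : fmem s1 40 =1 fmem s 40 by case: f1 => _ h _; apply: h.
have Dv s' : mulenv s' -> nval s' (rQ |*| pw (nvar 5)) = D.
  by move=> [[_ _ _ r4] r5 h6 _ _]; rewrite /= r4 r5 h6 //; apply: leqW.
apply: tri_conseq.
  apply: (@tri_sum _ _ _ _ _ _ _ _ _ _ _ D (fun=> q)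
    (fun idx i => (fmem s 40 (idx %/ q * q + i) *
       fmem s 40 (D + (idx %/ q * q + (idx %% q + (q - i %% q)) %% q)%N))%R)) => //.
  - exact: Dv.
  - exact: tot_trip'.
  - move=> s' i _ FR ei; rewrite /sim in FR; carryM FR; split; first exact: r31.
    exact: bottom_trip.
  - move=> s' i k _ kq FR ei ej; rewrite /sim in FR; carryM FR; case: FR => _ hF _.
    have vq : nval s' rq = q by [].
    have vvi : nval s' vi = i by [].
    have vvj : nval s' vj = k by [].
    have vD := Dv _ E.
    by rewrite !fvalE !hF // !X40 !nvalD vD !(nvalE, vq, vvi, vvj).
move=> s2 _ /= h e he.
have zq : (xij Lam ^+ q = 1)%R by exact: root_one l23 (ktab_gt0 _) (xij_root Lam).
rewrite [X in _ = (X * _)%R]/elem GRing.mulr_suml.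
transitivity (\sum_(i < q) (iota (fmem s 40 (e * q + i)) *
   \sum_(y < q) iota (fmem s 40 ((e + Bj Lam) * q + (y + (q - i %% q)) %% q)%N) * xij Lam ^+ y))%R.
  under [RHS]eq_bigr do rewrite GRing.mulr_sumr.
  rewrite exchange_big /=; apply: eq_bigr => y _.
  rewrite h; last by rewrite -BqD ltn_mulD.
  rewrite rmorph_sum GRing.mulr_suml; apply: eq_bigr => i _.
  rewrite !(div_mulDl, mod_mulDl) // rmorphM -GRing.mulrA.
  by congr (_ * (iota (fmem s 40 _) * _))%R; rewrite mulnDl BqD; ring.
apply: eq_bigr => i _; rewrite -GRing.mulrA; congr (_ * _)%R.
exact: (sum_rotl (fun y => iota (fmem s 40 ((e + Bj Lam) * q + y)%N)) i q_gt0 zq).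
Qed.

Lemma Bj0 : Bj 0 = 1. Proof. by rewrite /Bj subnn. Qed.
Lemma qj0 : qj 0 = Q. Proof. by []. Qed.
Lemma xij0 : xij 0 = xi. Proof. by rewrite /xij subnn GRing.expr1. Qed.

Lemma tri_transform s : mulenv s ->
  tri n transform_prog s (fun s' =>
    elem iota (fmem s' 42) Q xi 0 =
    (elem iota (fmem s 40) Q xi 0 * elem iota (fmem s 40) Q xi 1)%R).
Proof.
move=> E.
(* The way down leaves one [link] per level; the way up consumes them from the last to the first. *)
pose chain j s' := exists Vs : nat -> nat -> S,
  [/\ forall b, b < 2 -> Vs 0 b = elem iota (fmem s 40) Q xi b,
     forall i, i < j -> link i (Vs i) (Vs i.+1) &
     forall b, b < 2 * Bj j -> elem iota (fmem s' 40) (qj j) (xij j) b = Vs j b].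
apply: (@tri_seq _ _ _ _ _ (chain Lam)).
  apply: (@tri_for _ _ _ _ _ _ _ _ _ Lam chain) => //.
  - by case: E.
  - move=> s0 [_ hF _]; exists (fun _ => elem iota (fmem s 40) Q xi); split=> // b _.
    by rewrite qj0 xij0; apply: elem_ext; apply: hF.
  - move=> j s1 jL f1 r20 [Vs [V0 Vl Ve]]; rewrite [wN _]/= [wF _]/= in f1; carryM f1.
    apply: (tri_conseq (tri_fwd_level jL E r20 Ve)) => s2 _ [V' lV hV'] s3 [_ hF _].
    exists (fun i => if i == j.+1 then V' else Vs i); split.
    + by move=> b; apply: V0.
    + move=> i; rewrite ltnS leq_eqVlt => /orP[/eqP->|ij].
        by rewrite eqxx (ltn_eqF (ltnSn j)).
      by rewrite (ltn_eqF (ltnW ij : i < j.+1)) (ltn_eqF (ij : i.+1 < j.+1)); apply: Vl.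
    + by move=> b hb; rewrite eqxx -hV' //; apply: elem_ext; apply: hF.
move=> s1 f1 [Vs [V0 Vl Ve]]; rewrite [wN _]/= [wF _]/= in f1; carryM f1.
apply: tri_seq (tri_bottom E) _ => s2 f2 h2; rewrite [wN _]/= [wF _]/= in f2; carryM f2.
pose prd j s' := forall b, b < Bj j -> elem iota (fmem s' 42) (qj j) (xij j) b = (Vs j b * Vs j (b + Bj j)%N)%R.
apply: (@tri_for _ _ _ _ _ _ _ _ _ Lam (fun i => prd (Lam - i))) => //.
- by case: E.
- move=> s0 [_ hF _] b hb; rewrite subn0 in hb *; rewrite (elem_ext _ _ _ (hF 42 isT)) h2 // !Ve //; lia.
- move=> i s3 iL f3 r20; rewrite [wN _]/= [wF _]/= in f3; carryM f3.
  have jE : (Lam - i = (Lam - i.+1).+1)%N by lia.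
  rewrite /prd jE => I3.
  apply: (tri_conseq (tri_bwd_level iL erefl E r20 (Vl _ _) I3)); first by lia.
  by move=> s4 _ h4 s5 [_ hF _] b hb; rewrite (elem_ext _ _ _ (hF 42 isT)) h4.
- move=> s3 _; rewrite subnn => /(_ 0); rewrite Bj0 qj0 xij0 => -> //.
  by rewrite !V0.
Qed.
End MulCorrect.

(** The bound 8 n <= l^K gives the cyclotomic polynomial a degree of at least 4 n, enough for all
    products formed later. [radix_K2] and [radix_K2t] serve the repeated squaring of
    [cyclic_prog]. *)
Record radix (F : fieldType) (n l K Lam : nat) : Prop := Radix {
  radix_n : 0 < n;
  radix_l : (l == 2) || (l == 3);
  radix_lF : (l%:R : F)%R != 0%R;
  radix_K : 0 < K;
  radix_Q : 8 * n <= l ^ K;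
  radix_Qle : l ^ K <= 24 * n;
  radix_D : 2 * l ^ K * l ^ Lam <= trip n 1 2;
  radix_Kt : K.+1 <= trip n 0 1;
  radix_K2 : n <= 2 ^ (2 * K);
  radix_Lt : Lam <= trip n 0 1;
  radix_LK : Lam <= K;
  radix_LK2 : ktab K Lam <= 2;
  radix_K2t : 2 * K <= trip n 0 1 }.

Section Final.
Variables (F : fieldType) (n l K Lam : nat).
Hypothesis H : radix F n l K Lam.
Let Q := l ^ K.

Lemma tri_mul (s : state F) (p1 p2 : {poly F}) : mulenv n l K Lam s ->
  (size p1 + size p2 <= 4 * n) ->
  farr s 40 Q (fun i => p1`_i)%R -> (forall i, i < Q -> fmem s 40 (Q + i) = (p2`_i)%R) ->
  tri n mul_prog s (fun s' => farr s' 43 (4 * n) (fun i => (p1 * p2)`_i)%R).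
Proof.
case: H => n0 l23 lF K0 nQ _ Dt Kt _ Lt LK LK2 _ E sz h1 h2.
have l1 : 1 < l by case/orP: l23 => /eqP->.
have QE : Q = l * l ^ K.-1 by rewrite -expnS prednK.
have Ql : Q %/ l = l ^ K.-1 by rewrite QE mulKn // ltnW.
have RE : Q - Q %/ l = l.-1 * l ^ K.-1 by rewrite Ql QE -{1}(prednK (ltnW l1)) mulSn addKn.
have R4 : 4 * n <= l.-1 * l ^ K.-1.
  by move: nQ; rewrite -/Q QE; case/orP: l23 => /eqP-> /=; lia.
have RQ : l.-1 * l ^ K.-1 <= Q by rewrite -RE leq_subr.
apply: tri_seq.
  exact: (tri_transform n0 l23 lF K0 Dt Kt Lt LK (S := cyc F l K) (@cyc_iota F l K) (xi := cyc_X F l K) (cyc_root F K l1) LK2 E).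
move=> s1 f1 e1; rewrite [wN _]/= [wF _]/= in f1.
have {}E : mulenv n l K Lam s1 := mulenv_frame f1 isT isT E.
have {}e1 : (\sum_(i < l ^ K) cyc_iota l K (fmem s1 42 i) * cyc_X F l K ^+ i =
   (\sum_(i < l ^ K) cyc_iota l K (p1`_i) * cyc_X F l K ^+ i) *
   (\sum_(i < l ^ K) cyc_iota l K (p2`_i) * cyc_X F l K ^+ i))%R.
  move: e1; rewrite /elem mul0n mul1n => e1.
  transitivity (\sum_(y < Q) cyc_iota l K (fmem s1 42 y) * cyc_X F l K ^+ y)%R => //.
  rewrite e1; congr (_ * _)%R; apply: eq_bigr => i _; first by rewrite add0n h1.
  by rewrite h2.
have poly_id (p : {poly F}) : size p <= 4 * n -> (\poly_(i < l ^ K) p`_i)%R = p.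
  move=> sp; apply/polyP => i; rewrite coef_poly; case: ltnP => // hi.
  by rewrite nth_default // (leq_trans sp) // (leq_trans _ hi) // -/Q; lia.
have sp1 : size p1 <= 4 * n by lia.
have sp2 : size p2 <= 4 * n by lia.
have := @cyc_reduce F l K l1 (fun i => p1`_i)%R (fun i => p2`_i)%R (fmem s1 42) (l ^ K) K0.
rewrite !poly_id // => /(_ _ e1) red.
have {}red i : i < l.-1 * l ^ K.-1 -> ((p1 * p2)`_i = fmem s1 42 i - fmem s1 42 (l.-1 * l ^ K.-1 + i %% l ^ K.-1)%N)%R.
  apply: red; apply: leq_trans (size_polyMleq _ _) _; apply: leq_trans (leq_pred _) _.
  exact: leq_trans sz R4.
apply: tri_conseq.
  apply: (@tri_map _ _ _ _ _ _ _ _ _ (l.-1 * l ^ K.-1) 0 (fun i => (p1 * p2)`_i)%R) => //.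
  - by case: E => -[_ r2 _ r4] _ _ _ _; rewrite /= r2 r4 -/Q RE.
  - apply: leq_trans RQ _; apply: leq_trans Dt; rewrite -/Q mulnAC leq_pmull //.
    by rewrite muln_gt0 expn_gt0 (ltnW l1).
  - move=> s' i il FR ei; split=> //; rewrite red //.
    have E' : mulenv n l K Lam s' := mulenv_frame FR isT isT E.
    case: E' => -[_ r2 _ r4] _ _ _ _; case: FR => _ hF _.
    have vl : nval s' rl = l by [].
    have vQ : nval s' rQ = Q by [].
    have vvi : nval s' vi = i by [].
    by rewrite !fvalE !hF // !(nvalE, vl, vQ, vvi) Ql -{1}Ql RE.
by move=> s2 _ [h _] i hi; rewrite -h // (leq_trans hi).
Qed.

End Final.

(** * Choice of the radix, the length and the depth *)

Definition two := FAdd FOne FOne.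
Definition three := FAdd two FOne.

(** The inverse transform divides by l; radix 2 fails exactly in characteristic 2, where 3 = 1. *)
Definition choose_radix :=
  PIf (BFzero two)
    (PSeq (PNSet 2 #0 #3) (PFSet 44 #0 (FDiv FOne three)))
    (PSeq (PNSet 2 #0 #2) (PFSet 44 #0 (FDiv FOne two))).

(** A search by a bounded loop: once the guard fails, nothing changes any more. The n + 8 rounds
    suffice because 2^(n + 8) exceeds 8 n ([pow_gt_lin]). *)
Definition find_length :=
  PSeq (PNSet 4 #0 #1) (PSeq (PNSet 3 #0 #0)
  (PFor 20 (nvar 0 |+| #8) 1 0
    (PIf (BNot (BLe (#8 |*| nvar 0) (nvar 4)))
       (PSeq (PNSet 4 #0 (nvar 4 |*| nvar 2)) (PNSet 3 #0 (nvar 3 |+| #1)))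
       PSkip))).

Definition find_depth :=
  PSeq (PNSet 8 #0 #1) (PSeq (PNSet 5 #0 #0)
  (PFor 20 (nvar 0 |+| #8) 1 0
    (PIf (BLe (nvar 8) (nvar 3))
       (PSeq (PNSet 8 #0 (#2 |*| nvar 8)) (PNSet 5 #0 (nvar 5 |+| #1)))
       PSkip))).

Definition power_table :=
  PSeq (PNSet 6 #0 #1)
  (PFor 20 (nvar 3 |+| #1) 0 1
     (PNSet 6 (nvar 20 |+| #1) (NGet 6 (nvar 20) |*| nvar 2))).

Definition exponent_table :=
  PSeq (PNSet 7 #0 (nvar 3))
  (PFor 20 (nvar 5) 0 1
     (PNSet 7 (nvar 20 |+| #1) (NGet 7 (nvar 20) |/| #2 |+| #1))).

Definition setup_prog :=
  PSeq choose_radix (PSeq find_length (PSeq find_depth (PSeq power_table exponent_table))).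

(** Hence 2^Lam > K, the outcome of [find_depth], brings the exponent down to at most 2. *)
Lemma ktab_bound K j : ktab K j <= 2 + K %/ 2 ^ j.
Proof.
elim: j => [|j IH]; first by rewrite expn0 divn1; exact: leq_addl.
rewrite ktabS expnSr divnMA; move: IH; move: (K %/ 2 ^ j) (ktab K j) => a b.
by rewrite divn2; lia.
Qed.

Section Setup.
Variables (F : fieldType) (n : nat).
Hypothesis n_gt0 : 0 < n.
Implicit Types s : state F.
Let lg := bitlen n.
Let n_lt : n < 2 ^ lg. Proof. exact: bitlenP. Qed.
Let lg_gt0 : 0 < lg. Proof. by []. Qed.
Let lg_n : lg <= n. Proof. exact: bitlen_self. Qed.
Let tc : 2 ^ 13 <= tripc. Proof. by rewrite /tripc -lock leq_pexp2l. Qed.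

Lemma cell_big : 2 ^ 13 * n <= cellmax n.
Proof.
by rewrite /cellmax leq_mul //; case: (n) n_gt0 => // k _; rewrite -{1}(expn1 k.+1) leq_pexp2l.
Qed.

Lemma trip_lin k : k <= 2 ^ 13 -> k * n <= trip n 1 0.
Proof. by move=> h; rewrite /trip expn1 expn0 muln1 leq_mul2r (leq_trans h) ?orbT. Qed.

Lemma trip_log k : k <= 2 ^ 13 -> k * lg <= trip n 0 1.
Proof. by move=> h; rewrite /trip expn1 expn0 muln1 leq_mul2r (leq_trans h) ?orbT. Qed.

Lemma trip_lin' m : m <= 2 ^ 13 * n -> m <= trip n 1 0.
Proof. by move=> h; apply: leq_trans h (trip_lin _). Qed.

Lemma cell_lin m : m <= 2 ^ 13 * n -> m <= cellmax n.
Proof. by move=> h; apply: leq_trans h cell_big. Qed.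

Lemma tri_choose_radix s : tri n choose_radix s (fun s' => exists l : nat,
  [/\ (l == 2) || (l == 3), (l%:R : F)%R != 0%R, nreg s' 2 l & fmem s' 44 0 = (l%:R^-1)%R]).
Proof.
have c3 : 3 <= cellmax n by apply: cell_lin; nia.
apply: tri_if => /= h2.
  apply: tri_seq; first by apply: (@tri_set _ _ _ _ _ 3).
  move=> s1 f1 r; apply: tri_conseq; first by apply: tri_setf; reflexivity.
  move=> s2 f2 e; exists 3; split=> //.
  - by rewrite -natr1 (_ : 2%:R = 1 + 1)%R // (eqP h2) add0r oner_neq0.
  - exact: (nreg_frame f2 isT r).
  - rewrite (e : fmem s2 44 0 = _) /= div1r; congr (_^-1)%R; ring.
apply: tri_seq; first by apply: (@tri_set _ _ _ _ _ 2) => //; apply: ltnW.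
move=> s1 f1 r; apply: tri_conseq; first by apply: tri_setf; reflexivity.
move=> s2 f2 e; exists 2; split=> //.
- exact: (nreg_frame f2 isT r).
- rewrite (e : fmem s2 44 0 = _) /= div1r; congr (_^-1)%R; ring.
Qed.

Lemma pow_gt_lin k : 24 * k < 2 ^ (k + 8).
Proof. by rewrite expnD; have := ltn_expl k (isT : 1 < 2); rewrite (_ : 2 ^ 8 = 256) //; lia. Qed.

Lemma tri_find_length s l : (l == 2) || (l == 3) -> nreg s 0 n -> nreg s 2 l ->
  tri n find_length s (fun s' => exists K,
    [/\ 8 * n <= l ^ K, l ^ K <= 24 * n, nreg s' 3 K & nreg s' 4 (l ^ K)]).
Proof.
move=> l23 r0 r2; have l3 : 2 <= l <= 3 by case/orP: l23 => /eqP->.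
apply: tri_seq; first by apply: (@tri_set _ _ _ _ _ 1) => //; apply: cell_lin; lia.
move=> s1 f1 /= r4; rewrite /= in f1; carry f1.
apply: tri_seq; first by apply: (@tri_set _ _ _ _ _ 0).
move=> s2 f2 /= r3; rewrite /= in f2; carry f2.
pose I i s' := exists K, [/\ (K == i) || (8 * n <= l ^ K), l ^ K <= 24 * n, K <= i, nreg s' 3 K & nreg s' 4 (l ^ K)].
apply: (@tri_for _ _ _ _ _ _ _ _ _ (n + 8) I) => //.
- by rewrite /= r0.
- by apply: trip_lin'; lia.
- move=> s0 f0; exists 0; carry f0; rewrite expn0 eqxx; split=> //; lia.
- move=> i s3 ii f3 r20 [K [h1 h2 h3 r3' r4']]; rewrite /= in f3; clear r3 r4; carry f3.
  have Kc : K.+1 <= cellmax n by apply: cell_lin; lia.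
  apply: tri_if; rewrite /= r0 r4' => hb; last first.
    apply: tri_skip => s4 f4; carry f4; exists K; rewrite negbK in hb.
    by split=> //; [rewrite hb orbT|apply: leqW].
  have {}h1 : K = i by move: h1; rewrite (negPf hb) orbF => /eqP.
  have lK : l ^ K * l <= 24 * n by move: hb; rewrite -ltnNge; nia.
  apply: tri_seq.
    apply: (@tri_set _ _ _ _ _ (l ^ K * l)); first by rewrite /= r4' r2.
    by apply: cell_lin; lia.
  move=> s4 f4 /= r4; rewrite /= in f4; carry f4.
  apply: tri_conseq; first by apply: (@tri_set _ _ _ _ _ K.+1) => //=; rewrite r3' addn1.
  move=> s5 f5 /= r3; rewrite /= in f5; carry f5.
  move=> s6 f6; carry f6; exists K.+1; rewrite expnSr h1 eqxx; split=> //; rewrite -h1 //.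
- move=> s' f' [K [h1 h2 h3 r3' r4']]; exists K; split=> //.
  case/orP: h1 => // /eqP->; apply: leq_trans (_ : 2 ^ (n + 8) <= _).
    by have := pow_gt_lin n; lia.
  by rewrite leq_exp2r ?addn_gt0 ?orbT //; case/andP: l3.
Qed.

Lemma tri_find_depth s l K : (l == 2) || (l == 3) -> 8 * n <= l ^ K -> l ^ K <= 24 * n ->
  nreg s 0 n -> nreg s 3 K ->
  tri n find_depth s (fun s' => exists2 Lam, K < 2 ^ Lam <= 2 * K & nreg s' 5 Lam).
Proof.
move=> l23 Q1 Q2 r0 r3; have l3 : 2 <= l <= 3 by case/orP: l23 => /eqP->.
have K0 : 0 < K by case: (K) Q1; [rewrite expn0; lia|].
have Kn : K <= 24 * n.
  apply: leq_trans Q2; apply: ltnW; apply: ltn_expl; by case/andP: l3.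
apply: tri_seq; first by apply: (@tri_set _ _ _ _ _ 1) => //; apply: cell_lin; lia.
move=> s1 f1 /= r8; rewrite /= in f1; carry f1.
apply: tri_seq; first by apply: (@tri_set _ _ _ _ _ 0).
move=> s2 f2 /= r5; rewrite /= in f2; carry f2.
pose I i s' := exists L, [/\ (L == i) || (K < 2 ^ L), 2 ^ L <= 2 * K, L <= i, nreg s' 5 L & nreg s' 8 (2 ^ L)].
apply: (@tri_for _ _ _ _ _ _ _ _ _ (n + 8) I) => //.
- by rewrite /= r0.
- by apply: trip_lin'; lia.
- move=> s0 f0; exists 0; carry f0; rewrite expn0 eqxx; split=> //; lia.
- move=> i s3 ii f3 r20 [L [h1 h2 h3 r5' r8']]; rewrite /= in f3; clear r5 r8; carry f3.
  have Lc : L.+1 <= cellmax n by apply: cell_lin; lia.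
  apply: tri_if; rewrite /= r3 r8' => hb; last first.
    apply: tri_skip => s4 f4; carry f4; exists L; rewrite -ltnNge in hb.
    by split=> //; [rewrite hb orbT|apply: leqW].
  have {}h1 : L = i by move: h1; rewrite ltnNge hb orbF => /eqP.
  apply: tri_seq.
    apply: (@tri_set _ _ _ _ _ (2 ^ L.+1)); first by rewrite /= r8' expnS.
    by apply: cell_lin; rewrite expnS; lia.
  move=> s4 f4 /= r8; rewrite /= in f4; carry f4.
  apply: tri_conseq; first by apply: (@tri_set _ _ _ _ _ L.+1) => //=; rewrite r5' addn1.
  move=> s5 f5 /= r5; rewrite /= in f5; carry f5.
  move=> s6 f6; carry f6; exists L.+1; rewrite h1 eqxx; split=> //; rewrite -h1 // expnS; lia.
- move=> s' f' [L [h1 h2 h3 r5' r8']]; exists L => //; rewrite h2 andbT.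
  case/orP: h1 => // /eqP eL; rewrite eL in h2 *.
  by have := pow_gt_lin n; lia.
Qed.

Lemma radixP l K Lam : (l == 2) || (l == 3) -> (l%:R : F)%R != 0%R ->
  8 * n <= l ^ K -> l ^ K <= 24 * n -> K < 2 ^ Lam <= 2 * K -> radix F n l K Lam.
Proof.
move=> l23 lF Q1 Q2 /andP[L1 L2]; have l3 : 2 <= l <= 3 by case/orP: l23 => /eqP->.
have K0 : 0 < K by case: (K) Q1; [rewrite expn0; lia|].
have K6 : K <= 6 * lg.
  have : 2 ^ K < 2 ^ (5 + lg).
    apply: leq_ltn_trans (_ : l ^ K < _); first by rewrite leq_exp2r //; case/andP: l3.
    by rewrite expnD (_ : 2 ^ 5 = 32) //; lia.
  by rewrite ltn_exp2l //; lia.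
have LK : Lam <= K.
  rewrite leqNgt; apply/negP => h; have : 2 ^ K.+1 <= 2 ^ Lam by rewrite leq_exp2l.
  by rewrite expnS; have := ltn_expl K (isT : 1 < 2); lia.
split=> //.
(* The padding costs l^Lam <= 4^Lam <= (2 K)^2, which is O((log n)^2); this is the origin of the
   annotation n (log n)^2 on loops over all the data. *)
- have h4 : l ^ Lam <= (2 ^ Lam) ^ 2.
    by rewrite -expnM mulnC expnM; case: (Lam) => // k; rewrite leq_exp2r //; case/andP: l3; lia.
  have h5 : (2 ^ Lam) ^ 2 <= (12 * lg) ^ 2 by rewrite leq_exp2r //; lia.
  rewrite /trip expn1; apply: leq_trans (_ : 2 ^ 13 * n * lg ^ 2 <= _); last by rewrite !leq_mul.
  apply: leq_trans (leq_mul (leq_mul (leqnn 2) Q2) (leq_trans h4 h5)) _.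
  have -> : 2 * (24 * n) * (12 * lg) ^ 2 = (2 * 24 * 12 * 12) * (n * lg ^ 2) by ring.
  by rewrite -[2 ^ 13 * n * _]mulnA leq_mul.
- by apply: leq_trans (trip_log (_ : 7 <= _)) => //; lia.
- apply: leq_trans (_ : l ^ K <= _); first lia.
  by rewrite expnM leq_exp2r //; case/andP: l3; lia.
- by apply: leq_trans (trip_log (_ : 7 <= _)) => //; lia.
- by have := ktab_bound K Lam; rewrite divn_small.
- by apply: leq_trans (trip_log (_ : 12 <= _)) => //; lia.
Qed.

Lemma tri_setup s : nreg s 0 n ->
  tri n setup_prog s (fun s' => exists l K Lam,
     radix F n l K Lam /\ mulenv n l K Lam s').
Proof.
move=> r0; apply: tri_seq (tri_choose_radix s) _ => s1 f1 [l [l23 lF r2 e44]].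
rewrite /= in f1; carry f1.
apply: tri_seq (tri_find_length l23 r0 r2) _ => s2 f2 [K [Q1 Q2 r3 r4]].
rewrite /= in f2; carry f2; have {}e44 : fmem s2 44 0 = (l%:R^-1)%R.
  by rewrite -e44; case: f2 => _ h _; apply: h.
apply: tri_seq (tri_find_depth l23 Q1 Q2 r0 r3) _ => s3 f3 [Lam hL r5].
rewrite /= in f3; carry f3; have {}e44 : fmem s3 44 0 = (l%:R^-1)%R.
  by rewrite -e44; case: f3 => _ h _; apply: h.
have R := radixP l23 lF Q1 Q2 hL.
have l3 : l <= 3 by case/orP: l23 => /eqP->.
have l1 : 0 < l by case/orP: l23 => /eqP->.
have lc i : i <= K.+1 -> l ^ i <= cellmax n.
  move=> h; apply: cell_lin; apply: leq_trans (_ : l ^ K.+1 <= _); first by rewrite leq_pexp2l.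
  by rewrite expnS; nia.
apply: (@tri_seq _ _ _ _ _ (fun s' => forall i, i <= K.+1 -> nmem s' 6 i = l ^ i)).
  apply: tri_seq; first by apply: (@tri_set _ _ _ _ _ 1) => //; apply: (lc 0).
  move=> s4 f4 /= r6; rewrite /= in f4; carry f4.
  apply: (@tri_for _ _ _ _ _ _ _ _ _ K.+1 (fun k s' => forall i, i <= k -> nmem s' 6 i = l ^ i)) => //.
  - by rewrite /= r3 addn1.
  - exact: radix_Kt R.
  - by move=> s0 [hN _ _] [|i] // _; rewrite hN // r6.
  - move=> k s5 kK f5 r20 I5; rewrite /= in f5; carry f5.
    apply: tri_nset; rewrite /= r20 I5 ?r2 -?expnSr ?addn1 //; first exact: lc.
    move=> s6 [hN _ _] i hi; rewrite hN //= /upd eqxx /=; case: eqP => [->//|ne].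
    by apply: I5; lia.
move=> s4 f4 /= h6; rewrite /= in f4; carry f4; have {}e44 : fmem s4 44 0 = (l%:R^-1)%R.
  by rewrite -e44; case: f4 => _ h _; apply: h.
apply: (@tri_conseq _ _ _ _ (fun s' => forall i, i <= Lam -> nmem s' 7 i = ktab K i)).
  have Kc : K.+1 <= cellmax n by apply: leq_trans (radix_Kt R) (trip_cellmax n_gt0 _).
  apply: tri_seq; first by apply: (@tri_set _ _ _ _ _ K) => //; apply: ltnW.
  move=> s5 f5 /= r7; rewrite /= in f5; carry f5.
  apply: (@tri_for _ _ _ _ _ _ _ _ _ Lam (fun k s' => forall i, i <= k -> nmem s' 7 i = ktab K i)) => //.
  - exact: radix_Lt R.
  - by move=> s0 [hN _ _] [|i] // _; rewrite hN // r7.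
  - move=> k s6 kK f6 r20 I6; rewrite /= in f6; carry f6.
    have ek : ktab K k %/ 2 + 1 = ktab K k.+1 by rewrite ktabS divn2 addn1.
    apply: tri_nset; rewrite /= r20 I6 // ek.
      by apply: leq_trans (ktab_leK (radix_K R) k.+1) (ltnW Kc).
    move=> s7 [hN _ _] i hi; rewrite hN //= /upd eqxx /= addn1; case: eqP => [->//|ne].
    by apply: I6; lia.
move=> s5 f5 h7; rewrite /= in f5; carry f5.
exists l, K, Lam; split=> //; split=> //.
- by move=> i hi; case: f5 => hN _ _; rewrite hN // h6.
- by case: f5 => _ hF _; rewrite hF.
Qed.

End Setup.

(** * Krylov matrices and cyclic vectors *)

Local Open Scope ring_scope.

Section PolyAux.
Variable F : fieldType.
Implicit Types p q f : {poly F}.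

Lemma poly_eta m p : (size p <= m)%N -> \poly_(i < m) p`_i = p.
Proof.
move=> sp; apply/polyP => i; rewrite coef_poly; case: ltnP => // hi.
by rewrite nth_default // (leq_trans sp).
Qed.

Lemma monic_coef_size p m : p \is monic -> size p = m.+1 -> p`_m = 1.
Proof. by move=> /monicP <- sp; rewrite lead_coefE sp. Qed.

Lemma sum_shift (V : nmodType) m a (f : nat -> V) : (a <= m)%N ->
  (forall i, (i < a)%N -> f i = 0) ->
  \sum_(i < m) f i = \sum_(i < m - a) f (a + i)%N.
Proof.
move=> am f0; have [k ->] : exists k, m = (a + k)%N by exists (m - a)%N; rewrite subnKC.
by rewrite addKn big_split_ord /= big1 ?add0r // => i _; apply: f0.
Qed.

Lemma sum_widen (V : nmodType) m m' (f : nat -> V) : (m <= m')%N ->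
  (forall i, (m <= i)%N -> f i = 0) -> \sum_(i < m') f i = \sum_(i < m) f i.
Proof.
move=> am f0; rewrite -(subnKC am) big_split_ord /= [X in _ + X]big1 ?addr0 // => i _.
by rewrite f0 ?leq_addr.
Qed.
End PolyAux.

Section Krylov.
Variables (F : fieldType) (n' : nat).
Local Notation n := n'.+1.
Implicit Types (M : 'M[F]_n) (w : 'cV[F]_n) (p q h : {poly F}) (f : nat -> F).

Definition cv f : 'cV[F]_n := \col_i f i.
Definition krylov M w : 'M[F]_n := \matrix_(i, j) (M ^+ j *m w) i 0.

Lemma cv_eq f g : (forall i, (i < n)%N -> f i = g i) -> cv f = cv g.
Proof. by move=> h; apply/colP => i; rewrite !mxE h. Qed.

Lemma cvE w : w = cv (fun i => w (inord i) 0).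
Proof. by apply/colP => i; rewrite mxE inord_val. Qed.

Lemma horner_mx_sum M p m : (size p <= m)%N ->
  horner_mx M p = \sum_(i < m) p`_i *: M ^+ i.
Proof.
move=> sp; rewrite -{1}(poly_eta sp) poly_def rmorph_sum; apply: eq_bigr => i _.
by rewrite -mul_polyC rmorphM rmorphXn /= horner_mx_C horner_mx_X -mul_scalar_mx.
Qed.

Lemma horner_mx_Xn M k : horner_mx M 'X^k = M ^+ k.
Proof. by rewrite rmorphXn /= horner_mx_X. Qed.

Lemma horner_mx_cv M w c : horner_mx M (\poly_(i < n) c i) *m w = krylov M w *m cv c.
Proof.
rewrite (horner_mx_sum _ (size_poly _ _)) mulmx_suml; apply/colP => i.
rewrite mxE summxE; apply: eq_bigr => j _.
by rewrite -scalemxAl [LHS]mxE coef_poly ltn_ord [krylov _ _ _ _]mxE [cv _ _ _]mxE mulrC.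
Qed.

Lemma horner_mxM M p q w : horner_mx M (p * q) *m w = horner_mx M p *m (horner_mx M q *m w).
Proof. by rewrite rmorphM mulmxA. Qed.

Lemma horner_mx_tr M p : horner_mx M^T p = (horner_mx M p)^T.
Proof.
rewrite !(horner_mx_sum _ (leqnn (size p))) linear_sum; apply: eq_bigr => i _.
rewrite linearZ /=; congr (_ *: _).
elim: (nat_of_ord i) => [|k IH]; first by rewrite !expr0 trmx1.
by rewrite exprSr exprS trmx_mul IH.
Qed.

Lemma horner_mx_sim M M' U V p : V *m U = 1%:M -> M' = U *m M *m V ->
  horner_mx M' p = U *m horner_mx M p *m V.
Proof.
move=> VU ->; have UV : U *m V = 1%:M by apply: mulmx1C.
have powE k : (U *m M *m V) ^+ k = U *m (M ^+ k) *m V.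
  elim: k => [|k IH]; first by rewrite !expr0 mulmx1 UV.
  by rewrite !exprS IH -!mulmxE !mulmxA -[_ *m V *m U]mulmxA VU mulmx1.
rewrite !(horner_mx_sum _ (leqnn (size p))) mulmx_sumr mulmx_suml; apply: eq_bigr => i _.
by rewrite powE -scalemxAr -scalemxAl.
Qed.

Lemma krylov_sim M M' U V w : V *m U = 1%:M -> M' = U *m M *m V ->
  krylov M' (U *m w) = U *m krylov M w.
Proof.
move=> VU e; apply/matrixP => i j; rewrite [LHS]mxE -horner_mx_Xn.
rewrite (horner_mx_sim _ VU e) horner_mx_Xn mulmxA -(mulmxA _ V) VU mulmx1 -mulmxA.
by rewrite [LHS]mxE [RHS]mxE; apply: eq_bigr => k _; rewrite [krylov _ _ _ _]mxE.
Qed.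

Variable p : {poly F}.
Hypothesis p_monic : p \is monic.
Hypothesis p_size : size p = n.+1.
Local Notation C := (companion n' p).

Lemma companion_cv f :
  C *m cv f = cv (fun i => (if i is j.+1 then f j else 0) - p`_i * f n').
Proof.
apply/colP => i; rewrite !mxE big_ord_recr /= !mxE /= eqxx mulNr; congr (_ - _).
under eq_bigr => j _ do rewrite !mxE /= (ltn_eqF (ltn_ord j)).
case: i => -[|i] hi /=.
  by rewrite big1 // => j _; rewrite mul0r.
rewrite (bigD1 (Ordinal (hi : (i < n')%N))) //= eqxx mul1r big1 ?addr0 // => j.
by rewrite -val_eqE /= eqSS eq_sym => /negPf ->; rewrite mul0r.
Qed.

Definition unitv k := cv (fun i => (i == k)%:R).

Lemma companion_pow k : (k < n)%N -> C ^+ k *m unitv 0 = unitv k.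
Proof.
elim: k => [|k IH] kn; first by rewrite expr0 mul1mx.
rewrite exprS -mulmxE -mulmxA IH ?(ltnW kn) // companion_cv; apply: cv_eq => i _.
rewrite (gtn_eqF (kn : (k < n')%N)) mulr0 subr0; case: i => [|i] //.
Qed.

Lemma mx_unitv M (i j : 'I_n) : M i j = (M *m unitv j) i 0.
Proof.
rewrite mxE (bigD1 j) //= big1 ?addr0 => [|k kj].
  by rewrite mxE eqxx mulr1.
by rewrite mxE (_ : (k == j :> nat) = false) ?mulr0 //; apply/negbTE.
Qed.

Lemma mx_cv0 M : (forall k, (k < n)%N -> M *m unitv k = 0) -> M = 0.
Proof.
by move=> h; apply/matrixP => i j; rewrite mx_unitv h // !mxE.
Qed.

Lemma cv_sum c : cv c = \sum_(i < n) c i *: unitv i.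
Proof.
apply/colP => i; rewrite mxE summxE (bigD1 i) //= big1 ?addr0 => [|k ki].
  by rewrite !mxE eqxx mulr1.
by rewrite !mxE eq_sym (_ : (k == i :> nat) = false) ?mulr0 //; apply/negbTE.
Qed.

(** p(C) kills e_0 because C^n e_0 is the last column of C; it commutes with C, and every unit
    vector is some C^k e_0. *)
Lemma companion_root : horner_mx C p = 0.
Proof.
have e0 : horner_mx C p *m unitv 0 = 0.
  rewrite (@horner_mx_sum _ _ n.+1) ?p_size // big_ord_recr /= mulmxDl.
  rewrite (monic_coef_size p_monic p_size) scale1r exprS -mulmxE -mulmxA companion_pow //.
  rewrite companion_cv mulmx_suml.
  have -> : \sum_(i < n) (p`_i *: C ^+ i) *m unitv 0 = cv (fun i => p`_i).
    by rewrite cv_sum; apply: eq_bigr => i _; rewrite -scalemxAl companion_pow.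
  apply/colP => i; rewrite !mxE eqxx mulr1 (_ : (if _ is j.+1 then _ else 0) = 0).
    by rewrite sub0r subrr.
  by case: i => -[|i] hi //=; rewrite (ltn_eqF (hi : (i < n')%N)).
apply: mx_cv0 => k kn; rewrite -companion_pow // -horner_mx_Xn -horner_mxM mulrC.
by rewrite horner_mxM e0 mulmx0.
Qed.

(** The module F[X]/p in coordinates: through it [horner_prog] multiplies polynomials modulo [p]. *)
Lemma horner_companion h : horner_mx C h *m unitv 0 = cv (fun i => (h %% p)`_i).
Proof.
have p0 : p != 0 by rewrite monic_neq0.
rewrite {1}(divp_eq h p) rmorphD rmorphM /= companion_root mulr0 add0r.
have sh : (size (h %% p)%R <= n)%N by rewrite -ltnS -p_size ltn_modp.
rewrite (horner_mx_sum _ sh) mulmx_suml cv_sum; apply: eq_bigr => i _.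
by rewrite -scalemxAl companion_pow.
Qed.

(** Column j of both sides is M^(j+1) w; in the last column this is the relation p(M) = 0. *)
Lemma krylov_companion M w : horner_mx M p = 0 -> krylov M w *m C = M *m krylov M w.
Proof.
move=> Mp; apply/matrixP => i j.
have -> : (M *m krylov M w) i j = (M ^+ j.+1 *m w) i 0.
  by rewrite exprS -mulmxE -mulmxA !mxE; apply: eq_bigr => k _; rewrite !mxE.
have -> : (krylov M w *m C) i j = (krylov M w *m (C *m unitv j)) i 0.
  by rewrite mx_unitv mulmxA.
have [jn|jn] := ltnP j n'.
  have -> : C *m unitv j = unitv j.+1.
    rewrite companion_cv; apply: cv_eq => k _.
    by rewrite (gtn_eqF jn) mulr0 subr0; case: k.
  have := horner_mx_cv M w (fun k => (k == j.+1)%:R); rewrite -/(unitv j.+1) => <-.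
  have -> : (\poly_(k < n) (k == j.+1)%:R) = 'X^(j.+1) :> {poly F}.
    apply/polyP => k; rewrite coef_poly coefXn; case: ltnP => // hk.
    by rewrite (gtn_eqF (leq_trans _ hk)).
  by rewrite horner_mx_Xn.
have jE : j = n' :> nat by apply/eqP; rewrite eqn_leq jn -ltnS ltn_ord.
have e : C *m unitv j = cv (fun k => - p`_k).
  rewrite companion_cv; apply: cv_eq => k kn; rewrite jE eqxx mulr1.
  rewrite (_ : (if k is _.+1 then _ else 0) = 0) ?sub0r //.
  by case: k kn => [|k] //= kn; rewrite (ltn_eqF (kn : (k < n')%N)).
rewrite e -horner_mx_cv jE -horner_mx_Xn.
have -> : (\poly_(k < n) (- p`_k)) = 'X^n - p.
  apply/polyP => k; rewrite coef_poly coefB coefXn.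
  have [kn|kn|->] := ltngtP k n; first by rewrite sub0r.
    by rewrite sub0r nth_default ?oppr0 // p_size.
  by rewrite (monic_coef_size p_monic p_size) subrr.
by rewrite rmorphB /= Mp subr0.
Qed.

End Krylov.

(** * The module of a rank one perturbation on two generators *)

Section TwoGenerators.
Variables (F : fieldType) (n' : nat).
Local Notation n := n'.+1.
Variables (p : {poly F}) (fa fb : nat -> F).
Hypothesis p_monic : p \is monic.
Hypothesis p_size : size p = n.+1.
Let C : 'M[F]_n := companion n' p.
Let al : 'cV[F]_n := cv n' fa.
Let be : 'cV[F]_n := cv n' fb.
Let M : 'M[F]_n := C + al *m be^T.
Let e0 : 'cV[F]_n := unitv F n' 0.
Let pa : {poly F} := \poly_(i < n) fa i.

(** The correction term in e_i = M^i e_0 - Bp_i(M) al ([unitv_gen]); the recursion [BpS] reflects M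
    e_i = e_(i+1) + fb_i al. *)
Definition Bp i : {poly F} := \poly_(k < i) fb (i.-1 - k)%N.

Lemma coef_Bp i k : (Bp i)`_k = if (k < i)%N then fb (i.-1 - k)%N else 0.
Proof. exact: coef_poly. Qed.

Lemma BpS i : Bp i.+1 = 'X * Bp i + (fb i)%:P.
Proof.
apply/polyP => k; rewrite coefD coefXM coefC !coef_Bp /=; case: k => [|k] /=.
  by rewrite add0r subn0.
by rewrite addr0 ltnS; case: ifP => // ki; congr fb; lia.
Qed.

(* The relations p(M) e0 = r1(M) al and pa(M) e0 = r2(M) al present the module
   over F[X] defined by M on its two generators e0 and al. *)
Definition r1 : {poly F} := \sum_(i < n.+1) p`_i *: Bp i.
Definition r2 : {poly F} := 1 + \sum_(i < n) fa i *: Bp i.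
Definition rdet : {poly F} := p * r2 - pa * r1.

(** The form in which the program evaluates [r1]: a correlation, summed directly at quadratic
    cost. *)
Lemma coef_r1 l : r1`_l = \sum_(k < n) p`_(l.+1 + k) * fb k.
Proof.
rewrite /r1 coef_sum.
under eq_bigr do rewrite coefZ coef_Bp.
have [ln|ln] := ltnP l n.
  rewrite (@sum_shift _ n.+1 l.+1 (fun i => p`_i * if (l < i)%N then fb (i.-1 - l)%N else 0) (leqW ln)); last first.
    by move=> i; rewrite ltnS leqNgt => /negPf ->; rewrite mulr0.
  rewrite subSS [RHS](@sum_widen _ (n - l) n (fun k => p`_(l.+1 + k) * fb k)) ?leq_subr //; last first.
    by move=> k hk; rewrite nth_default ?mul0r // p_size; lia.
  by apply: eq_bigr => k _; rewrite addSn ltnS leq_addr /= addKn.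
rewrite big1 => [|i _]; last first.
  by rewrite ltnNge (leq_trans _ ln) ?mulr0 // -ltnS.
by rewrite big1 // => k _; rewrite nth_default ?mul0r // p_size; lia.
Qed.

Lemma coef_r2 l : r2`_l = (l == 0%N)%:R + \sum_(k < n) pa`_(l.+1 + k) * fb k.
Proof.
rewrite /r2 coefD coef1 coef_sum; congr (_ + _).
under eq_bigr do rewrite coefZ coef_Bp.
have [ln|ln] := ltnP l n.
  rewrite (@sum_shift _ n l.+1 (fun i => fa i * if (l < i)%N then fb (i.-1 - l)%N else 0)) //; last first.
    by move=> i; rewrite ltnS leqNgt => /negPf ->; rewrite mulr0.
  rewrite [RHS](@sum_widen _ (n - l.+1) n (fun k => pa`_(l.+1 + k) * fb k)) ?leq_subr //; last first.
    by move=> k hk; rewrite coef_poly ltnNge (_ : n <= _)%N ?mul0r //; lia.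
  apply: eq_bigr => k _; rewrite coef_poly (_ : l.+1 + k < n)%N; last by have := ltn_ord k; lia.
  by rewrite addSn ltnS leq_addr /= addKn.
rewrite big1 => [|i _]; last first.
  by rewrite ltnNge (leq_trans (ltnW (ltn_ord i)) ln) mulr0.
by rewrite big1 // => k _; rewrite coef_poly ltnNge (_ : n <= _)%N ?mul0r //; lia.
Qed.

Let act (h : {poly F}) (w : 'cV[F]_n) : 'cV[F]_n := horner_mx M h *m w.
Implicit Types (h g : {poly F}) (w : 'cV[F]_n).

Let actM h g w : act (h * g) w = act h (act g w). Proof. exact: horner_mxM. Qed.
Let actD h g w : act (h + g) w = act h w + act g w.
Proof. by rewrite /act rmorphD mulmxDl. Qed.
Let actB h g w : act (h - g) w = act h w - act g w.
Proof. by rewrite /act rmorphB mulmxBl. Qed.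
Let actZ c h w : act (c *: h) w = c *: act h w.
Proof. by rewrite /act -mul_polyC rmorphM /= horner_mx_C -mulmxE -mulmxA mul_scalar_mx. Qed.
Let act_sum m (h : 'I_m -> {poly F}) w : act (\sum_i h i) w = \sum_i act (h i) w.
Proof. by rewrite /act rmorph_sum mulmx_suml. Qed.
Let act1 w : act 1 w = w. Proof. by rewrite /act rmorph1 mul1mx. Qed.
Let actX w : act 'X w = M *m w. Proof. by rewrite /act horner_mx_X. Qed.
Let actC c w : act c%:P w = c *: w. Proof. by rewrite /act horner_mx_C mul_scalar_mx. Qed.

Lemma M_unitv k : (k < n)%N -> M *m unitv F n' k = C *m unitv F n' k + fb k *: al.
Proof.
move=> kn; rewrite mulmxDl -mulmxA; congr (_ + _).
rewrite (_ : be^T *m unitv F n' k = (fb k)%:M) ?mul_mx_scalar //.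
apply/matrixP => i j; rewrite !ord1 [LHS]mxE (bigD1 (Ordinal kn)) //= big1 => [|l lk].
  by rewrite !mxE /= eqxx mulr1 addr0.
by rewrite !mxE (_ : (l == k :> nat) = false) ?mulr0 //; apply/negbTE.
Qed.

Lemma unitv_gen k : (k < n)%N -> unitv F n' k = act 'X^k e0 - act (Bp k) al.
Proof.
elim: k => [|k IH] kn.
  by rewrite expr0 act1 (_ : Bp 0 = 0) ?/act ?rmorph0 ?mul0mx ?subr0 //; apply/polyP => i; rewrite coef_Bp coef0.
have -> : unitv F n' k.+1 = M *m unitv F n' k - fb k *: al.
  rewrite M_unitv ?(ltnW kn) // addrK -(companion_pow p kn).
  by rewrite exprS -mulmxE -mulmxA companion_pow // ltnW.
rewrite IH ?(ltnW kn) // mulmxBr -!actX -!actM -exprS BpS actD actC.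
by rewrite opprD addrA.
Qed.

(** The sum of the p_i e_i, with C e_(n-1) in place of e_n, is zero; expanding every term by
    [unitv_gen] gives the relation. *)
Lemma rel1 : act p e0 = act r1 al.
Proof.
have : \sum_(i < n.+1) p`_i *: (act 'X^i e0 - act (Bp i) al) = 0.
  rewrite big_ord_recr /= (monic_coef_size p_monic p_size) scale1r.
  have -> : act 'X^n e0 - act (Bp n) al = M *m unitv F n' n' - fb n' *: al.
    rewrite unitv_gen // mulmxBr -!actX -!actM -exprS BpS actD actC.
    by rewrite opprD addrA.
  rewrite M_unitv // addrK companion_cv.
  under eq_bigr => i _ do rewrite -unitv_gen //.
  rewrite -cv_sum; apply/colP => i; rewrite !mxE eqxx mulr1 (_ : (if _ is j.+1 then _ else 0) = 0).
    by rewrite sub0r addrN.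
  by case: i => -[|i] hi //=; rewrite (ltn_eqF (hi : (i < n')%N)).
rewrite -[in act p e0](poly_eta (eq_leq p_size)) poly_def act_sum /r1 act_sum => h.
apply/eqP; rewrite -subr_eq0 -sumrB -[X in _ == X]h; apply/eqP; apply: eq_bigr => i _.
by rewrite !actZ scalerBr.
Qed.

Lemma rel2 : act pa e0 = act r2 al.
Proof.
rewrite /pa poly_def act_sum /r2 actD act1 act_sum.
have e : al = \sum_(i < n) fa i *: (act 'X^i e0 - act (Bp i) al).
  by rewrite {1}/al cv_sum; apply: eq_bigr => i _; rewrite -unitv_gen.
rewrite {1}e -big_split /=; apply: eq_bigr => i _.
by rewrite !actZ scalerBr subrK.
Qed.

Lemma act_gen h : act h e0 = 0 -> act h al = 0 -> horner_mx M h = 0.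
Proof.
move=> h1 h2; apply: mx_cv0 => k kn; rewrite -/(act h _) unitv_gen //.
by rewrite /act mulmxBr -!horner_mxM ![h * _]mulrC !horner_mxM -!/(act _ _) h1 h2 /act !mulmx0 subrr.
Qed.

(** The adjugate of the 2 x 2 relation matrix, divided by g, shows that [rdet %/ g] kills both
    generators. With g = 1 this is [rdet_root]; a non-constant g will contradict minimality. *)
Lemma rdet_over g : g != 0 -> g %| p -> g %| pa -> g %| r1 -> g %| r2 ->
  horner_mx M (rdet %/ g) = 0.
Proof.
move=> g0 gp gpa g1 g2.
have e : rdet %/ g = p * (r2 %/ g) - pa * (r1 %/ g).
  by apply: (mulIf g0); rewrite mulrBl divpK ?dvdp_sub ?dvdp_mull // -!mulrA !divpK.
have e' : rdet %/ g = (p %/ g) * r2 - (pa %/ g) * r1.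
  by apply: (mulIf g0); rewrite mulrBl divpK ?dvdp_sub ?dvdp_mull // ![_ %/ g * _ * g]mulrAC !divpK.
apply: act_gen.
  rewrite e actB ![_ * (_ %/ g)]mulrC !actM rel1 rel2 -!actM -actB.
  rewrite (_ : _ - _ = 0) ?/act ?rmorph0 ?mul0mx //.
  apply: (mulIf g0); rewrite mul0r mulrBl ![_ %/ g * _ * g]mulrAC !divpK //; ring.
rewrite e' actB !actM -rel1 -rel2 -!actM -actB.
rewrite (_ : _ - _ = 0) ?/act ?rmorph0 ?mul0mx //.
apply: (mulIf g0); rewrite mul0r mulrBl ![_ %/ g * _ * g]mulrAC !divpK //; ring.
Qed.

Lemma rdet_root : horner_mx M rdet = 0.
Proof. by rewrite -(divp1 rdet) rdet_over ?oner_neq0 ?dvd1p. Qed.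

Lemma size_XBp i j : (i <= j)%N -> (size ('X^j * Bp i - 'X^i * Bp j)%R <= j)%N.
Proof.
move=> ij; apply/leq_sizeP => k jk; rewrite coefB !coefXnM !coef_Bp.
rewrite [(k < j)%N]ltnNge jk [(k < i)%N]ltnNge (leq_trans ij jk) /=.
have -> : (k - j < i)%N = (k - i < j)%N by lia.
case: ifP => _; last by rewrite subr0.
by rewrite (_ : (i.-1 - (k - j) = j.-1 - (k - i))%N) ?subrr //; lia.
Qed.

(** A form that shows the degree: by [size_XBp] the top coefficients of each difference cancel, so
    all summands but [p] have degree below n. *)
Lemma rdetE : rdet = p + \sum_(i < n) \sum_(j < n.+1)
   (fa i * p`_j) *: ('X^j * Bp i - 'X^i * Bp j).
Proof.
rewrite /rdet /r2 mulrDr mulr1 -addrA; congr (_ + _).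
rewrite /pa poly_def mulr_suml mulr_sumr -sumrB; apply: eq_bigr => i _.
rewrite -[in LHS](poly_eta (eq_leq p_size)) poly_def mulr_suml /r1 mulr_sumr -sumrB.
apply: eq_bigr => j _; rewrite -!scalerAl -!scalerAr !scalerA scalerBr; congr (_ *: _ - _).
exact: mulrC.
Qed.

Lemma rdet_monic : rdet \is monic /\ size rdet = n.+1.
Proof.
have sE : (size (\sum_(i < n) \sum_(j < n.+1)
   (fa i * p`_j) *: ('X^j * Bp i - 'X^i * Bp j))%R <= n)%N.
  apply: leq_trans (size_sum _ _ _) _; apply/bigmax_leqP => i _.
  apply: leq_trans (size_sum _ _ _) _; apply/bigmax_leqP => j _.
  apply: leq_trans (size_scale_leq _ _) _.
  case: (leqP i j) => ij; first by apply: leq_trans (size_XBp ij) _; rewrite -ltnS.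
  by rewrite -size_polyN opprB; apply: leq_trans (size_XBp (ltnW ij)) _; apply: ltnW.
have sp : (size (\sum_(i < n) \sum_(j < n.+1)
   (fa i * p`_j) *: ('X^j * Bp i - 'X^i * Bp j))%R < size p)%N by rewrite p_size ltnS.
by rewrite monicE rdetE lead_coefDl // size_polyDl // p_size; split=> //; rewrite -monicE.
Qed.

(** * The cyclic vector *)

Section Cyclic.
Hypothesis gen : forall h, horner_mx M h = 0 -> rdet %| h.
Variables (s G d : {poly F}) (N : nat).
Hypothesis sG : s * G %= rdet.
Hypothesis dE : d %= gcdp p pa.
Hypothesis GE : G %= gcdp rdet ((d ^+ N) %% rdet).
Hypothesis N_ge : (n <= N)%N.

Let rdet0 : rdet != 0. Proof. by rewrite monic_neq0 //; case: rdet_monic. Qed.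
Let s0 : s != 0. Proof. by apply: contraNneq rdet0 => e; move: sG; rewrite e mul0r eqp_sym eqp0. Qed.

Lemma G_dvd h : h %| G = (h %| rdet) && (h %| d ^+ N).
Proof.
rewrite (eqp_dvdr _ GE) dvdp_gcd; case hr : (h %| rdet) => //=.
by rewrite -(dvdp_mod _ hr).
Qed.

(** A common factor g of s and d is absorbed by G over and over: g^k | G implies that g^(k+1)
    divides s G, that is [rdet], and also d^N while k < N. In the end g^(N+1) divides [rdet], whose
    degree is n <= N. *)
Lemma coprime_sd : coprimep s d.
Proof.
set g := gcdp s d; have gs : g %| s by apply: dvdp_gcdl.
have gd : g %| d by apply: dvdp_gcdr.
have g0 : g != 0 by rewrite gcdp_eq0 (negPf s0).
rewrite /coprimep -/g; apply/negPn/negP => g1.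
have sg : (1 < size g)%N by have := size_poly_gt0 g; rewrite g0; move: g1; case: (size g) => [|[]].
have main k : (k <= N)%N -> g ^+ k %| G.
  elim: k => [|k IH] kN; first by rewrite expr0 dvd1p.
  rewrite G_dvd; apply/andP; split.
    by rewrite -(eqp_dvdr _ sG) exprS dvdp_mul // IH // ltnW.
  by apply: dvdp_trans (dvdp_exp2l _ kN) _; apply: dvdp_exp2r.
have := dvdp_mul gs (main N (leqnn N)); rewrite (eqp_dvdr _ sG) -exprS => /(dvdp_leq rdet0).
have [_ ->] := rdet_monic.
have : (size (g ^+ N.+1)).-1 = ((size g).-1 * N.+1)%N by rewrite size_exp.
by move: sg N_ge; move: (size _) (size _) => x y; nia.
Qed.

(** Let g be a non-constant common factor. It is prime to s, as a factor shared with s would divide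
    p and pa, hence d. So g | G, and g shares a factor g2 with d. Then g2 divides p and pa, and also
    r1 and r2 because it is prime to s; [rdet_over] yields an annihilator of too small a degree. *)
Lemma cyclic_coprime :
  coprimep (gcdp (p + s * r1) (pa + s * r2)) rdet.
Proof.
set g := gcdp (gcdp (p + s * r1) (pa + s * r2)) rdet.
rewrite /coprimep -/g; apply/negPn/negP => g1.
have gd : g %| rdet by apply: dvdp_gcdr.
have ga : g %| p + s * r1 by apply: dvdp_trans (dvdp_gcdl _ _) (dvdp_gcdl _ _).
have gb : g %| pa + s * r2 by apply: dvdp_trans (dvdp_gcdl _ _) (dvdp_gcdr _ _).
have g0 : g != 0 by rewrite gcdp_eq0 (negPf rdet0) andbF.
have cgs : coprimep g s.
  rewrite coprimep_sym; apply/coprimepP => h hs hg.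
  have hp : h %| p by rewrite -(dvdp_addl _ (dvdp_mulr r1 hs)) (dvdp_trans hg).
  have hpa : h %| pa by rewrite -(dvdp_addl _ (dvdp_mulr r2 hs)) (dvdp_trans hg).
  have hd : h %| d by rewrite (eqp_dvdr _ dE) dvdp_gcd hp.
  by have /coprimepP := coprime_sd; apply.
have gG : g %| G by rewrite -(Gauss_dvdpr _ cgs) (eqp_dvdr _ sG).
pose g2 := gcdp g d.
have g2_1 : size g2 != 1%N.
  apply: contra g1 => c; have : coprimep g (d ^+ N) by apply: coprimep_expr.
  move: gG; rewrite G_dvd => /andP[_ gN] /coprimepP /(_ g (dvdpp g) gN).
  by rewrite -size_poly_eq1.
have g20 : g2 != 0 by rewrite gcdp_eq0 (negPf g0).
have g2p : g2 %| p by apply: dvdp_trans (dvdp_gcdr _ _) _; rewrite (eqp_dvdl _ dE) dvdp_gcdl.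
have g2pa : g2 %| pa by apply: dvdp_trans (dvdp_gcdr _ _) _; rewrite (eqp_dvdl _ dE) dvdp_gcdr.
have g2g : g2 %| g by apply: dvdp_gcdl.
have c2s : coprimep g2 s by apply: coprimep_dvdr cgs; rewrite ?coprimep_sym.
have g2r1 : g2 %| r1 by rewrite -(Gauss_dvdpr _ c2s) -(dvdp_addr _ g2p) (dvdp_trans g2g).
have g2r2 : g2 %| r2 by rewrite -(Gauss_dvdpr _ c2s) -(dvdp_addr _ g2pa) (dvdp_trans g2g).
have g2rd : g2 %| rdet by apply: dvdp_trans g2g gd.
have := gen (rdet_over g20 g2p g2pa g2r1 g2r2).
have q0 : rdet %/ g2 != 0 by rewrite divp_eq0 (negPf g20) (negPf rdet0) /= -leqNgt dvdp_leq.
move=> /(dvdp_leq q0); rewrite size_divp // leqNgt => /negP; apply.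
have sg : (0 < size g2)%N by rewrite size_poly_gt0.
rewrite ltn_subrL size_poly_gt0 rdet0 andbT -ltnS prednK //.
by rewrite ltn_neqAle eq_sym g2_1.
Qed.

Lemma krylov_cyclic : krylov M (al + act s e0) \in unitmx.
Proof.
set y := al + act s e0.
have ry h : act h y = act h al + act (h * s) e0 by rewrite actM /act -mulmxDr.
have rela : act (p + s * r1) e0 = act r1 y.
  by rewrite ry actD rel1 (mulrC r1).
have relb : act (pa + s * r2) e0 = act r2 y.
  by rewrite ry actD rel2 (mulrC r2).
(* Both polynomials carry e_0 into F[M] y, and their gcd is invertible modulo [rdet]; by Bezout e_0
   itself lies in F[M] y, and with it al = y - s(M) e_0. *)
have [h0 e0E] : exists h, act h y = e0.
  have := cyclic_coprime => /Bezout_eq1_coprimepP[[u v] /= uv].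
  have [x1 [x2 eg]] : exists x1 x2, gcdp (p + s * r1) (pa + s * r2) %= x1 * (p + s * r1) + x2 * (pa + s * r2).
    by have [[x1 x2] /= ?] := Bezoutp (p + s * r1) (pa + s * r2); exists x1, x2; rewrite eqp_sym.
  have /eqpf_eq[c c0 gE] := eg.
  exists (u * (c *: (x1 * r1 + x2 * r2))).
  rewrite actM actZ actD !actM -rela -relb -!actM -actD -actZ -gE -actM.
  have z : act (v * rdet) e0 = 0 by rewrite mulrC actM /act rdet_root mul0mx.
  by rewrite -[RHS]act1 -uv actD z addr0.
have alE : act (1 - s * h0) y = al.
  by rewrite actB act1 actM e0E /y addrK.
have span w : exists h, act h y = w.
  exists (\sum_(i < n) (w (inord i) 0) *: ('X^i * h0 - Bp i * (1 - s * h0))).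
  rewrite act_sum [RHS]cvE cv_sum; apply: eq_bigr => i _.
  by rewrite actZ actB !actM e0E alE -unitv_gen.
have inj (v : 'rV[F]_n) : v *m krylov M y = 0 -> v = 0.
  move=> h; apply/rowP => i; have [q qE] := span (unitv F n' i).
  have [_ sr] := rdet_monic.
  have : v *m (act (q %% rdet) y) = 0.
    have sq : (size (q %% rdet)%R <= n)%N by rewrite -ltnS -sr ltn_modp.
    by rewrite /act -(poly_eta sq) horner_mx_cv mulmxA h mul0mx.
  have -> : act (q %% rdet) y = act q y.
    by rewrite {2}(divp_eq q rdet) actD mulrC actM {2}/act rdet_root mul0mx add0r.
  rewrite qE => /matrixP/(_ 0 0); rewrite !mxE (bigD1 i) //= big1 => [|k ki].
    by rewrite mxE eqxx mulr1 addr0.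
  by rewrite mxE (_ : (k == i :> nat) = false) ?mulr0 //; apply/negbTE.
rewrite -row_free_unit -kermx_eq0; apply/eqP/row_matrixP => i; rewrite row0.
by apply: inj; apply/sub_kermxP; apply: row_sub.
Qed.

End Cyclic.
End TwoGenerators.

(** * Rows and inverses of Krylov matrices *)

Section Recurrence.
Variables (F : fieldType) (n' : nat).
Local Notation n := n'.+1.
Variable p : {poly F}.
Hypothesis p_monic : p \is monic.
Hypothesis p_size : size p = n.+1.
Let C : 'M[F]_n := companion n' p.
Implicit Types (r : nat -> F).

Definition recur r := forall k, \sum_(i < n.+1) p`_i * r (k + i)%N = 0.

Lemma recur_krylov (M : 'M[F]_n) (x : 'rV[F]_n) (w : 'cV[F]_n) :
  horner_mx M p = 0 -> recur (fun k => (x *m (M ^+ k *m w)) 0 0).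
Proof.
move=> Mp k; have : (x *m (horner_mx M p *m (M ^+ k *m w))) 0 0 = 0.
  by rewrite Mp mul0mx mulmx0 mxE.
rewrite (@horner_mx_sum _ _ _ _ n.+1) ?p_size // mulmx_suml mulmx_sumr summxE => h.
rewrite -[RHS]h; apply: eq_bigr => i _.
by rewrite -scalemxAl -scalemxAr [RHS]mxE addnC exprD -mulmxE -!mulmxA.
Qed.

Definition revp : {poly F} := \poly_(i < n.+1) p`_(n - i).

Lemma revp_coef i : revp`_i = if (i < n.+1)%N then p`_(n - i) else 0.
Proof. exact: coef_poly. Qed.

Lemma revp_sum r m : (n <= m)%N -> recur r ->
  \sum_(j < n.+1) revp`_j * r (m - j)%N = 0.
Proof.
move=> nm hr; rewrite -[RHS](hr (m - n)%N) (reindex_inj rev_ord_inj) /=.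
apply: eq_bigr => i _; have := ltn_ord i; rewrite ltnS => hi.
rewrite revp_coef subSS (leq_ltn_trans (leq_subr _ _)) // subKn //.
by congr (_ * r _); lia.
Qed.

(* The power series inverse of revp. *)
Definition iser k : F := (C ^+ k *m unitv F n' n') ord_max 0.

(** The solution of the recurrence starting 0, ..., 0, 1; [iser] is its part from the 1 on. The
    leading zeros turn the truncated sums in [iser_sum] into full recurrence sums. *)
Let fullser k : F := (C ^+ k *m unitv F n' 0) ord_max 0.

Let iserE k : iser k = fullser (k + n').
Proof. by rewrite /iser /fullser -(companion_pow p (ltnSn n')) mulmxA mulmxE -exprD. Qed.

Let full_small k : (k < n')%N -> fullser k = 0.
Proof.
by move=> kn; rewrite /fullser companion_pow ?mxE 1?(gtn_eqF kn) // ltnW.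
Qed.

Let full_recur : recur fullser.
Proof.
move=> k; have := recur_krylov (delta_mx 0 ord_max) (unitv F n' 0) (companion_root p_monic p_size) k.
move=> h; rewrite -[RHS]h; apply: eq_bigr => i _; congr (_ * _).
by rewrite -rowE mxE.
Qed.

Lemma iser0 : iser 0 = 1.
Proof. by rewrite /iser expr0 mul1mx mxE eqxx. Qed.

Lemma iser_sum m : (0 < m)%N -> \sum_(j < m.+1) revp`_j * iser (m - j)%N = 0.
Proof.
move=> m0; pose g j := revp`_j * fullser (m + n' - j)%N.
transitivity (\sum_(j < m.+1) g j).
  apply: eq_bigr => j _; rewrite iserE /g; congr (_ * fullser _).
  by have := ltn_ord j; lia.
rewrite -(@sum_widen _ m.+1 (m.+1 + n)%N g) ?leq_addr //; last first.
  move=> j hj; rewrite /g revp_coef; case: ltnP => jn; last by rewrite mul0r.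
  by rewrite full_small ?mulr0 //; lia.
rewrite (@sum_widen _ n.+1 (m.+1 + n)%N g) ?leq_addl //; last first.
- by move=> j hj; rewrite /g revp_coef ltnNge hj mul0r.
- by lia.
by apply: revp_sum full_recur; lia.
Qed.

Lemma revp_iser N i : (i < N)%N -> (revp * \poly_(k < N) iser k)`_i = (i == 0%N)%:R.
Proof.
move=> iN; rewrite coefM.
under eq_bigr => j _ do rewrite coef_poly (leq_ltn_trans (leq_subr _ _) iN).
case: i iN => [|i] iN; last by rewrite iser_sum.
by rewrite big_ord1 iser0 revp_coef /= subn0 mulr1 (monic_coef_size p_monic p_size).
Qed.

(** The generating series of a sequence with recurrence [p] is the fraction of [numer] by [revp]; n
    initial terms determine the numerator. *)
Definition numer r : {poly F} := \poly_(i < n) ((\poly_(k < n) r k) * revp)`_i.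

Lemma revp_numer r N i : recur r -> (i < N)%N ->
  (revp * \poly_(k < N) r k)`_i = (numer r)`_i.
Proof.
move=> hr iN; rewrite coefM.
under eq_bigr => j _ do rewrite coef_poly (leq_ltn_trans (leq_subr _ _) iN).
rewrite coef_poly; case: ltnP => i_n.
  rewrite coefMr; apply: eq_bigr => j _.
  by rewrite coef_poly (leq_ltn_trans (leq_subr _ _) i_n) mulrC.
rewrite -[RHS](revp_sum i_n hr).
rewrite (@sum_widen _ n.+1 i.+1 (fun j => revp`_j * r (i - j)%N)) //.
by move=> j hj; rewrite revp_coef ltnNge hj mul0r.
Qed.

Lemma poly_trunc_split (f g : {poly F}) N : (forall i, (i < N)%N -> f`_i = g`_i) ->
  exists h, f = g + 'X^N * h.
Proof.
move=> fg; exists (drop_poly N (f - g)).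
rewrite mulrC -[X in _ + X]add0r -[0 in RHS](_ : take_poly N (f - g) = 0).
  by rewrite poly_take_drop addrC subrK.
by apply/polyP => i; rewrite coef_take_poly coef0; case: ltnP => // iN; rewrite coefB fg // subrr.
Qed.

Lemma extend_spec r N k : recur r -> (k < N)%N ->
  (numer r * \poly_(i < N) iser i)`_k = r k.
Proof.
move=> hr kN.
have [z1 e1] : exists h, revp * \poly_(i < N) r i = numer r + 'X^N * h.
  by apply: poly_trunc_split => i iN; apply: revp_numer.
have [z2 e2] : exists h, revp * \poly_(i < N) iser i = 1 + 'X^N * h.
  by apply: poly_trunc_split => i iN; rewrite revp_iser // coef1.
have e : numer r * \poly_(i < N) iser i =
    \poly_(i < N) r i + 'X^N * (\poly_(i < N) r i * z2 - z1 * \poly_(i < N) iser i).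
  have -> : numer r = revp * \poly_(i < N) r i - 'X^N * z1 by rewrite e1 addrK.
  rewrite mulrBl mulrAC e2; ring.
by rewrite e coefD coefXnM kN addr0 coef_poly kN.
Qed.

End Recurrence.

Section Rows.
Variables (F : fieldType) (n' : nat).
Local Notation n := n'.+1.
Implicit Types (r y : nat -> F).

(** A correlation is a product with a reversed polynomial, read from index n - 1 on; 2 n terms of r
    cover every k + j. *)
Lemma corr_spec r y k : (k < n)%N ->
  ((\poly_(i < 2 * n) r i) * (\poly_(i < n) y (n' - i)%N))`_(n' + k) =
  \sum_(j < n) r (k + j)%N * y j.
Proof.
move=> kn; rewrite coefM.
rewrite (@sum_shift _ (n' + k).+1 k (fun i => (\poly_(i < 2 * n) r i)`_i *
   (\poly_(i < n) y (n' - i)%N)`_(n' + k - i))); last 2 first.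
- by rewrite leqW // leq_addl.
- by move=> i ik; rewrite [X in _ * X]coef_poly ltnNge (_ : n <= _)%N ?mulr0 //; lia.
have -> : ((n' + k).+1 - k = n)%N by lia.
apply: eq_bigr => j _; have jn := ltn_ord j.
rewrite !coef_poly (_ : k + j < 2 * n)%N; last by lia.
rewrite (_ : n' + k - (k + j) < n)%N; last by lia.
by congr (_ * y _); lia.
Qed.

Lemma cauchy_spec r y k : (k < n)%N ->
  ((\poly_(i < n) r i) * (\poly_(i < n) y i))`_k = \sum_(i < k.+1) r (k - i)%N * y i.
Proof.
move=> kn; rewrite coefMr; apply: eq_bigr => i _.
have := ltn_ord i; rewrite ltnS => hi.
by rewrite !coef_poly (leq_ltn_trans hi kn) (leq_ltn_trans (leq_subr _ _) kn).
Qed.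

(** The low coefficients of a product with [revp], read backwards, are the outer sums of
    [krylov_inv]. *)
Lemma numer_low (p : {poly F}) r i : (i < n)%N -> size p = n.+1 ->
  ((\poly_(k < n) r k) * revp n' p)`_(n' - i) = \sum_(k < n) p`_(i + k.+1) * r k.
Proof.
move=> hi sp; rewrite coefM.
rewrite (@sum_widen _ (n' - i).+1 n (fun k => p`_(i + k.+1) * r k)); last 2 first.
- by lia.
- by move=> k hk; rewrite nth_default ?mul0r // sp; lia.
apply: eq_bigr => k _; have := ltn_ord k; rewrite ltnS => hk.
rewrite coef_poly (_ : k < n)%N; last by lia.
rewrite revp_coef (_ : n' - i - k < n.+1)%N; last by lia.
by rewrite mulrC; congr (p`_ _ * _); lia.
Qed.

Variables (C : 'M[F]_n) (al be y : 'cV[F]_n).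
Let M := C + al *m be^T.
Definition gseq i : F := (be^T *m (M ^+ i *m y)) 0 0.

(** Variation of constants: at each step the perturbation injects a multiple of al, which C then
    carries along. *)
Lemma pow_rank1 k : M ^+ k *m y =
  C ^+ k *m y + \sum_(i < k) gseq (k.-1 - i)%N *: (C ^+ i *m al).
Proof.
elim: k => [|k IH]; first by rewrite !expr0 big_ord0 addr0.
rewrite exprS -mulmxE -mulmxA {1}/M mulmxDl.
have -> : al *m be^T *m (M ^+ k *m y) = gseq k *: al.
  rewrite -mulmxA [be^T *m _](_ : _ = (gseq k)%:M) ?mul_mx_scalar //.
  by apply/matrixP => i j; rewrite !ord1 [RHS]mxE eqxx mulr1n.
rewrite IH mulmxDr mulmxA mulmxE -exprS -addrA; congr (_ + _).
rewrite big_ord_recl /= expr0 mul1mx subn0 addrC; congr (_ + _).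
rewrite mulmx_sumr; apply: eq_bigr => i _.
rewrite -scalemxAr mulmxA mulmxE -exprS; congr (gseq _ *: _).
by rewrite /bump /=; have := ltn_ord i; lia.
Qed.

End Rows.

Section Row.
Variables (F : fieldType) (n' : nat).
Local Notation n := n'.+1.
Variables (p : {poly F}) (U : 'M[F]_n) (al be y : 'cV[F]_n) (r : 'I_n).
Let C : 'M[F]_n := companion n' p.
Let e0 : 'cV[F]_n := unitv F n' 0.
(** Row r of U continued by the recurrence of p: row r of U C^k consists of the terms k, ..., k + n
    - 1 ([rho_corr]). *)
Definition rho k : F := (U *m (C ^+ k *m e0)) r 0.

Lemma rho_small k : (k < n)%N -> rho k = U r (inord k).
Proof.
by move=> kn; rewrite /rho companion_pow // [RHS]mx_unitv inordK.
Qed.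

Lemma rho_recur : p \is monic -> size p = n.+1 -> recur n' p rho.
Proof.
move=> pm ps k; have := recur_krylov ps (row r U) e0 (companion_root pm ps) k.
by move=> h; rewrite -[RHS]h; apply: eq_bigr => i _; rewrite -row_mul mxE.
Qed.

Lemma rho_corr (v : 'cV[F]_n) k :
  (U *m (C ^+ k *m v)) r 0 = \sum_(j < n) rho (k + j)%N * v (inord j) 0.
Proof.
rewrite {1}(cvE v) cv_sum mulmx_sumr mulmx_sumr summxE; apply: eq_bigr => j _.
rewrite -!scalemxAr [LHS]mxE mulrC; congr (_ * _).
by rewrite /rho exprD -mulmxE -!mulmxA companion_pow.
Qed.

Lemma row_out (k : 'I_n) : (U *m krylov (C + al *m be^T) y) r k =
  (\sum_(j < n) rho (k + j)%N * y (inord j) 0) +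
  (\sum_(i < k) (\sum_(j < n) rho (i + j)%N * al (inord j) 0) * gseq C al be y (k.-1 - i)%N).
Proof.
have -> : (U *m krylov (C + al *m be^T) y) r k = (U *m ((C + al *m be^T) ^+ k *m y)) r 0.
  by rewrite mxE [RHS]mxE; apply: eq_bigr => j _; rewrite [krylov _ _ _ _]mxE.
rewrite pow_rank1 mulmxDr mxE rho_corr; congr (_ + _).
rewrite mulmx_sumr summxE; apply: eq_bigr => i _.
by rewrite -scalemxAr mxE rho_corr mulrC.
Qed.
End Row.

(** * The residue form and the inverse of a Krylov matrix *)

Section Residue.
Variables (F : fieldType) (n' : nat).
Local Notation n := n'.+1.
Variable p : {poly F}.
Hypothesis p_monic : p \is monic.
Hypothesis p_size : size p = n.+1.
Implicit Types (f g : {poly F}).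

(** The residue form of F[X]/p: the coefficient of 1/X in f / p expanded at infinity. *)
Definition res f : F := (f %% p)`_n'.

Let p0 : p != 0. Proof. exact: monic_neq0. Qed.

Lemma resD f g : res (f + g) = res f + res g.
Proof. by rewrite /res modpD coefD. Qed.

Lemma resZ c f : res (c *: f) = c * res f.
Proof. by rewrite /res modpZl coefZ. Qed.

Lemma res_sum m (f : 'I_m -> {poly F}) : res (\sum_i f i) = \sum_i res (f i).
Proof.
elim/big_ind2: _ => [|x1 x2 y1 y2 <- <-|//]; first by rewrite /res mod0p coef0.
by rewrite resD.
Qed.

Lemma res_small f : (size f <= n)%N -> res f = f`_n'.
Proof. by move=> sf; rewrite /res modp_small // p_size. Qed.

Lemma res_mull f : res (p * f) = 0.
Proof. by rewrite /res modp_mulr coef0. Qed.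

(** The basis dual to 1, X, ..., X^(n-1) consists of the Horner quotients [drop_poly i.+1 p]. For l
    <= i the product X^l times the quotient has degree n - 1 - (i - l); for l > i it is, modulo p, a
    polynomial of degree below l. *)
Lemma res_dual i l : (i < n)%N -> (l < n)%N ->
  \sum_(k < n) p`_(i + k.+1) * res 'X^(l + k) = (i == l)%:R.
Proof.
move=> hi hl.
have -> : \sum_(k < n) p`_(i + k.+1) * res 'X^(l + k) = res ('X^l * drop_poly i.+1 p).
  have -> : drop_poly i.+1 p = \poly_(k < n) p`_(i + k.+1).
    apply/polyP => k; rewrite coef_drop_poly coef_poly addnC addSnnS.
    by case: ltnP => // hk; rewrite nth_default // p_size; lia.
  rewrite poly_def mulr_sumr res_sum; apply: eq_bigr => k _.
  by rewrite -scalerAr -exprD resZ.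
have sdrop : size (drop_poly i.+1 p) = (n - i)%N by rewrite size_drop_poly p_size subSS.
have [il|il] := leqP l i.
  have sz : (size ('X^l * drop_poly i.+1 p)%R <= n)%N.
    apply: leq_trans (size_polyMleq _ _) _; rewrite size_polyXn sdrop; lia.
  rewrite res_small // coefXnM ltnNge -ltnS hl /= coef_drop_poly.
  have [->|ne] := eqVneq i l.
    by rewrite addnS subnK -1?ltnS // (monic_coef_size p_monic p_size).
  by rewrite nth_default // p_size; move/eqP: ne => ne; lia.
rewrite (ltn_eqF il).
have -> : 'X^l * drop_poly i.+1 p = p * 'X^(l - i.+1) - 'X^(l - i.+1) * take_poly i.+1 p.
  rewrite -{2}(poly_take_drop i.+1 p) -{1}(subnK il) exprD; ring.
rewrite -scaleN1r resD resZ res_mull add0r mulN1r res_small ?coefXnM.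
  case: ltnP => _; first by rewrite oppr0.
  by rewrite coef_take_poly ifF ?oppr0 //; apply/negbTE; rewrite -leqNgt; lia.
apply: leq_trans (size_polyMleq _ _) _; rewrite size_polyXn.
by have := size_take_poly i.+1 p; move: (size _) => x; lia.
Qed.

Variables (M : 'M[F]_n) (w z : 'cV[F]_n).
Hypothesis Mp : horner_mx M p = 0.
Definition hank f : F := (z^T *m (horner_mx M f *m w)) 0 0.
(** The numerator over [p] of the series of the z^T M^k w in 1/X; by [hankE] it represents the
    functional [hank] through the residue form. *)
Definition hnum : {poly F} := \poly_(i < n) \sum_(k < n) p`_(i + k.+1) * hank 'X^k.

Lemma hankD f g : hank (f + g) = hank f + hank g.
Proof. by rewrite /hank rmorphD mulmxDl mulmxDr mxE. Qed.

Lemma hankZ c f : hank (c *: f) = c * hank f.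
Proof.
by rewrite /hank -mul_polyC rmorphM /= horner_mx_C -mulmxE -mulmxA mul_scalar_mx -scalemxAr mxE.
Qed.

Lemma hank_sum m (f : 'I_m -> {poly F}) : hank (\sum_i f i) = \sum_i hank (f i).
Proof.
elim/big_ind2: _ => [|x1 x2 y1 y2 <- <-|//].
  by rewrite /hank rmorph0 mul0mx mulmx0 mxE.
by rewrite hankD.
Qed.

Lemma hank_mull f : hank (p * f) = 0.
Proof. by rewrite /hank rmorphM /= Mp mul0r mul0mx mulmx0 mxE. Qed.

Lemma hankE f : hank f = res (f * hnum).
Proof.
have low k : (k < n)%N -> hank 'X^k = res ('X^k * hnum).
  move=> kn; rewrite /hnum poly_def mulr_sumr res_sum.
  under eq_bigr => i _ do rewrite -scalerAr -exprD resZ mulr_suml.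
  rewrite exchange_big /=.
  under eq_bigr => m _ do under eq_bigr => i _ do rewrite addnS -addSn addnC mulrAC.
  rewrite (bigD1 (Ordinal kn)) //= [X in _ + X]big1 ?addr0 => [|m mk].
    rewrite -mulr_suml; under eq_bigr => i _ do rewrite addnS -addnS.
    by rewrite res_dual // eqxx mul1r.
  rewrite -mulr_suml; under eq_bigr => i _ do rewrite addnS -addnS.
  by rewrite res_dual // (_ : (m == k :> nat) = false) ?mul0r //; apply/negbTE.
rewrite [in LHS](divp_eq f p) [in RHS](divp_eq f p) mulrDl ![f %/ p * p]mulrC -mulrA.
rewrite hankD hank_mull resD res_mull !add0r.
have sf : (size (f %% p)%R <= n)%N by rewrite -ltnS -p_size ltn_modp.
rewrite -(poly_eta sf) poly_def hank_sum mulr_suml res_sum; apply: eq_bigr => i _.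
by rewrite hankZ -scalerAl resZ low.
Qed.

(** Given a common factor g, put f = p / g. Then p | f hnum, so z^T M^k f(M) w = 0 for all k. The
    Krylov matrix of z gives f(M) w = 0, and that of w gives f = 0. *)
Lemma hnum_coprime : krylov M w \in unitmx -> krylov M^T z \in unitmx -> coprimep hnum p.
Proof.
move=> uw uz; apply/negPn/negP => h.
pose g := gcdp hnum p; have gp : g %| p by apply: dvdp_gcdr.
have g0 : g != 0 by rewrite gcdp_eq0 (negPf p0) andbF.
have sg : (1 < size g)%N.
  by rewrite ltn_neqAle eq_sym h size_poly_gt0.
pose f := p %/ g.
have f0 : f != 0 by rewrite divp_eq0 (negPf g0) (negPf p0) /= -leqNgt dvdp_leq.
have sf : (size f <= n)%N.
  by rewrite size_divp // p_size leq_subLR -ltnS; move: sg; move: (size g) => x; lia.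
have fN : f * hnum = p * (hnum %/ g).
  by apply: (mulIf g0); rewrite -!mulrA [hnum * g]mulrC divpK ?dvdp_gcdl // mulrA divpK.
have z0 k : (z^T *m (M ^+ k *m (horner_mx M f *m w))) 0 0 = 0.
  rewrite -horner_mx_Xn -horner_mxM -/(hank _) hankE -mulrA fN mulrCA res_mull //.
have fw : horner_mx M f *m w = 0.
  have : (krylov M^T z)^T *m (horner_mx M f *m w) = 0.
    apply/colP => i; rewrite [RHS]mxE -[RHS](z0 i) mulmxA [LHS]mxE [RHS]mxE.
    apply: eq_bigr => j _; congr (_ * _); rewrite mxE [krylov _ _ _ _]mxE.
    by rewrite -horner_mx_Xn horner_mx_tr horner_mx_Xn -[in RHS](trmxK (M ^+ i)) -trmx_mul [RHS]mxE.
  move=> e; rewrite -[LHS]mul1mx -(@mulVmx _ _ (krylov M^T z)^T) ?unitmx_tr //.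
  by rewrite -mulmxA e mulmx0.
have : krylov M w *m cv n' (fun i => f`_i) = 0 by rewrite -horner_mx_cv (poly_eta sf).
move=> e; case/negP: f0; apply/eqP/polyP => i; rewrite coef0.
have [hi|hi] := ltnP i n; last by rewrite nth_default // (leq_trans sf).
have : cv n' (fun i => f`_i) = 0 by rewrite -[LHS]mul1mx -(mulVmx uw) -mulmxA e mulmx0.
by move=> /colP/(_ (Ordinal hi)); rewrite !mxE.
Qed.

Variable q : {poly F}.
Hypothesis q_size : (size q <= n)%N.
Hypothesis q_inv : (q * hnum) %% p = 1 %% p.

Definition tcoef (r : 'I_n) k : F := ((M^T) ^+ k *m z) r 0.

(** Entry (i, l) of the product is the sum of p_(i+k+1) hank(X^(l+k) q). As q inverts [hnum], this
    is the sum of p_(i+k+1) res(X^(l+k)), to which [res_dual] applies. Column r of the inverse needs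
    only row r of the Krylov matrix of M^T, extended by recurrence. *)
Lemma krylov_inv :
  (\matrix_(i, r) \sum_(k < n) p`_(i + k.+1) * (\sum_(j < n) tcoef r (k + j) * q`_j))
   *m krylov M w = 1%:M.
Proof.
apply/matrixP => i l; rewrite [LHS]mxE.
have step k j : \sum_r tcoef r (k + j) * krylov M w r l = hank 'X^(k + j + l).
  rewrite /hank exprD horner_mxM !horner_mx_Xn [z^T *m _]mulmxA [RHS]mxE; apply: eq_bigr => r _.
    congr (_ * _); last by rewrite [LHS]mxE.
  by rewrite /tcoef -horner_mx_Xn horner_mx_tr horner_mx_Xn -(trmxK z) -trmx_mul mxE trmxK.
transitivity (\sum_(k < n) p`_(i + k.+1) * (\sum_(j < n) q`_j * hank 'X^(k + j + l))).
  under eq_bigr => r _ do rewrite mxE mulr_suml.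
  rewrite exchange_big /=; apply: eq_bigr => k _.
  under eq_bigr => r _ do rewrite -mulrA mulr_suml.
  rewrite -mulr_sumr; congr (_ * _); rewrite exchange_big /=; apply: eq_bigr => j _.
  rewrite -step mulr_sumr; apply: eq_bigr => r _; ring.
transitivity (\sum_(k < n) p`_(i + k.+1) * res 'X^(l + k)); last first.
  by rewrite res_dual // mxE.
apply: eq_bigr => k _; congr (_ * _).
transitivity (hank ('X^(l + k) * q)).
  rewrite -{2}(poly_eta q_size) poly_def mulr_sumr hank_sum; apply: eq_bigr => j _.
  by rewrite -scalerAr hankZ -exprD; congr (_ * hank 'X^_); lia.
rewrite hankE -mulrA /res -modp_mul q_inv modp_mul mulr1 //.
Qed.

End Residue.

(** * Extended Euclidean algorithm *)

Local Open Scope nat_scope.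

(* Arrays 50, 51: the remainders f, g; 52, 53: their cofactors modulo P; integer
   cells 50, 51: bounds on the sizes of f and g.  Each step lowers the sum of
   the bounds by one, so that 2n + 2 steps suffice. *)
Definition eswap :=
  let m := nvar 0 |+| #1 in
  PSeq (cp 54 50 m 1 0) (PSeq (cp 50 51 m 1 0) (PSeq (cp 51 54 m 1 0)
  (PSeq (cp 54 52 m 1 0) (PSeq (cp 52 53 m 1 0) (PSeq (cp 53 54 m 1 0)
  (PSeq (PNSet 53 #0 (nvar 50)) (PSeq (PNSet 50 #0 (nvar 51)) (PNSet 51 #0 (nvar 53))))))))).

Definition esub dst src :=
  let m := nvar 0 |+| #1 in
  PSeq (msum 54 #0 m 1 0 (#1 |-| (nvar 52 |-| nvar 90)) 0 0 (FGet dst (nvar 90))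
      (FSub FZero (FMul (FGet 55 #0) (FGet src (nvar 90 |-| nvar 52)))))
    (cp dst 54 m 1 0).

Definition ereduce :=
  PSeq (PNSet 52 #0 (nvar 51 |-| nvar 50))
  (PSeq (PFSet 55 #0 (FDiv (FGet 51 (nvar 51 |-| #1)) (FGet 50 (nvar 50 |-| #1))))
  (PSeq (esub 51 50) (PSeq (esub 53 52) (PNSet 51 #0 (nvar 51 |-| #1))))).

Definition estep :=
  PIf (BLe #1 (nvar 51))
    (PIf (BFzero (FGet 51 (nvar 51 |-| #1)))
       (PNSet 51 #0 (nvar 51 |-| #1))
       (PSeq (PIf (BNot (BLe (nvar 50) (nvar 51))) eswap PSkip) ereduce))
    PSkip.

Definition egcd_prog :=
  let m := nvar 0 |+| #1 in
  PSeq (msum 52 #0 m 1 0 #0 0 0 FZero FZero)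
  (PSeq (msum 53 #0 m 1 0 #0 0 0 FZero FZero)
  (PSeq (PFSet 53 #0 FOne)
  (PSeq (PNSet 50 #0 m)
  (PSeq (PNSet 51 #0 (nvar 0))
  (PFor 24 (#2 |*| m) 1 0 estep))))).

Section EuclidMath.
Local Open Scope ring_scope.
Variables (F : fieldType) (n : nat) (P E : {poly F}).
Implicit Types f g tf tg : {poly F}.

(** [sf] is exact but [sg] only a bound, so that leading zeros of g are dropped one at a time. By
    [ei_det] the last cofactor is P / gcd up to a unit: this is how s is found from [rdet] and G
    without a division routine. *)
Record einv f g tf tg (sf sg : nat) : Prop := EInv {
  ei_f : size f = sf; ei_sf : (0 < sf <= n.+1)%N;
  ei_g : (size g <= sg)%N; ei_sg : (sg <= n.+1)%N;
  ei_gcd : forall d, (d %| f) && (d %| g) = (d %| P) && (d %| E);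
  ei_tf : P %| f - tf * E; ei_tg : P %| g - tg * E;
  ei_det : f * tg - g * tf %= P;
  ei_stg : (size tg + sf <= n.+2)%N; ei_stf : (size tf + sg <= n.+2)%N;
  ei_stfn : (size tf <= n)%N }.

Lemma einv_init : size P = n.+1 -> (size E <= n)%N -> einv P E 0 1 n.+1 n.
Proof.
move=> sP sE; split; rewrite ?sP ?ltnS ?leqnn ?leqnSn //.
- by rewrite mul0r subr0.
- by rewrite mul1r subrr dvdp0.
- by rewrite mulr1 mulr0 subr0 eqpxx.
- by rewrite size_poly1.
- by rewrite size_poly0 add0n ltnW.
- by rewrite size_poly0.
Qed.

Lemma einv_drop f g tf tg sf sg : einv f g tf tg sf sg.+1 -> g`_sg = 0 ->
  einv f g tf tg sf sg.
Proof.
case=> [? ? h1 h2 ? ? ? ? ? h3 ?] g0; split=> //; last by apply: leq_trans h3; rewrite leq_add2l.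
  apply/leq_sizeP => j; rewrite leq_eqVlt => /orP[/eqP<-//|hj].
  by rewrite nth_default // (leq_trans h1).
exact: ltnW.
Qed.

Lemma einv_size f g tf tg sf sg : einv f g tf tg sf sg.+1 -> g`_sg != 0 -> size g = sg.+1.
Proof.
case=> [_ _ h1 _ _ _ _ _ _ _ _] g0; apply/eqP; rewrite eqn_leq h1 /= ltnNge.
by apply: contra g0 => h; rewrite nth_default.
Qed.

Lemma einv_swap f g tf tg sf sg : einv f g tf tg sf sg.+1 -> g`_sg != 0 -> (sg.+1 < sf)%N ->
  einv g f tg tf sg.+1 sf.
Proof.
move=> I g0; have sz := einv_size I g0; case: I => [h1 /andP[_ h2] h3 h4 h5 h6 h7 h8 h9 h10 h11] lt.
split=> //; rewrite ?h1 //.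
- by move=> d; rewrite andbC.
- by move: h8; rewrite /eqp -[g * tf - _]opprB dvdpNl dvdpNr.
- by move: h9 lt; lia.
Qed.

Lemma einv_reduce f g tf tg sf sg : einv f g tf tg sf sg.+1 -> g`_sg != 0 -> (sf <= sg.+1)%N ->
  let c := g`_sg / f`_sf.-1 in let h : {poly F} := c *: 'X^(sg.+1 - sf) in
  einv f (g - h * f) tf (tg - h * tf) sf sg.
Proof.
move=> I g0 le c h; have sz := einv_size I g0.
case: I => [h1 h2 h3 h4 h5 h6 h7 h8 h9 h10 h11].
have f0 : f`_sf.-1 != 0.
  by rewrite -h1 -lead_coefE lead_coef_eq0 -size_poly_gt0 h1; case/andP: h2.
have sh (p : {poly F}) : (size (h * p)%R <= (sg.+1 - sf) + size p)%N.
  rewrite -scalerAl; apply: leq_trans (size_scale_leq _ _) _.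
  by apply: leq_trans (size_polyMleq _ _) _; rewrite size_polyXn addSn.
split=> //.
- apply/leq_sizeP => j hj; rewrite coefB -scalerAl coefZ coefXnM.
  move: hj; rewrite leq_eqVlt => /orP[/eqP<-|hj].
    have /andP[sf0 _] := h2.
    rewrite ifF; last by apply/negbTE; rewrite -leqNgt; move: sf0; lia.
    have -> : (sg - (sg.+1 - sf) = sf.-1)%N by lia.
    by rewrite /c divfK // subrr.
  rewrite nth_default ?sz // sub0r ifF; last by apply/negbTE; rewrite -leqNgt; lia.
  by rewrite [X in _ * X]nth_default ?mulr0 ?oppr0 // h1; lia.
- exact: ltnW.
- move=> d; rewrite -h5; case hd : (d %| f) => //=.
  by rewrite dvdp_subl // dvdp_mull.
- have -> : g - h * f - (tg - h * tf) * E = (g - tg * E) - h * (f - tf * E) by ring.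
  by rewrite dvdp_sub // dvdp_mull.
- by have -> : f * (tg - h * tf) - (g - h * f) * tf = f * tg - g * tf by ring.
- apply: leq_trans (leq_add (size_polyD _ _) (leqnn sf)) _.
  rewrite size_polyN addn_maxl geq_max h9 /=; apply: leq_trans (leq_add (sh tf) (leqnn _)) _.
  by move: h10 le; move: (size tf) => x; lia.
- by apply: leq_trans h10; rewrite leq_add2l.
Qed.

Lemma einv_final f g tf tg sf : einv f g tf tg sf 0 ->
  [/\ f %= gcdp P E, f * tg %= P, P %| f - tf * E & (size tf <= n)%N].
Proof.
case=> [h1 h2 h3 h4 h5 h6 h7 h8 h9 h10 h11].
have g0 : g = 0 by apply/eqP; rewrite -size_poly_leq0.
split=> //; last by move: h8; rewrite g0 mul0r subr0.
have hd d : (d %| f) = (d %| P) && (d %| E) by rewrite -h5 g0 dvdp0 andbT.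
apply/andP; split; first by rewrite dvdp_gcd -hd.
by rewrite hd dvdp_gcdl dvdp_gcdr.
Qed.

End EuclidMath.

Section EuclidProg.
Local Open Scope ring_scope.
Variables (F : fieldType) (n : nat).
Hypothesis n_gt0 : (0 < n)%N.
Implicit Types s : state F.

Definition parr s a (f : {poly F}) := farr s a n.+1 (fun i => f`_i).

Lemma m_trip : (n.+1 <= trip n 1 0)%N.
Proof.
rewrite /trip expn1 expn0 muln1; apply: leq_trans (_ : 2 * n <= _)%N; first lia.
by rewrite leq_mul2r /tripc -lock (leq_trans _ (leq_pexp2l (isT : 0 < 2) (isT : 1 <= 20)))%N ?orbT.
Qed.

Lemma m_cell : (2 * n + 2 <= cellmax n)%N.
Proof.
rewrite /cellmax; apply: leq_trans (_ : 4 * n <= _)%N; first lia.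
apply: leq_mul; last by rewrite -{1}(expn1 n) leq_pexp2l.
by rewrite /tripc -lock (leq_pexp2l (isT : 0 < 2) (isT : 2 <= 20))%N.
Qed.

Lemma tri_cpm s dst src f : nreg s 0 n -> (dst != 99)%N -> (src != 99)%N -> (src != dst)%N ->
  parr s src f -> tri n (cp dst src (nvar 0 |+| #1) 1 0) s (fun s' => parr s' dst f).
Proof.
move=> r0 d99 s99 sd h; apply: tri_cp h => //; last exact: m_trip.
by rewrite /= r0 addn1.
Qed.

Lemma tri_eswap s f g tf tg sf sg : nreg s 0 n -> (sf <= n.+1)%N -> (sg <= n.+1)%N ->
  parr s 50 f -> parr s 51 g -> parr s 52 tf -> parr s 53 tg -> nreg s 50 sf -> nreg s 51 sg ->
  tri n eswap s (fun s' => [/\ parr s' 50 g, parr s' 51 f, parr s' 52 tg & parr s' 53 tf] /\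
     nreg s' 50 sg /\ nreg s' 51 sf).
Proof.
rewrite /parr => r0 lsf lsg h50 h51 h52 h53 r50 r51.
have mc := m_cell.
apply: tri_seq (tri_cpm r0 _ _ _ h50) _ => // s1 f1 h54; rewrite /= in f1; rewrite /parr in h54; carry f1.
apply: tri_seq (tri_cpm r0 _ _ _ h51) _ => // s2 f2 {}h50; rewrite /= in f2; rewrite /parr in h50; carry f2.
apply: tri_seq (tri_cpm r0 _ _ _ h54) _ => // s3 f3 {}h51; rewrite /= in f3; rewrite /parr in h51; carry f3.
apply: tri_seq (tri_cpm r0 _ _ _ h52) _ => // s4 f4 {}h54; rewrite /= in f4; rewrite /parr in h54; carry f4.
apply: tri_seq (tri_cpm r0 _ _ _ h53) _ => // s5 f5 {}h52; rewrite /= in f5; rewrite /parr in h52; carry f5.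
apply: tri_seq (tri_cpm r0 _ _ _ h54) _ => // s6 f6 {}h53; rewrite /= in f6; rewrite /parr in h53; carry f6.
apply: tri_seq; first by apply: tri_set; [exact: r50|lia].
move=> s7 f7 /= r53; rewrite /= in f7; carry f7.
apply: tri_seq; first by apply: tri_set; [exact: r51|lia].
move=> s8 f8 /= {}r50; rewrite /= in f8; carry f8.
apply: tri_conseq; first by apply: tri_set; [exact: r53|lia].
by move=> s9 f9 /= {}r51; rewrite /= in f9; carry f9.
Qed.

Lemma tri_esub dst src s (g f : {poly F}) sh c :
  (dst != 99)%N -> (src != 99)%N -> (dst != 54)%N -> (src != 54)%N -> (src != dst)%N ->
  nreg s 0 n -> nreg s 52 sh -> parr s dst g -> parr s src f -> fmem s 55 0 = c -> (dst != 55)%N ->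
  tri n (esub dst src) s (fun s' => parr s' dst (g - (c *: 'X^sh) * f)).
Proof.
rewrite /parr => d99 s99 d54 s54 sd r0 r52 hg0 hf0 hc d55.
have hg i : (i < n.+1)%N -> fmem s dst i = g`_i := hg0 i.
have hf i : (i < n.+1)%N -> fmem s src i = f`_i := hf0 i.
have dn : dst \notin [:: 54; 99] by rewrite !inE negb_or d54.
have sn : src \notin [:: 54; 99] by rewrite !inE negb_or s54.
apply: (@tri_seq _ _ _ _ _ (fun s' => parr s' 54 (g - (c *: 'X^sh) * f))).
  apply: tri_conseq.
    apply: (@tri_msum _ _ _ _ _ _ _ _ _ _ _ _ _ n.+1 0 (fun i => 1 - (sh - i))%N
      (fun i => g`_i) (fun i _ => 0 - c * f`_(i - sh))) => //.
    - by rewrite /= r0 addn1.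
    - exact: m_trip.
    - move=> s' i im FR ei; rewrite /sim in FR; carry FR; case: FR => _ hF _.
      rewrite /= r52 ei; split=> //; first by apply: leq_trans (leq_subr _ _) (trip_gt0 _ _ n_gt0).
      by rewrite hF ?hg.
    - move=> s' i j im jM FR ei ej; rewrite /sim in FR; carry FR; case: FR => _ hF _.
      by rewrite /= r52 ei !hF // hc hf // (leq_ltn_trans (leq_subr _ _)).
  move=> s' _ [h _] i im; rewrite -(add0n i) h // sum_guard coefB -scalerAl coefZ coefXnM.
  rewrite subn_eq0; case: leqP => hi; last by rewrite mulr0 addr0 subr0.
  by rewrite sub0r.
move=> s1 f1 h54; rewrite /= in f1; carry f1.
by apply: tri_cpm => //; rewrite eq_sym.
Qed.

Lemma tri_egcd s (P E : {poly F}) : nreg s 0 n -> size P = n.+1 -> (size E <= n)%N ->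
  parr s 50 P -> parr s 51 E ->
  tri n egcd_prog s (fun s' => exists f tf tg : {poly F},
    [/\ [/\ f %= gcdp P E, f * tg %= P, P %| f - tf * E & (size tf <= n)%N],
     (size tg <= n.+1)%N, parr s' 50 f, parr s' 52 tf & parr s' 53 tg]).
Proof.
rewrite /parr => r0 sP sE h50 h51; have mc := m_cell.
apply: tri_seq.
  apply: (@tri_map _ _ _ _ _ _ _ _ _ n.+1 0 (fun i => (0 : {poly F})`_i)) => //.
  - by rewrite /= r0 addn1.
  - exact: m_trip.
  - by move=> s' i _ _ _; rewrite coef0.
move=> s1 f1 [h52 _]; have {}h52 : farr s1 52 n.+1 (fun i => (0 : {poly F})`_i) := h52.
rewrite /= in f1; carry f1.
apply: tri_seq.
  apply: (@tri_map _ _ _ _ _ _ _ _ _ n.+1 0 (fun i => (0 : {poly F})`_i)) => //.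
  - by rewrite /= r0 addn1.
  - exact: m_trip.
  - by move=> s' i _ _ _; rewrite coef0.
move=> s2 f2 [h53 _]; have {}h53 : farr s2 53 n.+1 (fun i => (0 : {poly F})`_i) := h53.
rewrite /= in f2; carry f2.
apply: (@tri_seq _ _ _ _ _ (fun s' => farr s' 53 n.+1 (fun i => (1 : {poly F})`_i))).
  apply: tri_fset => i im; rewrite /= /upd eqxx /= coef1; case: eqP => // _.
  by rewrite h53 // coef0.
move=> s3 f3 {}h53; rewrite /= in f3; carry f3.
apply: tri_seq; first by apply: (@tri_set _ _ _ _ _ n.+1); [rewrite /= r0 addn1|lia].
move=> s4 f4 /= r50; rewrite /= in f4; carry f4.
apply: tri_seq; first by apply: (@tri_set _ _ _ _ _ n); [rewrite /= r0|lia].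
move=> s5 f5 /= r51; rewrite /= in f5; carry f5.
pose I i s' := exists f g tf tg sf sg,
  [/\ einv n P E f g tf tg sf sg, (sf + sg + i <= 2 * n + 1)%N \/ sg = 0%N,
      [/\ farr s' 50 n.+1 (fun i => f`_i), farr s' 51 n.+1 (fun i => g`_i),
          farr s' 52 n.+1 (fun i => tf`_i) & farr s' 53 n.+1 (fun i => tg`_i)],
      nreg s' 50 sf & nreg s' 51 sg].
apply: (@tri_for _ _ _ _ _ _ _ _ _ (2 * n.+1) I) => //.
- by rewrite /= r0 addn1.
- rewrite /trip expn1 expn0 muln1; apply: leq_trans (_ : 4 * n <= _)%N; first lia.
  by rewrite leq_mul2r /tripc -lock (leq_trans _ (leq_pexp2l (isT : 0 < 2) (isT : 2 <= 20)))%N ?orbT.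
- move=> s0 f0; carry f0; exists P, E, 0, 1, n.+1, n; split=> //; first exact: einv_init.
  by left; lia.
- move=> i s6 im f6 _ [f [g [tf [tg [sf [sg [V hm [a50 a51 a52 a53] b50 b51]]]]]]].
  clear h50 h51 h52 h53 r50 r51; rewrite [wN _]/= [wF _]/= in f6; carry f6.
  have [/andP[sf0 sfn] sgn] : (0 < sf <= n.+1)%N /\ (sg <= n.+1)%N by case: V.
  have keep s7 f' g' tf' tg' sf' sg' : einv n P E f' g' tf' tg' sf' sg' ->
     (sf' + sg' + i.+1 <= 2 * n + 1)%N \/ sg' = 0%N ->
     farr s7 50 n.+1 (fun i => f'`_i) -> farr s7 51 n.+1 (fun i => g'`_i) ->
     farr s7 52 n.+1 (fun i => tf'`_i) -> farr s7 53 n.+1 (fun i => tg'`_i) ->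
     nreg s7 50 sf' -> nreg s7 51 sg' ->
     forall s8, frame [:: 24] [::] s7 s8 -> I i.+1 s8.
    move=> V' m' x1 x2 x3 x4 x5 x6 s8 f8; carry f8.
    by exists f', g', tf', tg', sf', sg'.
  apply: tri_if; rewrite /= b51 => hsg; last first.
    have sg0 : sg = 0%N by lia.
    apply: tri_skip; apply: (keep _ f g tf tg sf sg) => //; by right.
  case: sg hsg V hm b51 sgn => // sg _ V hm b51 sgn.
  have g_at s' : farr s' 51 n.+1 (fun i => g`_i) -> nreg s' 51 sg.+1 ->
      fval s' (FGet 51 (nvar 51 |-| #1)) = g`_sg.
    by move=> x y; rewrite /= y subn1 /= x //; lia.
  apply: tri_if; rewrite [bval _ _]/= -/(fval _ (FGet 51 (nvar 51 |-| #1))) g_at // => g0.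
    apply: tri_conseq; first by apply: (@tri_set _ _ _ _ _ sg); [rewrite /= b51 subn1|lia].
    move=> s7 f7 /= r51; rewrite /= in f7; carry f7.
    apply: (keep _ f g tf tg sf sg) => //; first by apply: einv_drop V (eqP g0).
    by case: hm => // hm; left; lia.
  apply: (@tri_seq _ _ _ _ _ (fun s' => exists f g tf tg sf sg,
     [/\ einv n P E f g tf tg sf sg.+1, (sf + sg.+1 + i <= 2 * n + 1)%N, g`_sg != 0 /\ (sf <= sg.+1)%N,
      [/\ farr s' 50 n.+1 (fun i => f`_i), farr s' 51 n.+1 (fun i => g`_i),
          farr s' 52 n.+1 (fun i => tf`_i) & farr s' 53 n.+1 (fun i => tg`_i)] &
      nreg s' 50 sf /\ nreg s' 51 sg.+1])).
    have {}hm : (sf + sg.+1 + i <= 2 * n + 1)%N by case: hm.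
    apply: tri_if; rewrite /= b50 b51 => hlt; last first.
      by apply: tri_skip; exists f, g, tf, tg, sf, sg; split=> //; rewrite negbK in hlt.
    rewrite -ltnNge in hlt.
    apply: tri_conseq (tri_eswap r0 sfn sgn a50 a51 a52 a53 b50 b51) _.
    move=> s7 _ [[x1 x2 x3 x4] [x5 x6]]; case: sf hlt b50 V hm x6 sf0 sfn => // sf hlt b50 V hm x6 sf0 sfn.
    exists g, f, tg, tf, sg.+1, sf; split=> //; first exact: einv_swap V g0 hlt.
      by lia.
    split; last by lia.
    have sff : size f = sf.+1 by case: V.
    have -> : f`_sf = lead_coef f by rewrite lead_coefE sff.
    by rewrite lead_coef_eq0 -size_poly_gt0 sff.
  move=> s7 f7 [f' [g' [tf' [tg' [sf' [sg' [V' m' [g0' le'] [x1 x2 x3 x4] [x5 x6]]]]]]]].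
  clear a50 a51 a52 a53 b50 b51; rewrite [wN _]/= [wF _]/= in f7; carry f7.
  have [/andP[sf0' sfn'] sgn'] : (0 < sf' <= n.+1)%N /\ (sg'.+1 <= n.+1)%N by case: V'.
  apply: tri_seq.
    by apply: (@tri_set _ _ _ _ _ (sg'.+1 - sf')); [rewrite /= x5 x6|lia].
  move=> s8 f8 /= r52; rewrite /= in f8; carry f8.
  apply: (@tri_seq _ _ _ _ _ (fun s' => fmem s' 55 0 = g'`_sg' / f'`_sf'.-1)).
    apply: tri_conseq; first by apply: tri_setf; reflexivity.
    by move=> s9 _ ->; rewrite /= x5 x6 !subn1 x2 ?x1 //; lia.
  move=> s9 f9 hc; rewrite /= in f9; carry f9.
  apply: tri_seq; first by apply: (tri_esub (dst := 51) (src := 50)) r0 r52 x2 x1 hc _.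
  move=> s10 f10 /= {}x2; rewrite /parr in x2; rewrite [wN _]/= [wF _]/= in f10; carry f10.
  have {}hc : fmem s10 55 0 = g'`_sg' / f'`_sf'.-1 by rewrite -hc; case: f10 => _ hF _; apply: hF.
  apply: tri_seq; first by apply: (tri_esub (dst := 53) (src := 52)) r0 r52 x4 x3 hc _.
  move=> s11 f11 /= {}x4; rewrite /parr in x4; rewrite [wN _]/= [wF _]/= in f11; carry f11.
  apply: tri_conseq; first by apply: (@tri_set _ _ _ _ _ sg'); [rewrite /= x6 subn1|lia].
  move=> s12 f12 /= {}x6; rewrite /= in f12; carry f12.
  apply: (keep _ f' _ tf' _ sf' sg' (einv_reduce V' g0' le')) => //.
  by left; lia.
- move=> s6 f6 [f [g [tf [tg [sf [sg [V hm [a50 a51 a52 a53] b50 b51]]]]]]].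
  have sg0 : sg = 0%N.
    by case: hm => // hm; case: V => _ /andP[sf0 _] _ _ _ _ _ _ _ _ _; lia.
  rewrite sg0 in V; exists f, tf, tg; split=> //; first exact: einv_final V.
  by case: V => _ /andP[sf0 _] _ _ _ _ _ _ h _ _; move: h sf0; move: (size tg) => x; lia.
Qed.

End EuclidProg.

(** * The update algorithm *)

Definition i90 := nvar 90.
Definition i92 := nvar 92.

(* One step  v <- (C + alpha beta^T) v + kappa g  with C a companion matrix. *)
Definition step_prog :=
  PSeq (msum 66 #0 #1 0 0 (nvar 0) 1 0 FZero (FMul (FGet 63 i92) (FGet 60 i92)))
  (PSeq (msum 65 #0 (nvar 0) 1 0 (#1 |-| (#1 |-| i90)) 0 0
      (FSub (FAdd (FMul (FGet 67 #0) (FGet 64 i90)) (FMul (FGet 62 i90) (FGet 66 #0)))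
         (FMul (FGet 61 i90) (FGet 60 (nvar 0 |-| #1))))
      (FGet 60 (i90 |-| #1)))
  (cp 60 65 (nvar 0) 1 0)).

(** Linearly many steps of linear cost. Only O(log n) products modulo a polynomial are needed, so
    this quadratic method is affordable there. *)
Definition horner_prog :=
  let m := nvar 0 |+| #1 in
  PSeq (msum 60 #0 (nvar 0) 1 0 #0 0 0 FZero FZero)
  (PFor 24 m 1 0
    (PSeq (PFSet 67 #0 (FGet 68 (nvar 0 |-| nvar 24))) step_prog)).

Definition seq_prog :=
  PSeq (PFSet 67 #0 FZero)
  (PFor 24 (#2 |*| nvar 0) 1 0
    (PSeq (msum 66 #0 #1 0 0 (nvar 0) 1 0 FZero (FMul (FGet 70 i92) (FGet 60 i92)))
    (PSeq (PFSet 69 (nvar 24) (FGet 66 #0)) step_prog))).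

Section Vec.
Local Open Scope ring_scope.
Variables (F : fieldType) (n' : nat).
Local Notation n := n'.+1.
Implicit Types s : state F.
Variables (p : {poly F}) (fa fb : nat -> F).
Let M : 'M[F]_n := companion n' p + cv n' fa *m (cv n' fb)^T.

Lemma lin_trip k : (k <= 2 ^ 20 -> k * n <= trip n 1 0)%N.
Proof.
by move=> h; rewrite /trip expn1 expn0 muln1 leq_mul2r /tripc -lock h orbT.
Qed.

Lemma n_trip : (n <= trip n 1 0)%N.
Proof. by rewrite -{1}(mul1n n) lin_trip. Qed.

Lemma one_trip : (1 <= trip n 0 0)%N.
Proof. exact: trip_gt0. Qed.

Definition stepf (f : nat -> F) k g i :=
  (if i is j.+1 then f j else 0) - p`_i * f n' + fa i * (\sum_(j < n) fb j * f j) + k * g i.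

Lemma cv_stepf f k (g : nat -> F) : cv n' (stepf f k g) = M *m cv n' f + k *: cv n' g.
Proof.
rewrite mulmxDl companion_cv -mulmxA.
rewrite (_ : (cv n' fb)^T *m cv n' f = (\sum_(j < n) fb j * f j)%:M) ?mul_mx_scalar.
  by apply/colP => i; rewrite !mxE mulrC; congr (_ + _ + _); rewrite mulrC.
apply/matrixP => i j; rewrite !ord1 [LHS]mxE [RHS]mxE eqxx mulr1n.
by apply: eq_bigr => l _; rewrite !mxE.
Qed.

Definition genv s := [/\ nreg s 0 n, farr s 61 n (fun i => p`_i), farr s 62 n fa & farr s 63 n fb].

Lemma genv_frame lN lF s s' : frame lN lF s s' -> (0%N \notin lN) ->
  61%N \notin lF -> 62%N \notin lF -> 63%N \notin lF -> genv s -> genv s'.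
Proof.
move=> fr h0 h1 h2 h3 [a0 a1 a2 a3]; split.
- exact: nreg_frame fr h0 a0.
- exact: farr_frame fr h1 a1.
- exact: farr_frame fr h2 a2.
- exact: farr_frame fr h3 a3.
Qed.

Lemma tri_dot a s (f g : nat -> F) : (a != 66)%N -> (a != 99)%N -> nreg s 0 n -> farr s a n g -> farr s 60 n f ->
  tri n (msum 66 #0 #1 0 0 (nvar 0) 1 0 FZero (FMul (FGet a i92) (FGet 60 i92))) s
    (fun s' => fmem s' 66 0 = \sum_(j < n) g j * f j).
Proof.
move=> a66 a99 r0 ha hf.
have an : a \notin [:: 66%N; 99%N] by rewrite !inE negb_or a66.
apply: tri_conseq.
  apply: (@tri_sum _ _ _ _ _ _ _ _ _ _ _ 1%N (fun=> n) (fun _ j => g j * f j)) => //.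
  - exact: one_trip.
  - move=> s' i _ FR ei; rewrite /sim in FR; carry FR; rewrite /= r0; split=> //; exact: n_trip.
  - move=> s' i j _ jn FR ei ej; case: FR => _ hF _; rewrite /= ej !hF //.
    by rewrite ha // hf.
by move=> s' _ h; rewrite h.
Qed.

Lemma tri_step s f g k : genv s -> farr s 60 n f -> farr s 64 n g -> fmem s 67 0 = k ->
  tri n step_prog s (fun s' => farr s' 60 n (stepf f k g)).
Proof.
move=> G h60 h64 hk; have [r0 h61 h62 h63] := G.
apply: tri_seq (tri_dot (a := 63) _ _ r0 h63 h60) _ => // s1 f1 hd; rewrite /= in f1; carry f1.
have {}hk : fmem s1 67 0 = k by rewrite -hk; case: f1 => _ h _; apply: h.
apply: (@tri_seq _ _ _ _ _ (fun s' => farr s' 65 n (stepf f k g))).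
  apply: tri_conseq.
    apply: (@tri_msum _ _ _ _ _ _ _ _ _ _ _ _ _ n 0 (fun i => 1 - (1 - i))%N
      (fun i => k * g i + fa i * (\sum_(j < n) fb j * f j) - p`_i * f n') (fun i _ => f i.-1)) => //.
    - exact: n_trip.
    - move=> s' i im FR ei; rewrite /sim in FR; carry FR; case: FR => _ hF _.
      rewrite /= r0 ei subn1 /=; split=> //.
        by apply: leq_trans (leq_subr _ _) one_trip.
      by rewrite h64 // h62 // h61 // h60 // !hF // hk hd.
    - move=> s' i j im jM FR ei ej; rewrite /sim in FR; carry FR.
      by rewrite /= ei subn1 h60 // (leq_ltn_trans (leq_pred _)).
  move=> s' _ [h _] i im; rewrite -(add0n i) h // sum_guard /stepf add0n.
  by case: i im => [|i] im /=; ring.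
move=> s2 f2 h65; rewrite /= in f2; carry f2.
by apply: tri_cp h65 => //; exact: n_trip.
Qed.

Lemma cv_inj (f g : nat -> F) : cv n' f = cv n' g -> forall i, (i < n)%N -> f i = g i.
Proof. by move=> /colP h i im; have := h (Ordinal im); rewrite !mxE. Qed.

Lemma tri_horner s (f : {poly F}) (g : nat -> F) : genv s -> farr s 64 n g ->
  (size f <= n.+1)%N -> parr n s 68 f ->
  tri n horner_prog s (fun s' => exists2 v : nat -> F, farr s' 60 n v &
     cv n' v = horner_mx M f *m cv n' g).
Proof.
rewrite /parr => G h64 sf h68; have [r0 _ _ _] := G.
apply: tri_seq.
  apply: (@tri_map _ _ _ _ _ _ _ _ _ n 0 (fun=> 0)) => //; exact: n_trip.
move=> s1 f1 [h60 _]; have {}h60 : farr s1 60 n (fun=> 0) := h60.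
rewrite /= in f1; have {}G := genv_frame f1 isT isT isT isT G; carry f1.
pose I k s' := exists2 v : nat -> F, farr s' 60 n v &
   cv n' v = \sum_(i < k) f`_(n.+1 - k + i) *: (M ^+ i *m cv n' g).
apply: (@tri_for _ _ _ _ _ _ _ _ _ n.+1 I) => //.
- by rewrite /= r0 addn1.
- exact: m_trip.
- move=> s0 f0; carry f0; exists (fun=> 0) => //; rewrite big_ord0.
  by apply/colP => i; rewrite !mxE.
- move=> k s2 kn f2 r24 [v h60' ev]; rewrite [wN _]/= [wF _]/= in f2.
  have {}G := genv_frame f2 isT isT isT isT G; clear h60; carry f2.
  apply: (@tri_seq _ _ _ _ _ (fun s' => fmem s' 67 0 = f`_(n - k))).
    apply: tri_conseq; first by apply: tri_setf; reflexivity.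
    by move=> s3 _ ->; rewrite /= r24 r0 h68 //; lia.
  move=> s3 f3 hk; rewrite /= in f3; have {}G := genv_frame f3 isT isT isT isT G; carry f3.
  apply: tri_conseq (tri_step G h60' h64 hk) _ => s4 _ h4 s5 f5; carry f5.
  exists (stepf v f`_(n - k) g) => //.
  rewrite cv_stepf ev big_ord_recl /= addn0 expr0 mul1mx subSS addrC; congr (_ + _).
  rewrite mulmx_sumr; apply: eq_bigr => i _.
  rewrite -scalemxAr mulmxA mulmxE -exprS; congr (_`_ _ *: _).
  by rewrite /bump /=; lia.
- move=> s2 _ [v hv ev]; exists v => //.
  rewrite ev (horner_mx_sum _ sf) mulmx_suml subnn; apply: eq_bigr => i _.
  by rewrite -scalemxAl.
Qed.

Lemma tri_seqp s (f g : nat -> F) : genv s -> farr s 60 n f -> farr s 70 n g ->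
  tri n seq_prog s (fun s' => farr s' 69 (2 * n) (fun k => ((cv n' g)^T *m (M ^+ k *m cv n' f)) 0 0)).
Proof.
move=> G h60 h70; have [r0 _ _ _] := G.
apply: (@tri_seq _ _ _ _ _ (fun s' => fmem s' 67 0 = 0)).
  by apply: tri_conseq; first by apply: tri_setf; reflexivity.
move=> s1 f1 hk; rewrite /= in f1; have {}G := genv_frame f1 isT isT isT isT G; carry f1.
pose I k s' := fmem s' 67 0 = 0 /\
  (exists2 v : nat -> F, farr s' 60 n v & cv n' v = M ^+ k *m cv n' f) /\
  farr s' 69 k (fun k => ((cv n' g)^T *m (M ^+ k *m cv n' f)) 0 0).
apply: (@tri_for _ _ _ _ _ _ _ _ _ (2 * n)%N I) => //.
- by rewrite /= r0.
- exact: lin_trip.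
- move=> s0 f0; carry f0; split; first by case: f0 => _ h _; rewrite h.
  by split=> //; exists f => //; rewrite expr0 mul1mx.
- move=> k s2 kn f2 r24 [hk2 [[v h60' ev] h69]]; rewrite [wN _]/= [wF _]/= in f2.
  have {}G := genv_frame f2 isT isT isT isT G; clear h60; carry f2.
  apply: tri_seq (tri_dot (a := 70) _ _ r0 h70 h60') _ => // s3 f3 hd; rewrite /= in f3.
  have {}G := genv_frame f3 isT isT isT isT G; carry f3.
  have {}hk2 : fmem s3 67 0 = 0 by rewrite -hk2; case: f3 => _ h _; apply: h.
  apply: (@tri_seq _ _ _ _ _ (fun s' => farr s' 69 k.+1 (fun k => ((cv n' g)^T *m (M ^+ k *m cv n' f)) 0 0))).
    apply: tri_fset => i; rewrite ltnS /= /upd eqxx /= r24 hd; case: eqP => [-> _|ne hi].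
      by rewrite -ev mxE; apply: eq_bigr => j _; rewrite !mxE.
    by apply: h69; lia.
  move=> s4 f4 {}h69; rewrite /= in f4; have {}G := genv_frame f4 isT isT isT isT G; carry f4.
  have {}hk2 : fmem s4 67 0 = 0 by rewrite -hk2; case: f4 => _ h _; apply: h.
  have h64' : farr s4 64 n (fmem s4 64) by [].
  apply: tri_conseq (tri_step G h60' h64' hk2) _ => s5 f5 h5 s6 f6.
  rewrite [wN _]/= [wF _]/= in f5; carry f5; carry f6.
  split; first by case: f6 => _ h _; case: f5 => _ h' _; rewrite h // h'.
  split=> //; exists (stepf v 0 (fmem s4 64)) => //.
  by rewrite cv_stepf scale0r addr0 ev mulmxA mulmxE -exprS.
- by move=> s2 _ [_ [_ h]].
Qed.

End Vec.

(** * Row operations by fast products *)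

Ltac carryA FR :=
  rewrite ?[wN _]/= ?[wF _]/= in FR;
  carry FR;
  match type of FR with
  | frame _ _ ?s ?s' =>
    repeat match goal with
    | H : mulenv _ _ _ _ s |- _ =>
        first [ move: (mulenv_frame FR isT isT H) => {}H | clear H ]
    end
  end.

Definition rn := nvar 0.

(** The guard [1 - i / len] is 1 below [len] and 0 from there on; it pads the operand with zeros to
    Q entries. *)
Definition load eb len term :=
  msum 40 eb rQ 1 2 (#1 |-| i90 |/| len) 0 0 FZero term.

Definition mulp len1 term1 len2 term2 :=
  PSeq (load #0 len1 term1) (PSeq (load rQ len2 term2) mul_prog).

(* Extends a row (array 71) to 2n terms (array 72) of the linear recurrence of
   the polynomial p in array 19, with the first 2n coefficients (array 18) of
   the inverse power series of its reversal. *)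
Definition ext_prog :=
  PSeq (mulp rn (FGet 71 i90) (rn |+| #1) (FGet 19 (rn |-| i90)))
  (PSeq (mulp rn (FGet 43 i90) (#2 |*| rn) (FGet 18 i90))
        (cp 72 43 (#2 |*| rn) 1 0)).

Definition corr_prog src :=
  mulp (#2 |*| rn) (FGet 72 i90) rn (FGet src (rn |-| #1 |-| i90)).

Definition row_load src :=
  msum 71 #0 rn 1 0 #0 0 0 (FGet src (nvar 28 |*| rn |+| i90)) FZero.

Definition hi43 := FGet 43 (rn |-| #1 |+| i90).

(* Row r of U K, for the matrix U of array 100 and the Krylov matrix K of y
   (array 16) under companion(p) + alpha beta^T, where array 11 holds alpha and
   array 17 the scalars beta^T (companion(p) + alpha beta^T)^i y. *)
Definition rows_prog :=
  PFor 28 rn 1 0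
    (PSeq (row_load 100) (PSeq ext_prog
    (PSeq (corr_prog 16) (PSeq (msum 74 #0 rn 1 0 #0 0 0 hi43 FZero)
    (PSeq (corr_prog 11) (PSeq (mulp rn hi43 rn (FGet 17 i90))
      (msum 104 (nvar 28 |*| rn) rn 1 0 (#1 |-| (#1 |-| i90)) 0 0
         (FGet 74 i90) (FGet 43 (i90 |-| #1))))))))).

(** Each round computes one column of the inverse and stores it as a row of array 106, so the result
    is transposed and [tr_prog] turns it back. *)
Definition inv_prog :=
  PFor 28 rn 1 0
    (PSeq (row_load 105) (PSeq ext_prog
    (PSeq (corr_prog 75) (PSeq (mulp rn hi43 (rn |+| #1) (FGet 19 (rn |-| i90)))
      (msum 106 (nvar 28 |*| rn) rn 1 0 #0 0 0
         (FGet 43 (rn |-| #1 |-| i90)) FZero))))).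

Section Prog1.
Local Open Scope ring_scope.
Variables (F : fieldType) (n' l K Lam : nat).
Local Notation n := n'.+1.
Hypothesis R : radix F n l K Lam.
Let Q := (l ^ K)%N.
Implicit Types s : state F.
Local Notation env := (mulenv n l K Lam).

Definition lframe s s' := frame [:: 90; 91; 92; 93] [:: 40; 99] s s'.

Lemma Q_trip : (Q <= trip n 1 2)%N.
Proof.
apply: leq_trans (radix_D R); rewrite mulnAC leq_pmull // muln_gt0 expn_gt0.
by case/orP: (radix_l R) => /eqP->.
Qed.

Lemma tri_load eb B len L term s (p : {poly F}) : env s -> (0 < L)%N -> (size p <= L)%N ->
  (forall s', lframe s s' -> nval s' eb = B) ->
  (forall s', lframe s s' -> nval s' len = L) ->
  (forall s' i, (i < L)%N -> lframe s s' -> nmem s' 90 0 = i -> fval s' term = p`_i) ->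
  tri n (load eb len term) s (fun s' =>
     (forall i, (i < Q)%N -> fmem s' 40 (B + i)%N = p`_i) /\
     (forall i, ~~ (B <= i < B + Q)%N -> fmem s' 40 i = fmem s 40 i)).
Proof.
move=> E L0 sp hB hL ht; have n0 := radix_n R.
apply: tri_conseq.
  apply: (@tri_msum _ _ _ _ _ _ _ _ _ _ _ _ _ Q B (fun i => 1 - i %/ L)%N
      (fun i => 0) (fun i _ => p`_i)) => //.
  - by case: E => -[_ _ _ r4] _ _ _ _.
  - exact: Q_trip.
  - by move=> s' i _ FR _; apply: hB.
  - move=> s' i _ FR ei; split=> //; last by apply: leq_trans (leq_subr _ _) (trip_gt0 _ _ n0).
    by rewrite nvalB nvalQ hL // [nval _ i90]ei.
  - move=> s' i j _ jM FR ei _; apply: ht => //; rewrite ltnNge -divn_gt0 // -eqn0Ngt.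
    by case: (i %/ L)%N jM => [|k] //; rewrite subSS sub0n.
move=> s' _ [h1 h2]; split=> // i iQ; rewrite h1 // sum_guard add0r.
case: eqP => // /eqP; rewrite -lt0n divn_gt0 // => Li.
by rewrite nth_default // (leq_trans sp).
Qed.

Lemma tri_mulp len1 L1 term1 len2 L2 term2 s (p1 p2 : {poly F}) : env s ->
  (0 < L1)%N -> (0 < L2)%N -> (L1 + L2 <= 4 * n)%N ->
  (size p1 <= L1)%N -> (size p2 <= L2)%N ->
  (forall s', lframe s s' -> nval s' len1 = L1 /\ nval s' len2 = L2) ->
  (forall s' i, (i < L1)%N -> lframe s s' -> nmem s' 90 0 = i -> fval s' term1 = p1`_i) ->
  (forall s' i, (i < L2)%N -> lframe s s' -> nmem s' 90 0 = i -> fval s' term2 = p2`_i) ->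
  tri n (mulp len1 term1 len2 term2) s (fun s' => farr s' 43 (4 * n) (fun i => (p1 * p2)`_i)).
Proof.
move=> E L10 L20 L12 s1 s2 hlen ht1 ht2.
apply: tri_seq.
  apply: (tri_load (L := L1) (B := 0) (p := p1) E) => // s' FR.
  by case: (hlen _ FR).
move=> s3 f3 [h3 _]; rewrite /= in f3.
have l3 : lframe s s3 by apply: frame_sub f3 => // x; rewrite !inE => /or3P[] ->; rewrite ?orbT.
carryA f3; have tr s' : lframe s3 s' -> lframe s s' by apply: frame_trans.
apply: tri_seq.
  apply: (tri_load (L := L2) (B := Q) (p := p2) E) => //.
  - move=> s' FR; have E' := mulenv_frame FR isT isT E.
    by case: E' => -[_ _ _ r4] _ _ _ _.
  - by move=> s' FR; case: (hlen _ (tr _ FR)).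
  - by move=> s' i iL FR; apply: ht2 => //; apply: tr.
move=> s4 f4 [h4 h4']; rewrite /= in f4; carryA f4.
apply: (tri_mul R E _ _ h4).
  by apply: leq_trans (leq_add s1 s2) L12.
by move=> i iQ; rewrite h4' ?h3 // negb_and -ltnNge iQ.
Qed.

Lemma rnE s : env s -> nval s rn = n.
Proof. by case=> -[]. Qed.

Lemma tri_ext s (p : {poly F}) (r : nat -> F) : env s -> p \is monic -> size p = n.+1 ->
  recur n' p r -> farr s 71 n r -> farr s 19 n.+1 (fun i => p`_i) -> farr s 18 (2 * n) (iser n' p) ->
  tri n ext_prog s (fun s' => farr s' 72 (2 * n) r).
Proof.
move=> E pm ps rec h71 h19 h18; have n0 := radix_n R.
apply: tri_seq.
  apply: (tri_mulp (L1 := n) (L2 := n.+1) (p1 := \poly_(i < n) r i) (p2 := revp n' p) E) => //.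
  - by lia.
  - by rewrite /revp /numer ?size_poly.
  - move=> s' FR; rewrite /lframe in FR; carryA FR.
    by rewrite nvalD nvalC rnE // addn1.
  - move=> s' i iL FR ei; rewrite /lframe in FR; carryA FR.
    by rewrite /= ei h71 // coef_poly iL.
  - move=> s' i iL FR ei; rewrite /lframe in FR; carryA FR.
    rewrite fvalG nvalB rnE // [nval _ i90]ei h19 ?revp_coef ?iL //.
    by rewrite ltnS leq_subr.
move=> s1 f1 /= h43; carryA f1.
apply: tri_seq.
  apply: (tri_mulp (L1 := n) (L2 := (2 * n)%N) (p1 := numer n' p r) (p2 := \poly_(i < 2 * n) iser n' p i) E) => //.
  - by lia.
  - by rewrite /revp /numer ?size_poly.
  - move=> s' FR; rewrite /lframe in FR; carryA FR.
    by rewrite nvalM nvalC rnE.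
  - move=> s' i iL FR ei; rewrite /lframe in FR; carryA FR.
    by rewrite /= ei h43 ?coef_poly ?iL //; lia.
  - move=> s' i iL FR ei; rewrite /lframe in FR; carryA FR.
    by rewrite /= ei h18 // coef_poly iL.
move=> s2 f2 /= {}h43; carryA f2.
apply: (tri_cp (m := (2 * n)%N) (f := r)) => //.
- by rewrite nvalM nvalC rnE.
- exact: lin_trip.
- by move=> i i2; rewrite h43 ?(extend_spec pm ps rec) //; lia.
Qed.

Lemma tri_corr src s (r y : nat -> F) : env s -> src \notin [:: 40%N; 99%N] ->
  farr s 72 (2 * n) r -> farr s src n y ->
  tri n (corr_prog src) s (fun s' => forall k, (k < n)%N ->
     fmem s' 43 (n' + k) = \sum_(j < n) r (k + j)%N * y j).
Proof.
move=> E hs h72 hsrc; apply: tri_conseq.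
  apply: (tri_mulp (L1 := (2 * n)%N) (L2 := n) (p1 := \poly_(i < 2 * n) r i)
     (p2 := \poly_(i < n) y (n' - i)%N) E) => //.
  - by lia.
  - move=> s' FR; rewrite /lframe in FR; carryA FR.
    by rewrite nvalM nvalC rnE.
  - move=> s' i iL FR ei; rewrite /lframe in FR; carryA FR.
    by rewrite /= ei h72 // coef_poly iL.
  - move=> s' i iL FR ei; have E' := mulenv_frame FR isT isT E.
    rewrite fvalG !nvalB rnE // nvalC [nval _ i90]ei subn1 /=; case: FR => _ hF _.
    by rewrite hF // hsrc ?coef_poly ?iL // ltnS leq_subr.
move=> s' _ h k kn; rewrite h; last by lia.
exact: corr_spec.
Qed.

Lemma tri_row_load src s (U : nat -> F) r : env s -> nreg s 28 r -> (r < n)%N ->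
  src \notin [:: 71%N; 99%N] -> farr s src (n * n) U ->
  tri n (row_load src) s (fun s' => farr s' 71 n (fun i => U (r * n + i)%N)).
Proof.
move=> E r28 rn hs hU0; apply: tri_conseq.
  apply: (@tri_map _ _ _ _ _ _ _ _ _ n 0 (fun i => U (r * n + i)%N)) => //.
  - exact: rnE.
  - exact: n_trip.
  - move=> s' i im FR ei; rewrite /sim in FR; split=> //.
    have hU := hU0; rewrite /farr in hU.
    have E' := mulenv_frame FR isT isT E; carry FR; case: FR => _ hF _.
    rewrite fvalG nvalD nvalM rnE // [nval _ i90]ei [nval _ _]r28 hF // hU //.
    by rewrite ltn_mulD.
by move=> s' _ [h _].
Qed.

Lemma hi43E s i (f : nat -> F) : env s -> nmem s 90 0 = i ->
  (forall k, (k < n)%N -> fmem s 43 (n' + k) = f k) -> (i < n)%N -> fval s hi43 = f i.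
Proof.
move=> E ei h il; rewrite fvalG nvalD nvalB rnE // nvalC [nval _ i90]ei subn1 /=.
exact: h.
Qed.

Lemma tri_rows s (p : {poly F}) (U : nat -> F) (rho : nat -> nat -> F) (y fa g : nat -> F) :
  env s -> p \is monic -> size p = n.+1 ->
  (forall r, (r < n)%N -> recur n' p (rho r)) ->
  (forall r k, (r < n)%N -> (k < n)%N -> U (r * n + k)%N = rho r k) ->
  farr s 100 (n * n) U -> farr s 19 n.+1 (fun i => p`_i) -> farr s 18 (2 * n) (iser n' p) ->
  farr s 16 n y -> farr s 11 n fa -> farr s 17 n g ->
  tri n rows_prog s (fun s' => forall r k, (r < n)%N -> (k < n)%N ->
    fmem s' 104 (r * n + k)%N = (\sum_(j < n) rho r (k + j)%N * y j) +
     \sum_(i < k) (\sum_(j < n) rho r (i + j)%N * fa j) * g (k.-1 - i)%N).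
Proof.
move=> E pm ps hrec hU h100 h19 h18 h16 h11 h17; have n0 := radix_n R.
pose out r k := (\sum_(j < n) rho r (k + j)%N * y j) +
     \sum_(i < k) (\sum_(j < n) rho r (i + j)%N * fa j) * g (k.-1 - i)%N.
pose I m s' := forall r k, (r < m)%N -> (k < n)%N -> fmem s' 104 (r * n + k)%N = out r k.
apply: (@tri_for _ _ _ _ _ _ _ _ _ n I) => //; [exact: rnE|exact: n_trip|].
move=> r s1 rn f1 r28 I1; carryA f1.
apply: tri_seq (tri_row_load E r28 rn _ h100) _ => // s2 f2 /= h71.
have {}h71 : farr s2 71 n (rho r) by move=> i im; rewrite h71 // hU.
have x2 : fmem s2 104 =1 fmem s1 104 by case: f2 => _ h _; apply: h.
carryA f2; apply: tri_seq (tri_ext E pm ps (hrec r rn) h71 h19 h18) _ => s3 f3 /= h72.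
have x3 : fmem s3 104 =1 fmem s1 104 by move=> i; case: f3 => _ h _; rewrite h.
carryA f3; apply: tri_seq (tri_corr (src := 16) E _ h72 h16) _ => // s4 f4 /= h43.
have x4 : fmem s4 104 =1 fmem s1 104 by move=> i; case: f4 => _ h _; rewrite h.
carryA f4.
apply: (@tri_seq _ _ _ _ _ (fun s' => farr s' 74 n (fun k => \sum_(j < n) rho r (k + j)%N * y j))).
  apply: tri_conseq.
    apply: (@tri_map _ _ _ _ _ _ _ _ _ n 0 (fun k => \sum_(j < n) rho r (k + j)%N * y j)) => //.
    - exact: rnE.
    - exact: n_trip.
    - move=> s' i im FR ei; rewrite /sim in FR; split=> //.
      have E' := mulenv_frame FR isT isT E; case: FR => _ hF _.
      by apply: (hi43E (f := fun k => \sum_(j < n) rho r (k + j)%N * y j)) => // k kn; rewrite hF // h43.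
  by move=> s' _ [h _].
move=> s5 f5 /= h74.
have x5 : fmem s5 104 =1 fmem s1 104 by move=> i; case: f5 => _ h _; rewrite h.
carryA f5; apply: tri_seq (tri_corr (src := 11) E _ h72 h11) _ => // s6 f6 /= {}h43.
have x6 : fmem s6 104 =1 fmem s1 104 by move=> i; case: f6 => _ h _; rewrite h.
carryA f6; pose Ak k := \sum_(j < n) rho r (k + j)%N * fa j.
apply: tri_seq.
  apply: (tri_mulp (L1 := n) (L2 := n) (p1 := \poly_(i < n) Ak i) (p2 := \poly_(i < n) g i) E) => //.
  - by lia.
  - by move=> s' FR; rewrite /lframe in FR; carryA FR; rewrite rnE.
  - move=> s' i iL FR ei; have E' := mulenv_frame FR isT isT E; case: FR => _ hF _.
    rewrite coef_poly iL; apply: (hi43E (f := Ak)) => // k kn; by rewrite hF // h43.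
  - move=> s' i iL FR ei; rewrite /lframe in FR; carryA FR.
    by rewrite /= ei h17 // coef_poly iL.
move=> s7 f7 /= {}h43.
have x7 : fmem s7 104 =1 fmem s1 104 by move=> i; case: f7 => _ h _; rewrite h.
carryA f7; apply: tri_conseq.
  apply: (@tri_msum _ _ _ _ _ _ _ _ _ _ _ _ _ n (r * n)%N (fun i => 1 - (1 - i))%N
      (fun k => \sum_(j < n) rho r (k + j)%N * y j)
      (fun k _ => ((\poly_(i < n) Ak i) * (\poly_(i < n) g i))`_k.-1)) => //.
  - exact: rnE.
  - exact: n_trip.
  - move=> s' i _ FR _; rewrite /sim in FR; carryA FR.
    by rewrite nvalM rnE // [nval _ _]r28.
  - move=> s' i im FR ei; rewrite /sim in FR; carryA FR; rewrite /= ei h74 //; split=> //.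
    by apply: leq_trans (leq_subr _ _) (trip_gt0 _ _ n0).
  - move=> s' i j im jM FR ei _; rewrite /sim in FR; carryA FR.
    by rewrite /= ei subn1 h43 //; lia.
move=> s8 _ [h8 h8'] s9 [_ hF _] r' k; rewrite ltnS leq_eqVlt => rr kn; rewrite hF //.
have [->|ne] := eqVneq r' r.
  rewrite h8 // sum_guard /out; congr (_ + _).
  (* At k = 0 the convolution is empty and the guard [1 - (1 - k)] suppresses it; otherwise it is
     coefficient k - 1 of the product. *)
  case: k kn => [|k] kn /=; first by rewrite big_ord0.
  rewrite cauchy_spec; last exact: ltnW.
  rewrite (reindex_inj rev_ord_inj) /=; apply: eq_bigr => i _.
  by have := ltn_ord i; rewrite ltnS => ik; rewrite subSS subKn.
have lt : (r' < r)%N by rewrite (negPf ne) in rr.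
rewrite h8' ?x7 ?I1 //; rewrite negb_and -ltnNge; apply/orP; left.
by apply: leq_trans (ltn_mulD lt kn) _.
Qed.

Lemma tri_inv s (p : {poly F}) (X : nat -> F) (rho : nat -> nat -> F) (q : nat -> F) :
  env s -> p \is monic -> size p = n.+1 ->
  (forall r, (r < n)%N -> recur n' p (rho r)) ->
  (forall r k, (r < n)%N -> (k < n)%N -> X (r * n + k)%N = rho r k) ->
  farr s 105 (n * n) X -> farr s 19 n.+1 (fun i => p`_i) -> farr s 18 (2 * n) (iser n' p) ->
  farr s 75 n q ->
  tri n inv_prog s (fun s' => forall r i, (r < n)%N -> (i < n)%N ->
    fmem s' 106 (r * n + i)%N = \sum_(k < n) p`_(i + k.+1) * (\sum_(j < n) rho r (k + j)%N * q j)).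
Proof.
move=> E pm ps hrec hX h105 h19 h18 h75; have n0 := radix_n R.
pose out r i := \sum_(k < n) p`_(i + k.+1) * (\sum_(j < n) rho r (k + j)%N * q j).
pose I m s' := forall r k, (r < m)%N -> (k < n)%N -> fmem s' 106 (r * n + k)%N = out r k.
apply: (@tri_for _ _ _ _ _ _ _ _ _ n I) => //; [exact: rnE|exact: n_trip|].
move=> r s1 rn f1 r28 I1; carryA f1.
apply: tri_seq (tri_row_load E r28 rn _ h105) _ => // s2 f2 /= h71.
have {}h71 : farr s2 71 n (rho r) by move=> i im; rewrite h71 // hX.
have x2 : fmem s2 106 =1 fmem s1 106 by case: f2 => _ h _; apply: h.
carryA f2; apply: tri_seq (tri_ext E pm ps (hrec r rn) h71 h19 h18) _ => s3 f3 /= h72.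
have x3 : fmem s3 106 =1 fmem s1 106 by move=> i; case: f3 => _ h _; rewrite h.
carryA f3; apply: tri_seq (tri_corr (src := 75) E _ h72 h75) _ => // s4 f4 /= h43.
have x4 : fmem s4 106 =1 fmem s1 106 by move=> i; case: f4 => _ h _; rewrite h.
carryA f4; pose Sk k := \sum_(j < n) rho r (k + j)%N * q j.
apply: tri_seq.
  apply: (tri_mulp (L1 := n) (L2 := n.+1) (p1 := \poly_(i < n) Sk i) (p2 := revp n' p) E) => //.
  - by lia.
  - by rewrite /revp /numer ?size_poly.
  - move=> s' FR; rewrite /lframe in FR; carryA FR.
    by rewrite nvalD nvalC rnE // addn1.
  - move=> s' i iL FR ei; have E' := mulenv_frame FR isT isT E; case: FR => _ hF _.
    rewrite coef_poly iL; apply: (hi43E (f := Sk)) => // k kn; by rewrite hF // h43.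
  - move=> s' i iL FR ei; rewrite /lframe in FR; carryA FR.
    rewrite fvalG nvalB rnE // [nval _ i90]ei h19 ?revp_coef ?iL //.
    by rewrite ltnS leq_subr.
move=> s7 f7 /= {}h43.
have x7 : fmem s7 106 =1 fmem s1 106 by move=> i; case: f7 => _ h _; rewrite h.
carryA f7; apply: tri_conseq.
  apply: (@tri_map _ _ _ _ _ _ _ _ _ n (r * n)%N (out r)) => //.
  - exact: rnE.
  - exact: n_trip.
  - move=> s' i im FR ei; rewrite /sim in FR; carryA FR; split.
      by rewrite nvalM rnE // [nval _ _]r28.
    rewrite fvalG !nvalB nvalC rnE // [nval _ i90]ei subn1 h43; last by lia.
    exact: (numer_low Sk im ps).
move=> s8 _ [h8 h8'] s9 [_ hF _] r' k; rewrite ltnS leq_eqVlt => rr kn; rewrite hF //.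
have [->|ne] := eqVneq r' r; first by rewrite h8.
have lt : (r' < r)%N by rewrite (negPf ne) in rr.
rewrite h8' ?x7 ?I1 //; rewrite negb_and -ltnNge; apply/orP; left.
by apply: leq_trans (ltn_mulD lt kn) _.
Qed.

End Prog1.

(* 1 below n and 0 from n to 2n - 1 *)
Definition below_n := #1 |-| i90 |/| rn.

(* Array 10: the characteristic polynomial p of the given matrix; 11: V a, also
   viewed as a polynomial; 12: U^T b; 13, 14: r1, r2; 15: rdet.  U, V, a, b are
   in arrays 100 to 103. *)
Definition sums_prog :=
  PSeq (msum 11 #0 (#2 |*| rn) 1 0 (rn |*| below_n) 1 0 FZero
     (FMul (FGet 101 (i90 |*| rn |+| i92)) (FGet 102 i92)))
  (PSeq (msum 12 #0 rn 1 0 rn 1 0 FZero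
     (FMul (FGet 100 (i92 |*| rn |+| i90)) (FGet 103 i92)))
  (PSeq (msum 13 #0 rn 1 0 rn 1 0 FZero
     (FMul (FGet 10 (i90 |+| #1 |+| i92)) (FGet 12 i92)))
  (PSeq (msum 14 #0 rn 1 0 rn 1 0 FZero
     (FMul (FGet 11 (i90 |+| #1 |+| i92)) (FGet 12 i92)))
  (PSeq (PFSet 14 #0 (FAdd (FGet 14 #0) FOne))
  (PSeq (msum 15 #0 (#2 |*| rn) 1 0 ((i90 |+| #1) |*| below_n) 1 0 FZero
     (FSub (FMul (FGet 10 i92) (FGet 14 (i90 |-| i92)))
           (FMul (FGet 11 i92) (FGet 13 (i90 |-| i92)))))
  (PFSet 15 rn FOne)))))).

Definition zero_vec a := msum a #0 rn 1 0 #0 0 0 FZero FZero.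
Definition e0_prog := PSeq (zero_vec 64) (PFSet 64 #0 FOne).

(** With alpha = 0 and both vectors equal to e_(n-1), [seq_prog] yields the last entries of the C^k
    e_(n-1), which is [iser]. *)
Definition iser_prog :=
  PSeq (zero_vec 62) (PSeq (zero_vec 60) (PSeq (PFSet 60 (rn |-| #1) FOne)
  (PSeq (cp 70 60 rn 1 0) (PSeq seq_prog (cp 18 69 (#2 |*| rn) 1 0))))).

Definition pad dst := msum dst #0 (rn |+| #1) 1 0 below_n 0 0 FZero (FGet 60 i90).

(* The loop computes d^(2^(2K)) modulo rdet by repeated squaring, and 2^(2K)
   is at least n. *)
Definition cyclic_prog :=
  let m := rn |+| #1 in
  PSeq (cp 50 10 m 1 0) (PSeq (cp 51 11 m 1 0) (PSeq egcd_prog (PSeq (cp 68 50 m 1 0)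
  (PSeq (cp 61 15 rn 1 0) (PSeq (zero_vec 62) (PSeq e0_prog (PSeq horner_prog
  (PSeq (PFor 26 (#2 |*| nvar 3) 0 1
     (PSeq (cp 64 60 rn 1 0) (PSeq (pad 68) horner_prog)))
  (PSeq (cp 50 15 m 1 0) (PSeq (pad 51) (PSeq egcd_prog (PSeq (cp 68 53 m 1 0)
  (PSeq (cp 61 10 rn 1 0) (PSeq (cp 62 11 rn 1 0) (PSeq (cp 63 12 rn 1 0)
  (PSeq e0_prog (PSeq horner_prog
    (msum 16 #0 rn 1 0 #0 0 0 (FAdd (FGet 11 i90) (FGet 60 i90)) FZero)))))))))))))))))).

Definition row_prog :=
  PSeq (cp 60 16 rn 1 0) (PSeq (cp 70 12 rn 1 0) (PSeq seq_prog (PSeq (cp 17 69 rn 1 0)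
  (PSeq iser_prog (PSeq (cp 19 10 (rn |+| #1) 1 0) rows_prog))))).

Definition half_prog := PSeq sums_prog (PSeq cyclic_prog row_prog).

(** * Correctness of the update for one of the two matrices *)

Section Prog2.
Local Open Scope ring_scope.
Variables (F : fieldType) (n' : nat).
Local Notation n := n'.+1.
Implicit Types s : state F.

Lemma below_nE s i : nreg s 0 n -> nmem s 90 0 = i -> (i < 2 * n)%N -> nval s below_n = (i < n)%N.
Proof.
move=> r0 ei i2; rewrite nvalB nvalQ nvalC [nval _ i90]ei [nval _ rn]r0.
have [h|h] := ltnP i n; first by rewrite divn_small.
have : (0 < i %/ n)%N by rewrite divn_gt0.
by case: (i %/ n)%N.
Qed.

Lemma tri_sums s (p : {poly F}) (U V a b : nat -> F) :
  let fa i := \sum_(j < n) V (i * n + j)%N * a j in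
  let fb i := \sum_(j < n) U (j * n + i)%N * b j in
  nreg s 0 n -> p \is monic -> size p = n.+1 ->
  farr s 100 (n * n) U -> farr s 101 (n * n) V -> farr s 102 n a -> farr s 103 n b ->
  farr s 10 (2 * n) (fun i => p`_i) ->
  tri n sums_prog s (fun s' => [/\ farr s' 11 (2 * n) (fun i => (\poly_(i < n) fa i)`_i),
     farr s' 12 n fb & farr s' 15 (2 * n) (fun i => (rdet n' p fa fb)`_i)]).
Proof.
move=> fa fb r0 pm ps hU hV ha hb hp; have t1 := n_trip n'.
apply: (@tri_seq _ _ _ _ _ (fun s' => farr s' 11 (2 * n) (fun i => (\poly_(i < n) fa i)`_i))).
  apply: tri_conseq.
    apply: (@tri_sum _ _ _ _ _ _ _ _ _ _ _ (2 * n)%N (fun i => n * (i < n))%N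
      (fun i j => V (i * n + j)%N * a j)) => //.
    - by rewrite nvalM [nval _ rn]r0.
    - exact: lin_trip.
    - move=> s' i i2 FR ei; rewrite /sim in FR; carry FR.
      rewrite nvalM (below_nE r0 ei i2) [nval _ rn]r0; split=> //.
      by case: (i < n)%N; rewrite ?muln1 ?muln0.
    - move=> s' i j i2; have [h|h] := ltnP i n; rewrite ?muln0 // muln1 => jn FR ei ej.
      rewrite /sim in FR; carry FR; rewrite /= ei ej r0 hV ?ha //.
      by rewrite ltn_mulD.
  move=> s' _ h i i2; rewrite h // coef_poly; case: ltnP => _; first by rewrite muln1.
  by rewrite muln0 big_ord0.
move=> s1 f1 /= h11; carry f1.
apply: (@tri_seq _ _ _ _ _ (fun s' => farr s' 12 n fb)).
  apply: (@tri_sum _ _ _ _ _ _ _ _ _ _ _ n (fun i => n)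
      (fun i j => U (j * n + i)%N * b j)) => //.
  - by move=> s' i _ FR _; rewrite /sim in FR; carry FR.
  - move=> s' i j im jn FR ei ej; rewrite /sim in FR; carry FR.
    by rewrite /= ei ej r0 hU ?hb // ltn_mulD.
move=> s2 f2 /= h12; carry f2.
apply: (@tri_seq _ _ _ _ _ (fun s' => farr s' 13 n (fun i => (r1 n' p fb)`_i))).
  apply: tri_conseq.
    apply: (@tri_sum _ _ _ _ _ _ _ _ _ _ _ n (fun i => n)
      (fun i j => p`_(i.+1 + j) * fb j)) => //.
    - by move=> s' i _ FR _; rewrite /sim in FR; carry FR.
    - move=> s' i j im jn FR ei ej; rewrite /sim in FR; carry FR.
      by rewrite /= ei ej addn1 hp ?h12 //; lia.
  by move=> s' _ h i im; rewrite h // (coef_r1 _ pm ps).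
move=> s3 f3 /= h13; carry f3.
apply: (@tri_seq _ _ _ _ _ (fun s' => farr s' 14 n (fun i => (r2 n' fa fb)`_i - (i == 0%N)%:R))).
  apply: tri_conseq.
    apply: (@tri_sum _ _ _ _ _ _ _ _ _ _ _ n (fun i => n)
      (fun i j => (\poly_(i < n) fa i)`_(i.+1 + j) * fb j)) => //.
    - by move=> s' i _ FR _; rewrite /sim in FR; carry FR.
    - move=> s' i j im jn FR ei ej; rewrite /sim in FR; carry FR.
      by rewrite /= ei ej addn1 h11 ?h12 //; lia.
  by move=> s' _ h i im; rewrite h // (coef_r2 _ _ pm ps) addrAC subrr add0r.
move=> s4 f4 /= h14; carry f4.
apply: (@tri_seq _ _ _ _ _ (fun s' => farr s' 14 n (fun i => (r2 n' fa fb)`_i))).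
  apply: tri_fset => i im /=; rewrite /upd eqxx /= !h14 //.
  by case: eqP => [->|/eqP/negPf ne]; rewrite ?eqxx ?subrK ?subr0.
move=> s5 f5 /= {}h14; rewrite /= in f5; carry f5.
apply: (@tri_seq _ _ _ _ _ (fun s' => farr s' 15 (2 * n) (fun i => if (i < n)%N then (rdet n' p fa fb)`_i else 0))).
  apply: tri_conseq.
    apply: (@tri_sum _ _ _ _ _ _ _ _ _ _ _ (2 * n)%N (fun i => i.+1 * (i < n))%N
      (fun i j => p`_j * (r2 n' fa fb)`_(i - j) - (\poly_(i < n) fa i)`_j * (r1 n' p fb)`_(i - j))) => //.
    - by rewrite nvalM [nval _ rn]r0.
    - exact: lin_trip.
    - move=> s' i i2 FR ei; rewrite /sim in FR; carry FR.
      rewrite nvalM nvalD (below_nE r0 ei i2) [nval _ i90]ei addn1; split=> //.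
      case: ltnP => h; rewrite ?muln0 // muln1; exact: leq_trans t1.
    - move=> s' i j i2; have [h|h] := ltnP i n; rewrite ?muln0 // muln1 ltnS => jn FR ei ej.
      rewrite /sim in FR; carry FR; rewrite /= ei ej hp ?h11 ?h14 ?h13 //; try lia.
  move=> s' _ h i i2; rewrite h //; case: ltnP => im; last by rewrite muln0 big_ord0.
  by rewrite muln1 sumrB /rdet coefB !coefM.
move=> s6 f6 /= h15; carry f6.
have [rm' rs'] := rdet_monic fa fb pm ps.
(* The sums gave only the coefficients below n; coefficient n is 1 because [rdet] is monic of degree
   n. *)
apply: tri_fset; split.
- by move=> i im; rewrite /= /upd /= h11.
- by move=> i im; rewrite /= /upd /= h12.
- move=> i im; rewrite /= /upd /= [nmem _ _ _]r0; case: eqP => [->|ne].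
    by rewrite (monic_coef_size rm' rs').
  rewrite h15 //; case: ltnP => // h; rewrite nth_default // rs'; lia.
Qed.

Lemma tri_zero_vec s a : nreg s 0 n -> (a != 99)%N ->
  tri n (zero_vec a) s (fun s' => farr s' a n (fun=> 0)).
Proof.
move=> r0 a99; apply: tri_conseq.
  apply: (@tri_map _ _ _ _ _ _ _ _ _ n 0 (fun=> 0)) => //; exact: n_trip.
by move=> s' _ [h _].
Qed.

Lemma tri_e0 s : nreg s 0 n ->
  tri n e0_prog s (fun s' => farr s' 64 n (fun i => (i == 0%N)%:R)).
Proof.
move=> r0; apply: tri_seq (tri_zero_vec r0 _) _ => // s1 f1 h.
by apply: tri_fset => i im /=; rewrite /upd /=; case: eqP => // _; rewrite h.
Qed.

Lemma tri_iser s (p : {poly F}) : nreg s 0 n -> farr s 61 n (fun i => p`_i) ->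
  tri n iser_prog s (fun s' => farr s' 18 (2 * n) (iser n' p)).
Proof.
move=> r0 h61; have t1 := n_trip n'.
apply: tri_seq (tri_zero_vec r0 _) _ => // s1 f1 h62; rewrite /= in f1; carry f1.
apply: tri_seq (tri_zero_vec r0 _) _ => // s2 f2 h60; rewrite /= in f2; carry f2.
apply: (@tri_seq _ _ _ _ _ (fun s' => farr s' 60 n (fun i => (i == n')%:R))).
  apply: tri_fset => i im /=; rewrite /upd /= r0 subn1 /=; case: eqP => // _; exact: h60.
move=> s3 f3 {}h60; rewrite /= in f3; carry f3.
apply: tri_seq (tri_cp _ _ _ _ _ h60) _ => // s4 f4 h70; rewrite /= in f4; carry f4.
have G : genv n' p (fun=> 0) (fmem s4 63) s4 by [].
apply: tri_seq (tri_seqp G h60 h70) _ => s5 f5 /= h69; carry f5.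
apply: tri_conseq; first by apply: (tri_cp _ _ _ _ _ h69) => //; [rewrite nvalM [nval _ rn]r0|exact: lin_trip].
move=> s6 _ h i i2; rewrite h // /iser.
have -> : cv n' (fun=> 0 : F) = 0 by apply/colP => j; rewrite !mxE.
rewrite mul0mx addr0 mxE (bigD1 ord_max) //= big1 ?addr0 => [|j jn].
  by rewrite !mxE eqxx mul1r.
by rewrite !mxE (_ : (j == n' :> nat) = false) ?mul0r //; apply/negbTE.
Qed.

Lemma tri_pad s dst (f : {poly F}) : nreg s 0 n -> (dst != 99)%N -> (dst != 60)%N ->
  (size f <= n)%N -> farr s 60 n (fun i => f`_i) -> tri n (pad dst) s (fun s' => parr n s' dst f).
Proof.
move=> r0 d99 d60 sf h60; apply: tri_conseq.
  apply: (@tri_sum _ _ _ _ _ _ _ _ _ _ _ n.+1 (fun i => (i < n)%N : nat) (fun i _ => f`_i)) => //.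
  - by rewrite nvalD [nval _ rn]r0 addn1.
  - exact: m_trip.
  - move=> s' i im FR ei; rewrite /sim in FR; have {}r0 := nreg_frame (a := 0%N) FR isT r0; split.
      by apply: below_nE => //; lia.
    by apply: leq_trans (one_trip n'); case: (i < n)%N.
  - move=> s' i j im; have [h|h] := ltnP i n => // _ [_ hF _] ei ej.
    by rewrite /= ei hF ?h60 // !inE eq_sym negb_or d60.
move=> s' _ h i im; rewrite h //; case: ltnP => hi; first by rewrite big_ord1.
by rewrite big_ord0 nth_default // (leq_trans sf).
Qed.

Lemma eq_farr s a m (f g : nat -> F) : (forall i, (i < m)%N -> f i = g i) -> farr s a m f -> farr s a m g.
Proof. by move=> fg h i im; rewrite h // fg. Qed.

Lemma sub_farr s a m k (f : nat -> F) : (k <= m)%N -> farr s a m f -> farr s a k f.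
Proof. by move=> km h i ik; apply: h; apply: leq_trans km. Qed.

Lemma cv_zero : cv n' (fun=> 0 : F) = 0.
Proof. by apply/colP => i; rewrite !mxE. Qed.

Lemma tri_cyclic l K Lam s (p : {poly F}) (fa fb : nat -> F) : radix F n l K Lam ->
  let M := companion n' p + cv n' fa *m (cv n' fb)^T in
  let x := rdet n' p fa fb in
  (forall h, horner_mx M h = 0 -> x %| h) ->
  mulenv n l K Lam s -> p \is monic -> size p = n.+1 ->
  farr s 10 (2 * n) (fun i => p`_i) -> farr s 11 (2 * n) (fun i => (\poly_(i < n) fa i)`_i) ->
  farr s 12 n fb -> farr s 15 (2 * n) (fun i => x`_i) ->
  tri n cyclic_prog s (fun s' => exists2 y : nat -> F, farr s' 16 n y /\ genv n' p fa fb s' & krylov M (cv n' y) \in unitmx).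
Proof.
move=> R M x gen E pm ps h10 h11 h12 h15; have t1 := n_trip n'; set pa := \poly_(i < n) fa i in h11.
have [xm xs] : x \is monic /\ size x = n.+1 := rdet_monic fa fb pm ps.
have n2 : (n.+1 <= 2 * n)%N by lia.
have r0 : nreg s 0 n by case: E => -[].
have spa : (size pa <= n)%N by apply: size_poly.
apply: tri_seq (tri_cpm (f := p) (ltn0Sn n') r0 _ _ _ (sub_farr n2 h10)) _ => // s1 f1 h50; rewrite /parr /= in f1 h50; carryA f1.
apply: tri_seq (tri_cpm (f := pa) (ltn0Sn n') r0 _ _ _ (sub_farr n2 h11)) _ => // s2 f2 h51; rewrite /parr /= in f2 h51; carryA f2.
apply: tri_seq (tri_egcd (ltn0Sn n') r0 ps spa h50 h51) _ => // s3 f3 [d [_ [tg [[dE _ _ _] _ {}h50 _ _]]]].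
rewrite /parr /= in h50; carryA f3.
apply: tri_seq (tri_cpm (f := d) (ltn0Sn n') r0 _ _ _ h50) _ => // s4 f4 h68; rewrite /parr /= in f4 h68; carryA f4.
have sd : (size d <= n.+1)%N.
  rewrite (eqp_size dE) -ps leq_gcdpl //.
  by rewrite -size_poly_gt0 ps.
apply: (@tri_seq _ _ _ _ _ (fun s' => farr s' 61 n (fun i => x`_i))).
  by apply: tri_cp => //; apply: sub_farr h15; rewrite leq_pmull.
move=> s5 f5 h61; rewrite /= in f5; carryA f5.
apply: tri_seq (tri_zero_vec r0 _) _ => // s6 f6 h62; rewrite /= in f6; carryA f6.
apply: tri_seq (tri_e0 r0) _ => // s7 f7 h64; carryA f7.
have G : genv n' x (fun=> 0) (fmem s7 63) s7 by [].
apply: tri_seq (tri_horner G h64 sd h68) _ => s8 f8 [v0 h60 ev0].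
have C0 g : companion n' x + cv n' (fun=> 0) *m (cv n' g)^T = companion n' x.
  by rewrite cv_zero mul0mx addr0.
rewrite C0 (horner_companion xm xs) in ev0.
have {}h60 := eq_farr (cv_inj ev0) h60; clear v0 ev0.
clear h64 h68 h50 G; carryA f8.
(* Array 60 holds a residue modulo x as a vector. By [horner_companion], applying it as a polynomial
   in the companion matrix of x to itself squares it. *)
pose I k s' := farr s' 60 n (fun i => (d ^+ (2 ^ k) %% x)`_i).
have sx (f : {poly F}) : (size (f %% x)%R <= n)%N.
  by rewrite -ltnS -xs ltn_modp monic_neq0.
apply: (@tri_seq _ _ _ _ _ (I (2 * K)%N)).
  apply: (@tri_for _ _ _ _ _ _ _ _ _ (2 * K)%N I) => //.
  - by rewrite nvalM [nval _ (nvar 3)](_ : _ = K) //; case: E => -[].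
  - exact: radix_K2t R.
  - by move=> s0 f0; rewrite /I expn0 expr1; carry f0.
  - move=> k s9 kK f9 _ {}h60; carryA f9.
    rewrite /I in h60.
    apply: tri_seq (tri_cp _ _ _ _ _ h60) _ => // s10 f10 h64; rewrite /= in f10; carryA f10.
    apply: tri_seq (tri_pad (dst := 68) r0 _ _ (sx _) h60) _ => // s11 f11 h68.
    rewrite /parr /= in h68 f11; carryA f11.
    have G : genv n' x (fun=> 0) (fmem s11 63) s11 by [].
    apply: tri_conseq (tri_horner G h64 (leqW (sx _)) h68) _ => s12 f12 [v hv ev] s13 f13 i im.
    case: f13 => _ -> // _; rewrite hv //; apply: (cv_inj (n' := n') _ im); rewrite ev C0.
    rewrite -(horner_companion xm xs) -horner_mxM (horner_companion xm xs).
    by apply: cv_eq => j _; rewrite mulrC modp_mul -exprD addnn -mul2n -expnS.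
move=> s9 f9 {}h60; rewrite /I in h60; carryA f9; clear I.
apply: tri_seq (tri_cpm (f := x) (ltn0Sn n') r0 _ _ _ (sub_farr n2 h15)) _ => // s10 f10 h50; rewrite /parr /= in f10 h50; carryA f10.
apply: tri_seq (tri_pad (dst := 51) r0 _ _ (sx _) h60) _ => // s11 f11 h51; rewrite /parr /= in f11 h51; carryA f11.
(* Here the cofactor in array 53 is wanted rather than the gcd g: it is x / g up to a unit. *)
apply: tri_seq (tri_egcd (ltn0Sn n') r0 xs (sx _) h50 h51) _ => // s12 f12 [g [_ [sg [[gE gs _ _] ssg _ _ h53]]]].
rewrite /parr /= in h53; carryA f12.
apply: tri_seq (tri_cpm (f := sg) (ltn0Sn n') r0 _ _ _ h53) _ => // s13 f13 h68; rewrite /parr /= in f13 h68; carryA f13.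
apply: (@tri_seq _ _ _ _ _ (fun s' => farr s' 61 n (fun i => p`_i))).
  by apply: tri_cp => //; apply: sub_farr h10; rewrite leq_pmull.
move=> s14 f14 {}h61; rewrite /= in f14; carryA f14.
have h11' : farr s14 11 n fa.
  by move=> i im; rewrite h11 ?coef_poly ?im //; lia.
apply: (@tri_seq _ _ _ _ _ (fun s' => farr s' 62 n fa)).
  by apply: tri_cp.
move=> s15 f15 {}h62; rewrite /= in f15; carryA f15.
apply: tri_seq (tri_cp _ _ _ _ _ h12) _ => // s16 f16 h63; rewrite /= in f16; carryA f16.
apply: tri_seq (tri_e0 r0) _ => // s17 f17 h64; carryA f17.
have G : genv n' p fa fb s17 by [].
apply: tri_seq (tri_horner G h64 ssg h68) _ => s18 f18 [v hv ev]; carryA f18.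
apply: tri_conseq.
  apply: (@tri_map _ _ _ _ _ _ _ _ _ n 0 (fun i => fa i + v i)) => //.
  move=> s' i im FR ei; rewrite /sim in FR; carryA FR.
  by rewrite /= ei h11' // hv.
move=> s19 f19 [h16 _]; exists (fun i => fa i + v i); first by rewrite /= in f19; carryA f19.
have -> : cv n' (fun i => fa i + v i) = cv n' fa + horner_mx M sg *m unitv F n' 0.
  by rewrite -[horner_mx M sg *m _]ev; apply/colP => i; rewrite !mxE.
apply: (krylov_cyclic pm ps gen (G := g) (d := d) (N := (2 ^ (2 * K))%N)) => //.
- by rewrite mulrC.
- exact: radix_K2 R.
Qed.

Lemma array_mxE m k (X : 'M[F]_(m.+1, k.+1)) i j : (i < m.+1)%N -> (j < k.+1)%N ->
  array_of_mx X (i * k.+1 + j) = X (inord i) (inord j).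
Proof.
move=> im jk; rewrite /array_of_mx divnMDl // divn_small // addn0 modnMDl modn_small //.
by rewrite !insubT; congr (X _ _); apply: val_inj; rewrite /= inordK.
Qed.

Lemma array_colE (a : 'cV[F]_n) i : (i < n)%N -> array_of_mx a i = a (inord i) 0.
Proof.
move=> im; rewrite -[i in LHS]addn0 -[i in LHS]muln1 array_mxE //; congr (a _ _).
by apply: val_inj; rewrite /= inordK.
Qed.

Lemma farr_mx s k (X : 'M[F]_n) :
  (forall i j : 'I_n, fmem s k (i * n + j)%N = X i j) -> farr s k (n * n) (array_of_mx X).
Proof.
move=> h v vn; have i1 : (v %/ n < n)%N by rewrite ltn_divLR.
have i2 : (v %% n < n)%N by rewrite ltn_mod.
rewrite {1}(divn_eq v n) (h (Ordinal i1) (Ordinal i2)) [in RHS](divn_eq v n) array_mxE //.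
by congr (X _ _); apply: val_inj; rewrite /= inordK.
Qed.

Lemma mulmx_fun (X : 'M[F]_n) (a : 'cV[F]_n) :
  X *m a = cv n' (fun i => \sum_(j < n) array_of_mx X (i * n + j)%N * array_of_mx a j).
Proof.
apply/colP => i; rewrite !mxE; apply: eq_bigr => j _.
by rewrite array_mxE // array_colE // !inord_val.
Qed.

Lemma tri_half l K Lam s (p : {poly F}) (U V : 'M[F]_n) (a b : 'cV[F]_n) : radix F n l K Lam ->
  let A := U *m companion n' p *m V + a *m b^T in
  (forall h, horner_mx A h = 0 -> char_poly A %| h) -> V *m U = 1%:M ->
  mulenv n l K Lam s -> p \is monic -> size p = n.+1 ->
  farr s 100 (n * n) (array_of_mx U) -> farr s 101 (n * n) (array_of_mx V) ->
  farr s 102 n (array_of_mx a) -> farr s 103 n (array_of_mx b) -> farr s 10 (2 * n) (fun i => p`_i) ->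
  tri n half_prog s (fun s' => exists w : 'cV[F]_n,
    [/\ krylov A w \in unitmx, farr s' 104 (n * n) (array_of_mx (krylov A w)) &
        farr s' 15 (2 * n) (fun i => (char_poly A)`_i)]).
Proof.
move=> R A gen VU E pm ps h100 h101 h102 h103 h10.
have r0 : nreg s 0 n by case: E => -[].
have UV : U *m V = 1%:M by apply: mulmx1C.
set fa := fun i : nat => \sum_(j < n) array_of_mx V (i * n + j)%N * array_of_mx a j.
set fb := fun i : nat => \sum_(j < n) array_of_mx U (j * n + i)%N * array_of_mx b j.
have faE : cv n' fa = V *m a by rewrite mulmx_fun.
have fbE : cv n' fb = U^T *m b.
  apply/colP => i; rewrite !mxE; apply: eq_bigr => j _.
  by rewrite mxE array_mxE // array_colE // !inord_val.
set M := companion n' p + cv n' fa *m (cv n' fb)^T.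
have AM : A = U *m M *m V.
  rewrite /M faE fbE trmx_mul trmxK mulmxDr mulmxDl; congr (_ + _).
  by rewrite !mulmxA UV mul1mx -!mulmxA UV mulmx1.
have [xm xs] := rdet_monic fa fb pm ps.
(* Minimality: the characteristic polynomial divides every annihilator of [A], in particular [rdet];
   both are monic of degree n. *)
have xE : rdet n' p fa fb = char_poly A.
  apply/eqP; rewrite -eqp_monic ?char_poly_monic // eqp_sym -dvdp_size_eqp ?size_char_poly ?xs //.
  by apply: gen; rewrite (horner_mx_sim _ VU AM) rdet_root // mulmx0 mul0mx.
have genM h : horner_mx M h = 0 -> rdet n' p fa fb %| h.
  by move=> hM; rewrite xE; apply: gen; rewrite (horner_mx_sim _ VU AM) hM mulmx0 mul0mx.
apply: tri_seq (tri_sums r0 pm ps h100 h101 h102 h103 h10) _ => s1 f1 [h11 h12 h15].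
rewrite -/fa -/fb in h11 h12 h15; carryA f1.
apply: tri_seq (tri_cyclic R genM E pm ps h10 h11 h12 h15) _ => s2 f2 [y [h16 [_ h61 h62 h63]] yc].
carryA f2; have t1 := n_trip n'.
apply: tri_seq (tri_cp _ _ _ _ _ h16) _ => // s3 f3 h60; rewrite /= in f3; carryA f3.
apply: tri_seq (tri_cp _ _ _ _ _ h12) _ => // s4 f4 h70; rewrite /= in f4; carryA f4.
have G : genv n' p fa fb s4 by [].
apply: tri_seq (tri_seqp G h60 h70) _ => s5 f5 h69; rewrite /= in h69; clear G; carryA f5.
set g := fun k => _ in h69.
have {}h69 : farr s5 69 n g by apply: sub_farr h69; rewrite leq_pmull.
apply: tri_seq (tri_cp _ _ _ _ _ h69) _ => // s6 f6 h17; rewrite /= in f6; carryA f6.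
apply: tri_seq (tri_iser r0 h61) _ => s7 f7 h18; rewrite /= in h18; carryA f7.
have n2 : (n.+1 <= 2 * n)%N by lia.
apply: tri_seq (tri_cpm (f := p) (ltn0Sn n') r0 _ _ _ (sub_farr n2 h10)) _ => // s8 f8 h19.
rewrite /parr /= in f8 h19; carryA f8.
have h11' : farr s8 11 n fa.
  by move=> i im; rewrite h11 ?coef_poly ?im //; lia.
apply: tri_conseq.
  apply: (tri_rows R (rho := fun r k => rho p U (inord r) k) E pm ps _ _ h100 h19 h18 h16 h11' h17).
  - by move=> r _; apply: rho_recur.
  - by move=> r k rn kn; rewrite array_mxE // rho_small.
move=> s9 f9 h104; exists (U *m cv n' y).
have kE := krylov_sim (cv n' y) VU AM.
split.
- rewrite kE unitmx_mul yc andbT.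
  by case/mulmx1_unit: UV.
- rewrite kE; apply: farr_mx => i j; rewrite h104 // row_out inord_val; congr (_ + _).
    by apply: eq_bigr => k _; rewrite mxE inordK.
  apply: eq_bigr => k _; congr (_ * _).
  by apply: eq_bigr => q _; rewrite mxE inordK.
- by rewrite -xE; apply: (farr_frame (a := 15) f9 isT h15).
Qed.

End Prog2.

(** * Assembly of the two normal forms *)

Definition charpoly_prog :=
  PSeq (msum 10 #0 (#2 |*| rn) 1 0 below_n 0 0 FZero
    (FSub FZero (FGet 1 (i90 |*| rn |+| (rn |-| #1)))))
  (PFSet 10 rn FOne).

Definition nn := rn |*| rn.

(* The inverse, modulo the polynomial of array 15, of the Hankel numerator of
   the sequence z^T A^k w, from the Krylov matrices 107 of w and 108 of z. *)
Definition quot_prog :=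
  PSeq (msum 76 #0 rn 1 0 rn 1 0 FZero
    (FMul (FGet 107 (i92 |*| rn)) (FGet 108 (i92 |*| rn |+| i90))))
  (PSeq (cp 50 15 (rn |+| #1) 1 0)
  (PSeq (msum 51 #0 (rn |+| #1) 1 0 (rn |*| below_n) 1 0 FZero
     (FMul (FGet 15 (i90 |+| #1 |+| i92)) (FGet 76 i92)))
  (PSeq egcd_prog
    (msum 75 #0 rn 1 0 #0 0 0 (FDiv (FGet 52 i90) (FGet 50 #0)) FZero)))).

Definition tr_prog dst src :=
  msum dst #0 nn 2 0 #0 0 0 (FGet src ((i90 |%| rn) |*| rn |+| i90 |/| rn)) FZero.

(** With truncated subtraction, 1 - ((a - b) + (b - a)) is the test a = b; it produces the
    subdiagonal, and the guard of the second loop selects the last column. *)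
Definition companion_prog :=
  PSeq (msum 77 #0 nn 2 0
     (#1 |-| ((i90 |/| rn |-| (i90 |%| rn |+| #1)) |+| (i90 |%| rn |+| #1 |-| i90 |/| rn)))
     0 0 FZero FOne)
  (msum 1 #0 nn 2 0 (#1 |-| (rn |-| #1 |-| i90 |%| rn)) 0 0
     (FGet 77 i90) (FSub FZero (FGet 15 (i90 |/| rn)))).

Definition input_prog a b c d :=
  PSeq (cp 100 a nn 2 0) (PSeq (cp 101 b nn 2 0) (PSeq (cp 102 c rn 1 0) (cp 103 d rn 1 0))).

(** The inputs are overwritten only after both halves have run. One quotient q serves both
    inversions, since the Hankel sequence is the same from either side ([hnum_tr]). *)
Definition main_prog :=
  PSeq setup_prog (PSeq charpoly_prog
  (PSeq (input_prog 0 2 6 7) (PSeq half_prog (PSeq (cp 107 104 nn 2 0)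
  (PSeq (input_prog 3 5 7 6) (PSeq half_prog (PSeq (cp 108 104 nn 2 0)
  (PSeq quot_prog
  (PSeq (cp 61 15 rn 1 0) (PSeq iser_prog (PSeq (cp 19 15 (rn |+| #1) 1 0)
  (PSeq (cp 105 108 nn 2 0) (PSeq inv_prog (PSeq (cp 109 106 nn 2 0)
  (PSeq (cp 105 107 nn 2 0) (PSeq inv_prog
  (PSeq (cp 0 107 nn 2 0) (PSeq (cp 3 108 nn 2 0)
  (PSeq (tr_prog 2 109) (PSeq (tr_prog 5 106)
  (PSeq companion_prog (cp 4 1 nn 2 0)))))))))))))))))))))).

Section Prog3.
Local Open Scope ring_scope.
Variables (F : fieldType) (n' : nat).
Local Notation n := n'.+1.
Implicit Types (s : state F) (A : 'M[F]_n) (p : {poly F}).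

Lemma char_poly_tr A : char_poly A^T = char_poly A.
Proof.
rewrite /char_poly -det_tr; congr (\det _); apply/matrixP => i j.
by rewrite !mxE eq_sym.
Qed.

Lemma nn_trip : (n * n <= trip n 2 0)%N.
Proof. by rewrite /trip expn0 muln1 mulnn leq_pmull // /tripc -lock expn_gt0. Qed.

Lemma nnE s : nreg s 0 n -> nval s nn = (n * n)%N.
Proof. by move=> r0; rewrite nvalM [nval _ rn]r0. Qed.

Lemma tri_charpoly s p : nreg s 0 n -> p \is monic -> size p = n.+1 ->
  farr s 1 (n * n) (array_of_mx (companion n' p)) ->
  tri n charpoly_prog s (fun s' => farr s' 10 (2 * n) (fun i => p`_i)).
Proof.
move=> r0 pm ps h1.
apply: (@tri_seq _ _ _ _ _ (fun s' => farr s' 10 (2 * n) (fun i => if (i < n)%N then p`_i else 0))).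
  apply: tri_conseq.
    apply: (@tri_sum _ _ _ _ _ _ _ _ _ _ _ (2 * n)%N (fun i => (i < n)%N : nat) (fun i _ => p`_i)) => //.
    - by rewrite nvalM [nval _ rn]r0.
    - exact: lin_trip.
    - move=> s' i i2 FR ei; rewrite /sim in FR; carry FR; split; first exact: below_nE.
      by apply: leq_trans (one_trip n'); case: (i < n)%N.
    - move=> s' i j i2; have [im|//] := ltnP i n => _ FR ei _; rewrite /sim in FR; carry FR.
      rewrite /= ei r0 subn1 /= h1; last by rewrite ltn_mulD.
      by rewrite array_mxE // mxE !inordK // eqxx sub0r opprK.
  move=> s' _ h i i2; rewrite h //; case: ltnP => hi; first by rewrite big_ord1.
  by rewrite big_ord0.
move=> s1 f1 /= h10; carry f1; apply: tri_fset => i i2 /=; rewrite /upd /= r0.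
case: eqP => [->|ne]; first by rewrite (monic_coef_size pm ps).
rewrite h10 //; case: ltnP => // hi; rewrite nth_default // ps; lia.
Qed.

Lemma farr_cp dst src len ca cb s s' k m (f : nat -> F) :
  frame (wN (cp dst src len ca cb)) (wF (cp dst src len ca cb)) s s' ->
  (k < 50)%N -> (99 < dst)%N -> farr s k m f -> farr s' k m f.
Proof. by move=> fr k50 d99; apply: (farr_frame fr); rewrite /= !inE; lia. Qed.

Lemma tri_input a b c d s (U V : 'M[F]_n) (x y : 'cV[F]_n) : nreg s 0 n ->
  all (fun k => k < 50)%N [:: a; b; c; d] ->
  farr s a (n * n) (array_of_mx U) -> farr s b (n * n) (array_of_mx V) ->
  farr s c n (array_of_mx x) -> farr s d n (array_of_mx y) ->
  tri n (input_prog a b c d) s (fun s' =>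
    [/\ farr s' 100 (n * n) (array_of_mx U), farr s' 101 (n * n) (array_of_mx V),
        farr s' 102 n (array_of_mx x) & farr s' 103 n (array_of_mx y)]).
Proof.
move=> r0 /and5P[a50 b50 c50 d50 _] ha hb hc hd; have t1 := n_trip n'; have t2 := nn_trip.
apply: tri_seq (tri_cp _ _ _ (nnE r0) t2 ha) _ => //; try lia.
move=> s1 f1 h100; have {}hb := farr_cp f1 b50 isT hb; have {}hc := farr_cp f1 c50 isT hc.
have {}hd := farr_cp f1 d50 isT hd; rewrite /= in f1; carry f1.
apply: tri_seq (tri_cp _ _ _ (nnE r0) t2 hb) _ => //; try lia.
move=> s2 f2 h101; have {}hc := farr_cp f2 c50 isT hc.
have {}hd := farr_cp f2 d50 isT hd; rewrite /= in f2; carry f2.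
apply: tri_seq (tri_cp _ _ _ _ t1 hc) _ => //; try lia.
move=> s3 f3 h102; have {}hd := farr_cp f3 d50 isT hd; rewrite /= in f3; carry f3.
apply: tri_conseq (tri_cp _ _ _ _ t1 hd) _ => //; try lia.
by move=> s4 f4 h103; rewrite /= in f4; carry f4.
Qed.

(** By Cayley-Hamilton the Krylov matrix intertwines [A] with the companion matrix, so a left
    inverse is all that a normal form still requires. *)
Lemma krylov_FNF A w V : V *m krylov A w = 1%:M ->
  is_FNF A (krylov A w) (companion n' (char_poly A)) V.
Proof.
move=> VU; have [uV uU] := mulmx1_unit VU.
have UV := mulmx1C VU.
have VE : V = invmx (krylov A w).
  by rewrite -[V]mulmx1 -(mulmxV uU) mulmxA VU mul1mx.
split=> //; rewrite krylov_companion ?size_char_poly ?char_poly_monic //.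
  by rewrite -mulmxA UV mulmx1.
exact: Cayley_Hamilton.
Qed.

Lemma hank_tr A w z f : hank A^T z w f = hank A w z f.
Proof.
rewrite /hank horner_mx_tr.
have -> : z^T *m (horner_mx A f *m w) = (w^T *m ((horner_mx A f)^T *m z))^T.
  by rewrite !trmx_mul !trmxK !mulmxA.
by rewrite [RHS]mxE.
Qed.

Lemma hnum_tr p A w z : hnum p A^T z w = hnum p A w z.
Proof.
by apply/polyP => i; rewrite !coef_poly; case: ifP => // _; apply: eq_bigr => k _; rewrite hank_tr.
Qed.

Lemma tri_quot s p A (w z : 'cV[F]_n) : nreg s 0 n -> p \is monic -> size p = n.+1 ->
  horner_mx A p = 0 -> krylov A w \in unitmx -> krylov A^T z \in unitmx ->
  farr s 107 (n * n) (array_of_mx (krylov A w)) ->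
  farr s 108 (n * n) (array_of_mx (krylov A^T z)) ->
  farr s 15 (2 * n) (fun i => p`_i) ->
  tri n quot_prog s (fun s' => exists q : {poly F}, [/\ (size q <= n)%N, (q * hnum p A w z) %% p = 1 %% p &
     farr s' 75 n (fun i => q`_i)]).
Proof.
move=> r0 pm ps Ap uw uz h107 h108 h15; have t1 := n_trip n'.
have n2 : (n.+1 <= 2 * n)%N by lia.
(* Column 0 of array 107 is w and column k of array 108 is (A^T)^k z; their inner product is z^T A^k
   w. *)
apply: (@tri_seq _ _ _ _ _ (fun s' => farr s' 76 n (fun k => hank A w z 'X^k))).
  apply: tri_conseq.
    apply: (@tri_sum _ _ _ _ _ _ _ _ _ _ _ n (fun i => n)
      (fun k j => w (inord j) 0 * (krylov A^T z) (inord j) (inord k))) => //.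
    - by move=> s' i _ FR _; rewrite /sim in FR; carry FR.
    - move=> s' k j km jn FR ek ej; rewrite /sim in FR; carry FR.
      rewrite /= ek ej r0 h108 ?ltn_mulD // array_mxE // -[(j * n)%N]addn0 h107 ?ltn_mulD // array_mxE //.
      rewrite [krylov A w _ _]mxE inordK // expr0 mul1mx; congr (w _ _ * _).
  move=> s' _ h k km; rewrite h // -hank_tr /hank horner_mx_Xn mxE.
  by apply: eq_bigr => j _; rewrite inord_val !mxE inordK.
move=> s1 f1 /= h76; carry f1.
apply: tri_seq (tri_cpm (f := p) (ltn0Sn n') r0 _ _ _ (sub_farr n2 h15)) _ => // s2 f2 h50.
rewrite /parr /= in f2 h50; carry f2.
set H := hnum p A w z; have sH : (size H <= n)%N by apply: size_poly.
apply: (@tri_seq _ _ _ _ _ (fun s' => parr n s' 51 H)).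
  apply: tri_conseq.
    apply: (@tri_sum _ _ _ _ _ _ _ _ _ _ _ n.+1 (fun i => n * (i < n))%N
      (fun i k => p`_(i + k.+1) * hank A w z 'X^k)) => //.
    - by rewrite nvalD [nval _ rn]r0 addn1.
    - exact: m_trip.
    - move=> s' i i1 FR ei; rewrite /sim in FR; carry FR.
      rewrite nvalM (below_nE r0 ei) ?[nval _ rn]r0; last lia.
      by split=> //; case: (i < n)%N; rewrite ?muln1 ?muln0.
    - move=> s' i k i1; case: (ltnP i n) => im; rewrite ?muln0 // muln1 => kn FR ei ek.
      rewrite /sim in FR; carry FR; rewrite /= ei ek h76 // addn1 addSnnS h15 //; lia.
  move=> s' _ h i i1; rewrite h // coef_poly; case: ltnP => _; rewrite ?muln1 //.
  by rewrite muln0 big_ord0.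
move=> s3 f3 h51; rewrite /parr /= in f3 h51; carry f3.
apply: tri_seq (tri_egcd (ltn0Sn n') r0 ps sH h50 h51) _ => // s4 f4 [f [tf [tg [[fE _ pd stf] _ {}h50 h52 _]]]].
rewrite /parr /= in h50 h52; carry f4.
have cop : coprimep p H by rewrite coprimep_sym; apply: hnum_coprime.
have sf : size f = 1%N by rewrite (eqp_size fE); apply/eqP; rewrite -/(coprimep p H).
(* Coprimality makes the gcd a constant c, so the cofactor divided by c is the modular inverse. *)
have [c c0 fc] : exists2 c, c != 0 & f = c%:P.
  exists f`_0; last by apply: size1_polyC; rewrite sf.
  by rewrite -[f`_0]/(f`_(1%N.-1)) -sf -lead_coefE lead_coef_eq0 -size_poly_eq0 sf.
apply: tri_conseq.
  apply: (@tri_map _ _ _ _ _ _ _ _ _ n 0 (fun i => tf`_i / c)) => //.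
  move=> s' i im FR ei; rewrite /sim in FR; carry FR.
  by rewrite /= ei h52 ?h50 // ?fc ?coefC //; lia.
move=> s5 _ [h75 _]; exists (c^-1 *: tf); split.
- by rewrite (leq_trans (size_scale_leq _ _)).
- apply/eqP; rewrite -subr_eq0 -modpN -modpD -/(dvdp _ _) -(dvdpZr _ _ c0) scalerBr scalerAl scalerA.
  by rewrite divff // scale1r alg_polyC -fc -opprB dvdpNr.
- by move=> i im; rewrite coefZ mulrC; apply: h75.
Qed.

Lemma tri_tr dst src s (X : 'M[F]_n) : nreg s 0 n -> (dst != 99)%N -> (src != 99)%N -> (src != dst)%N ->
  farr s src (n * n) (array_of_mx X) ->
  tri n (tr_prog dst src) s (fun s' => farr s' dst (n * n) (array_of_mx X^T)).
Proof.
move=> r0 d99 s99 sd h; apply: tri_conseq.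
  apply: (@tri_map _ _ _ _ _ _ _ _ _ (n * n)%N 0 (array_of_mx X^T)) => //.
  - exact: nnE.
  - exact: nn_trip.
  - move=> s' i im FR ei; split=> //; have {}r0 := nreg_frame (a := 0%N) FR isT r0.
    have i1 : (i %/ n < n)%N by rewrite ltn_divLR.
    have i2 : (i %% n < n)%N by rewrite ltn_mod.
    case: FR => _ hF _; rewrite fvalG nvalD nvalM nvalQ nval_mod [nval _ i90]ei [nval _ rn]r0.
    rewrite hF ?h ?ltn_mulD //; last by rewrite !inE negb_or sd s99.
    by rewrite array_mxE // [in RHS](divn_eq i n) array_mxE // mxE.
by move=> s' _ [h' _].
Qed.

Lemma tri_companion s p : nreg s 0 n -> farr s 15 (2 * n) (fun i => p`_i) ->
  tri n companion_prog s (fun s' => farr s' 1 (n * n) (array_of_mx (companion n' p))).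
Proof.
move=> r0 h15; have t2 := nn_trip.
have dm i : (i < n * n)%N -> (i %/ n < n)%N /\ (i %% n < n)%N.
  by move=> im; rewrite ltn_divLR // ltn_mod.
apply: (@tri_seq _ _ _ _ _ (fun s' => farr s' 77 (n * n) (fun v => (v %/ n == (v %% n).+1)%N%:R))).
  apply: tri_conseq.
    apply: (@tri_sum _ _ _ _ _ _ _ _ _ _ _ (n * n)%N
      (fun v => 1 - ((v %/ n - (v %% n).+1) + ((v %% n).+1 - v %/ n)))%N (fun _ _ => 1)) => //.
    - exact: nnE.
    - move=> s' i im FR ei; rewrite /sim in FR; carry FR; split; last first.
        by apply: leq_trans (leq_subr _ _) (one_trip n').
      by rewrite !nvalE [nval _ i90]ei [nval _ rn]r0 addn1.
  move=> s' _ h v vn; rewrite h // sum_guard.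
  case: eqP => [e|ne]; case: eqP => // ?; exfalso; lia.
move=> s1 f1 h77; rewrite /= in f1; carry f1.
apply: tri_conseq.
  apply: (@tri_msum _ _ _ _ _ _ _ _ _ _ _ _ _ (n * n)%N 0 (fun v => 1 - (n' - v %% n))%N
      (fun v => (v %/ n == (v %% n).+1)%N%:R) (fun v _ => - p`_(v %/ n))) => //.
  - exact: nnE.
  - move=> s' i im FR ei; rewrite /sim in FR; carry FR; split.
    + by rewrite !nvalE [nval _ i90]ei [nval _ rn]r0 subn1.
    + by apply: leq_trans (leq_subr _ _) (one_trip n').
    + by rewrite /= ei h77.
  - move=> s' i j im jM FR ei _; rewrite /sim in FR; carry FR; have [i1 i2] := dm _ im.
    by rewrite !fvalE nvalQ [nval _ i90]ei [nval _ rn]r0 h15 ?[fval _ FZero]/(0 : F) ?sub0r //; lia.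
move=> s2 _ [h _] v vn; have [i1 i2] := dm _ vn.
rewrite -[v in LHS]add0n h // sum_guard [in RHS](divn_eq v n) array_mxE // mxE !inordK //.
have [e|ne] := eqVneq (v %% n)%N n'.
  by rewrite e subnn eqxx (ltn_eqF (i1 : _ < n'.+1)%N) add0r.
by rewrite (_ : (n' - v %% n == 0)%N = false) ?addr0 //; lia.
Qed.

Lemma generic_dvdp A h : generic A -> horner_mx A h = 0 -> char_poly A %| h.
Proof. by move=> -> /mxminpoly_min. Qed.

(** The minimal polynomial of [A^T] annihilates [A], so the common characteristic polynomial divides
    it. *)
Lemma generic_tr A : generic A -> generic A^T.
Proof.
move=> gA; apply/eqP; rewrite -eqp_monic ?char_poly_monic ?mxminpoly_monic //.
rewrite /eqp mxminpoly_dvd_char andbT char_poly_tr; apply: generic_dvdp => //.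
by rewrite -{1}[A]trmxK horner_mx_tr mx_root_minpoly trmx0.
Qed.

Lemma FNF_mul A U C V : is_FNF A U C V ->
  V *m U = 1%:M /\ A = U *m companion n' (char_poly A) *m V.
Proof. by case=> uU -> <- ->; rewrite mulVmx. Qed.

Lemma tri_inv_mx l K Lam s p A (w z : 'cV[F]_n) (q : {poly F}) : radix F n l K Lam ->
  mulenv n l K Lam s -> p \is monic -> size p = n.+1 -> horner_mx A p = 0 ->
  (size q <= n)%N -> (q * hnum p A w z) %% p = 1 %% p ->
  farr s 105 (n * n) (array_of_mx (krylov A^T z)) -> farr s 19 n.+1 (fun i => p`_i) ->
  farr s 18 (2 * n) (iser n' p) -> farr s 75 n (fun i => q`_i) ->
  tri n inv_prog s (fun s' => exists2 V, V *m krylov A w = 1%:M &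
     farr s' 106 (n * n) (array_of_mx V^T)).
Proof.
move=> R E pm ps Ap sq qi h105 h19 h18 h75.
have Atp : horner_mx A^T p = 0 by rewrite horner_mx_tr Ap trmx0.
apply: tri_conseq.
  apply: (tri_inv R (rho := fun r => tcoef A z (inord r)) E pm ps _ _ h105 h19 h18 h75).
  - move=> r rn k; have := recur_krylov ps (delta_mx 0 (inord r)) z Atp k.
    by move=> h; rewrite -[RHS]h; apply: eq_bigr => i _; rewrite -rowE [in RHS]mxE.
  - by move=> r k rn kn; rewrite array_mxE // mxE inordK.
move=> s' _ h; eexists; first exact: (krylov_inv pm ps Ap sq qi).
by apply: farr_mx => i j; rewrite h // !mxE inord_val.
Qed.

Lemma tri_main s A U C V Ut Ct Vt (a b : 'cV[F]_n) (A' := A + a *m b^T) :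
  is_FNF A U C V -> is_FNF A^T Ut Ct Vt -> generic A' -> nreg s 0 n ->
  farr s 0 (n * n) (array_of_mx U) -> farr s 1 (n * n) (array_of_mx C) ->
  farr s 2 (n * n) (array_of_mx V) -> farr s 3 (n * n) (array_of_mx Ut) ->
  farr s 5 (n * n) (array_of_mx Vt) -> farr s 6 n (array_of_mx a) -> farr s 7 n (array_of_mx b) ->
  tri n main_prog s (fun s' => exists U' C' V' Ut' Vt',
    [/\ is_FNF A' U' C' V', is_FNF A'^T Ut' C' Vt',
      [/\ farr s' 0 (n * n) (array_of_mx U'), farr s' 1 (n * n) (array_of_mx C')
        & farr s' 2 (n * n) (array_of_mx V')] &
      [/\ farr s' 3 (n * n) (array_of_mx Ut'), farr s' 4 (n * n) (array_of_mx C')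
        & farr s' 5 (n * n) (array_of_mx Vt')]]).
Proof.
move=> N Nt gA r0 h0 h1 h2 h3 h5 h6 h7; have t1 := n_trip n'; have t2 := nn_trip.
have n2 : (n.+1 <= 2 * n)%N by lia.
have [VU AE] := FNF_mul N; have [VUt AtE] := FNF_mul Nt; rewrite char_poly_tr in AtE.
set p := char_poly A in AE AtE; set x := char_poly A'.
have CE : C = companion n' p by case: N.
have pm : p \is monic by apply: char_poly_monic.
have ps : size p = n.+1 by apply: size_char_poly.
have xm : x \is monic by apply: char_poly_monic.
have xs : size x = n.+1 by apply: size_char_poly.
have Ax : horner_mx A' x = 0 by apply: Cayley_Hamilton.
apply: tri_seq (tri_setup (ltn0Sn n') r0) _ => s1 f1 [l [K [Lam [R E]]]]; carryA f1.
rewrite CE in h1; apply: tri_seq (tri_charpoly r0 pm ps h1) _ => s2 f2 h10; carryA f2.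
apply: tri_seq (tri_input r0 _ h0 h2 h6 h7) _ => // s3 f3 [h100 h101 h102 h103]; carryA f3.
apply: tri_seq (tri_half (b := b) R _ VU E pm ps h100 h101 h102 h103 h10) _.
  by rewrite -AE => h; apply: generic_dvdp.
rewrite -AE -/A' -/x => s4 f4 [w [uw h104 _]]; clear h100 h101 h102 h103; carryA f4.
apply: tri_seq (tri_cp _ _ _ (nnE r0) t2 h104) _ => // s5 f5 h107; clear h104; rewrite /= in f5; carryA f5.
apply: tri_seq (tri_input r0 _ h3 h5 h7 h6) _ => // s6 f6 [h100 h101 h102 h103]; carryA f6.
(* Transposition exchanges a and b: the same program runs on the second normal form with the vectors
   swapped. *)
have AtE' : A'^T = Ut *m companion n' p *m Vt + b *m a^T.
  by rewrite -AtE linearD /= trmx_mul trmxK.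
apply: tri_seq (tri_half (b := a) R _ VUt E pm ps h100 h101 h102 h103 h10) _.
  by rewrite -AtE' => h; apply: generic_dvdp; apply: generic_tr.
rewrite -AtE' char_poly_tr -/x => s7 f7 [z [uz h104 h15]]; clear h100 h101 h102 h103; carryA f7.
apply: tri_seq (tri_cp _ _ _ (nnE r0) t2 h104) _ => // s8 f8 h108; rewrite /= in f8; carryA f8.
apply: tri_seq (tri_quot r0 xm xs Ax uw uz h107 h108 h15) _ => s9 f9 [q [sq qi h75]]; carryA f9.
apply: (@tri_seq _ _ _ _ _ (fun s' => farr s' 61 n (fun i => x`_i))).
  by apply: tri_cp => //; apply: sub_farr h15; rewrite leq_pmull.
move=> s10 f10 h61; rewrite /= in f10; carryA f10.
apply: tri_seq (tri_iser r0 h61) _ => s11 f11 h18; carryA f11.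
apply: tri_seq (tri_cpm (f := x) (ltn0Sn n') r0 _ _ _ (sub_farr n2 h15)) _ => // s12 f12 h19.
rewrite /parr /= in f12 h19; carryA f12.
apply: tri_seq (tri_cp _ _ _ (nnE r0) t2 h108) _ => // s13 f13 h105; rewrite /= in f13; carryA f13.
apply: tri_seq (tri_inv_mx R E xm xs Ax sq qi h105 h19 h18 h75) _ => s14 f14 [V' VU' h106].
clear h105; carryA f14.
apply: tri_seq (tri_cp _ _ _ (nnE r0) t2 h106) _ => // s15 f15 h109; rewrite /= in f15; clear h106; carryA f15.
apply: tri_seq (tri_cp _ _ _ (nnE r0) t2 h107) _ => // s16 f16 h105; rewrite /= in f16; carryA f16.
(* The second inversion is the first one for A'^T, with the roles of w and z exchanged. *)
rewrite -[A']trmxK in h105; rewrite -(hnum_tr x A' w z) in qi.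
have Atx : horner_mx A'^T x = 0 by rewrite horner_mx_tr Ax trmx0.
apply: tri_seq (tri_inv_mx R E xm xs Atx sq qi h105 h19 h18 h75) _ => s17 f17 [Vt' VUt' h106].
clear h105; carryA f17; clear h0 h1 h2 h3 h5 h6 h7.
apply: tri_seq (tri_cp _ _ _ (nnE r0) t2 h107) _ => // s18 f18 h0; rewrite /= in f18; carryA f18.
apply: tri_seq (tri_cp _ _ _ (nnE r0) t2 h108) _ => // s19 f19 h3; rewrite /= in f19; carryA f19.
apply: tri_seq (tri_tr r0 _ _ _ h109) _ => // s20 f20 h2; rewrite /= in f20; carryA f20.
apply: tri_seq (tri_tr r0 _ _ _ h106) _ => // s21 f21 h5; rewrite /= in f21; carryA f21.
apply: tri_seq (tri_companion r0 h15) _ => s22 f22 h1; rewrite /= in f22; carryA f22.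
apply: tri_conseq (tri_cp _ _ _ (nnE r0) t2 h1) _ => // s23 f23 h4; rewrite /= in f23; carryA f23.
rewrite !trmxK in h2 h5.
exists (krylov A' w), (companion n' x), V', (krylov A'^T z), Vt'; split=> //.
  exact: krylov_FNF.
by rewrite /x -char_poly_tr; apply: krylov_FNF.
Qed.

End Prog3.

(** * Running time *)

Definition main_time (n : nat) :=
  wcoef main_prog * (n ^ 2 * bitlen n ^ deglog main_prog) * bitlen (cellmax n) ^ 2.

(** The quadratic time appears here: [degn main_prog] evaluates to 2. *)
Lemma weight_main n : 0 < n ->
  weight n main_prog * bitlen (cellmax n) ^ 2 <= main_time n.
Proof. by move=> n0; rewrite leq_mul2r (weight_bound main_prog n0) orbT. Qed.

Lemma bitlen_cellmax n : bitlen (cellmax n) <= (bitlen tripc + 4) * bitlen n.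
Proof.
apply: leq_trans (bitlenM _ _) _; rewrite mulnDl.
by apply: leq_add; [rewrite leq_pmulr | apply: leq_trans (bitlenX n 3) _; have := bitlen_gt0 n; lia].
Qed.

Lemma main_time_le n :
  main_time n <= wcoef main_prog * (bitlen tripc + 4) ^ 2 * (n ^ 2 * bitlen n ^ (deglog main_prog + 2)).
Proof.
rewrite /main_time; set w := wcoef _; set k := deglog _.
apply: (@leq_trans (w * (n ^ 2 * bitlen n ^ k) * ((bitlen tripc + 4) * bitlen n) ^ 2)).
  by rewrite leq_mul2l leq_exp2r ?bitlen_cellmax ?orbT.
by rewrite expnD expnMn; apply/eq_leq; move: (bitlen n ^ k) (n ^ 2) (bitlen n ^ 2) (_ ^ 2); lia.
Qed.

Section SoftO.
Local Open Scope ring_scope.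
Variable R : realType.

Lemma bitlen_ln (n : nat) : (1 < n)%N -> (bitlen n)%:R <= 2 / ln 2 * ln (n%:R : R).
Proof.
move=> n1; have l2 : 0 < ln (2 : R) by rewrite ln_gt0 // ltr1n.
have n0 : (0 < n)%N by apply: ltnW.
have le2 : ln (2 : R) <= ln n%:R by rewrite ler_ln ?ler_nat // posrE ltr0n.
have lt : (trunc_log 2 n)%:R * ln 2 <= ln (n%:R : R).
  by rewrite mulr_natl -lnXn ?ltr0n // -natrX ler_ln ?ler_nat ?trunc_logP ?posrE ?ltr0n ?expn_gt0.
rewrite mulrAC ler_pdivlMr // /bitlen -addn1 natrD mulrDl mul1r mulr2n mulrDl !mul1r.
exact: lerD.
Qed.

(** From n = 2 on, bit lengths are at most (2 / ln 2) ln n. The constant uses c + 1 so as to be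
    positive even for c = 0. *)
Lemma soft_O_poly (T : nat -> nat) (c k : nat) :
  (forall n, T n <= c * (n ^ 2 * bitlen n ^ k))%N ->
  soft_O (fun n => (T n)%:R : R) (fun n => n%:R ^+ 2).
Proof.
move=> hT; exists k; apply/eqO_exP; exists (c.+1%:R * (2 / ln 2) ^+ k) => /=.
  by rewrite mulr_gt0 ?ltr0n // exprn_gt0 // divr_gt0 ?ln_gt0 ?ltr1n.
near=> n; have n1 : (1 < n)%N by near: n; exists 2%N.
have ln0 : 0 <= ln (n%:R : R) by rewrite ln_ge0 // ler1n ltnW.
rewrite ger0_norm ?ler0n // ger0_norm ?mulr_ge0 ?exprn_ge0 ?ler0n //.
apply: le_trans (_ : (c * (n ^ 2 * bitlen n ^ k))%:R <= _); first by rewrite ler_nat.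
rewrite natrM natrM !natrX.
apply: (@le_trans _ _ (c%:R * (n%:R ^+ 2 * (2 / ln 2 * ln n%:R) ^+ k))).
  rewrite ler_wpM2l // ler_wpM2l ?exprn_ge0 // lerXn2r ?nnegrE ?bitlen_ln //.
  by rewrite mulr_ge0 // divr_ge0 // ln_ge0 // ler1n.
rewrite exprMn [n%:R ^+ 2 * _]mulrCA !mulrA !ler_wpM2r ?exprn_ge0 ?ler_nat //.
by rewrite divr_ge0 // ln_ge0 // ler1n.
Unshelve. all: by end_near.
Qed.

Lemma prob1 (F : finFieldType) m (E : m.-tuple F -> Prop) : (forall r, E r) -> prob R E = 1.
Proof.
move=> h; rewrite /prob (_ : [set r : m.-tuple F | `[< E r >]] = [set: m.-tuple F])%SET.
  rewrite cardsT card_tuple divff // pnatr_eq0 -lt0n expn_gt0.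
  by apply/orP; left; apply/card_gt0P; exists 0.
by apply/setP => r; rewrite !inE; apply/asboolP; apply: h.
Qed.

End SoftO.

Section Run.
Local Open Scope ring_scope.
Variables (F : fieldType) (n' : nat).
Local Notation n := n'.+1.

(** The tape is arbitrary, since compiled programs contain no draw. *)
Lemma main_exec (A U C V Ut Ct Vt : 'M[F]_n) (a b : 'cV[F]_n) (r : seq F) (A' := A + a *m b^T) :
  is_FNF A U C V -> is_FNF A^T Ut Ct Vt -> generic A' ->
  exists s t, [/\ exec (compile main_prog) (init_state U C V Ut Ct Vt a b r) s t, (t <= main_time n)%N,
    is_FNF A' (output n s 0) (output n s 1) (output n s 2) &
    is_FNF A'^T (output n s 3) (output n s 4) (output n s 5)].
Proof.
move=> N Nt gA; set s0 := init_state _ _ _ _ _ _ _ _ _.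
have := tri_main (s := s0) N Nt gA.
have sm : small n s0.
  move=> k i /=; case: ifP => // _; rewrite /cellmax.
  apply: leq_trans (_ : n ^ 3 <= _)%N; first by rewrite -{1}(expn1 n) leq_pexp2l.
  by rewrite leq_pmull // /tripc -lock expn_gt0.
rewrite triE; case=> // ok_main [U' [C' [V' [Ut' [Vt' [N1 N2 [h0 h1 h2] [h3 h4 h5]]]]]]].
have [//|//|_ [t tw ex]] := exec_compile _ _ sm ok_main.
have outE k (X : 'M[F]_n) : farr (den main_prog s0) k (n * n) (array_of_mx X) ->
    output n (den main_prog s0) k = X.
  by move=> h; apply/matrixP => i j; rewrite mxE h ?ltn_mulD // array_mxE // !inord_val.
exists (den main_prog s0), t; split=> //.
- exact: leq_trans tw (weight_main _).
- by rewrite (outE _ _ h0) (outE _ _ h1) (outE _ _ h2).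
- by rewrite (outE _ _ h3) (outE _ _ h4) (outE _ _ h5).
Qed.

End Run.

Local Open Scope ring_scope.

Theorem theorem2 (R : realType) (c : R) (hc : 1 <= c) :
  exists (P : cmd) (T : nat -> nat),
    soft_O (fun n : nat => (T n)%:R : R) (fun n : nat => n%:R ^+ 2) /\
    forall (F : finFieldType) (n' : nat) (n := n'.+1)
        (A U C V Ut Ct Vt : 'M[F]_n) (a b : 'cV[F]_n)
        (A' := A + a *m b^T),
      generic A ->
      is_FNF A U C V -> is_FNF A^T Ut Ct Vt ->
      generic A' ->
      (forall r : (T n).-tuple F, exists (s : state F) (t : nat),
         exec P (init_state U C V Ut Ct Vt a b r) s t /\ (t <= T n)%N) /\
      1 - 1 / (n%:R `^ c) <=
        prob R (fun r : (T n).-tuple F => exists (s : state F) (t : nat),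
          [/\ exec P (init_state U C V Ut Ct Vt a b r) s t,
              is_FNF A' (output n s 0) (output n s 1) (output n s 2) &
              is_FNF A'^T (output n s 3) (output n s 4) (output n s 5)]).
Proof.
exists (compile main_prog), main_time; split; first exact: soft_O_poly main_time_le.
move=> F n' n A U C V Ut Ct Vt a b A' _ N Nt gA'; split=> [r|].
  by have [s [t [ex lt _ _]]] := main_exec r N Nt gA'; exists s, t.
(* The event is certain, and its probability 1 exceeds the bound for every c. *)
rewrite prob1 ?gerBl ?divr_ge0 ?powR_ge0 // => r.
by have [s [t [ex _ N1 N2]]] := main_exec r N Nt gA'; exists s, t.
Qed.
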